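(* Let $\mathcal{A}:\operatorname{Dom}(\mathcal{A})\subset\mathcal{X}\to\mathcal{X}$ be the uncontrolled ($V(t)=0$) piezoelectric actuator operator defined in the context. Then $\mathcal{A}$ generates a strongly continuous semigroup of contractions $(T(t))_{t\ge 0}$ on $(\mathcal{X},\langle\cdot,\cdot\rangle_{\mathcal{X}})$, i.e. $\|T(t)\|\le 1$ for all $t\ge0$.
   Context: Parameters: $\rho,\mu,\beta,C^E_{11}>0$, $\gamma\in\mathbb{R}$, $C:=C^E_{11}+\gamma^2\beta$. Geometry: $g_b>0$, $h_a<h_b$, and $$A:=2g_b(h_b-h_a),\qquad I:=\tfrac23 g_b(h_b^3-h_a^3),\qquad I_0:=g_b(h_b^2-h_a^2).$$ Spaces (real-valued functions on $(0,1)$, a prime denotes the derivative in $z\in(0,1)$): $H^1_0(0,1):=\{f\in H^1(0,1)\mid f(0)=0\}$ (vanishing only at $z=0$), and $$\mathcal{X}:=H^1_0(0,1)^3\times L^2(0,1)^3.$$ Elements are written $x=(x_1,\dots,x_6)$; they represent $(v,w_z,q,\dot v,\dot w_z,\dot q)$ (longitudinal displacement, rotation, charge, and their time derivatives). Inner product: $$\begin{aligned}\langle x,y\rangle_{\mathcal{X}}:=\int_0^1\big[&CA\,x_1'y_1'+CI\,x_2'y_2'-CI_0(x_1'y_2'+x_2'y_1')-\gamma\beta A(x_1'y_3'+x_3'y_1')+\gamma\beta I_0(x_2'y_3'+x_3'y_2')\\&+\beta A\,x_3'y_3'+\rho A\,x_4y_4+\rho I\,x_5y_5-\rho I_0(x_4y_5+x_5y_4)+\mu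 A\,x_6y_6\big]\,dz.\end{aligned}$$ Operator: $$\mathcal{A}x=\Big(x_4,\;x_5,\;x_6,\;\tfrac{C}{\rho}x_1''-\tfrac{\gamma\beta}{\rho}x_3'',\;\tfrac{C}{\rho}x_2'',\;-\tfrac{\gamma\beta}{\mu}x_1''+\tfrac{\gamma\beta I_0}{\mu A}x_2''+\tfrac{\beta}{\mu}x_3''\Big),$$ with $\operatorname{Dom}(\mathcal{A})$ the set of $x\in\mathcal{X}$ with $x_1,x_2,x_3\in H^2(0,1)\cap H^1_0(0,1)$, $x_4,x_5,x_6\in H^1_0(0,1)$ and $$\begin{aligned}&CA\,x_1'(1)-CI_0\,x_2'(1)-\gamma\beta A\,x_3'(1)=0,\\&CI\,x_2'(1)-CI_0\,x_1'(1)+\gamma\beta I_0\,x_3'(1)=0,\\&\beta A\,x_3'(1)-\gamma\beta\big(A\,x_1'(1)-I_0\,x_2'(1)\big)=0.\end{aligned}$$ *)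

(* Defs.v *)
From HB Require Import structures.
From mathcomp Require Import all_boot all_order all_algebra.
From mathcomp Require Import all_classical all_reals all_analysis.
From mathcomp Require Import measurable_realfun.
Set Implicit Arguments.
Unset Strict Implicit.
Unset Printing Implicit Defensive.
Import Order.TTheory GRing.Theory Num.Theory.
Import numFieldNormedType.Exports.
Local Open Scope classical_set_scope.
Local Open Scope ring_scope.

Section Lspace2.
Context d (T : measurableType d) (R : realType).
Variable mu : {measure set T -> \bar R}.
Notation L2 := (LspaceType2 mu).

(* The elements of LspaceType2 mu are classes of functions modulo equality
   mu-a.e.; the operations below are those of (chosen) representatives. *)
Definition Lspace2_fun (f : L2) : T -> R :=
  aqEqMfun_to_fun (LebesgueSpace.sort f).
Coercion Lspace2_fun : LspaceType2 >-> Funclass.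

HB.instance Definition _ := gen_eqMixin L2.
HB.instance Definition _ := gen_choiceMixin L2.

Lemma Lspace2_eq (f g : L2) : f = g %[ae mu] -> f = g.
Proof.
case: f g => f [[pf]] [g [[pg]]] fg.
have e : f = g.
  by rewrite -[f]reprK -[g]reprK; apply/eqP; rewrite eqmodE; exact/asboolP.
by move: pg {fg}; rewrite -e => pg; rewrite (Prop_irrelevance pf pg).
Qed.

Lemma Lspace2_Lfun (f : L2) : (f : T -> R) \in Lfun mu 2%:E.
Proof.
rewrite inE; apply/andP; split; rewrite inE/=; last first.
  exact: (@Lebesgue_finite _ _ _ _ _ _ f).
exact: (measurable_funPT (repr (LebesgueSpace.sort f))).
Qed.

Lemma ae_eq_finite_norm2 (f g : T -> R) :
  measurable_fun setT f -> measurable_fun setT g ->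
  f = g %[ae mu] -> finite_norm mu 2%:E f -> finite_norm mu 2%:E g.
Proof.
move=> mf mg fg; rewrite /finite_norm unlock.
suff -> : (\int[mu]_x (`|(EFin \o f) x| `^ 2) =
           \int[mu]_x (`|(EFin \o g) x| `^ 2))%E by [].
have mpow (h : T -> R) : measurable_fun setT h ->
    measurable_fun setT ((fun x => `|(EFin \o h) x| `^ 2)%E : T -> \bar R).
  move=> mh.
  apply: (@measurableT_comp _ _ _ _ _ _ (fun x : \bar R => x `^ 2)%E) => //.
    exact: measurable_poweR.
  by apply: measurableT_comp => //; exact/measurable_EFinP.
apply: ae_eq_integral => //; [exact: mpow|exact: mpow|].
by apply: filterS fg => x + _ => /(_ I) /= ->.
Qed.

Lemma Lspace2_class_ex (f : T -> R) :
  f \in Lfun mu 2%:E -> exists g : L2, g = f %[ae mu].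
Proof.
rewrite inE => /andP[]; rewrite !inE/= => mf Nf.
pose F : {mfun T >-> measurableTypeR R} :=
  @mfun_Sub _ _ T (measurableTypeR R) f (mem_set mf).
pose Q := {mfun_ mu, T >-> measurableTypeR R}.
pose q : Q := \pi_(Q)%qT F.
have qF : (repr q : T -> R) = F %[ae mu].
  apply/asboolP; rewrite -[X in is_true X]/(ae_eq_op mu (repr q) F).
  have : (repr q == F %[mod Q])%qT by rewrite reprK.
  by rewrite eqmodE.
have Nq : finite_norm mu 2%:E (repr q : T -> R).
  apply: ae_eq_finite_norm2 Nf => //.
  - exact: (measurable_funPT (repr q)).
  - exact: ae_eq_sym.
by exists (LebesgueSpace.Pack (LebesgueSpace.Class
  (@isFinLebesgue.Build _ _ _ _ _ (lee1n 2) q Nq))).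
Qed.

Definition Lspace2_class (f : T -> R) (fL : f \in Lfun mu 2%:E) : L2 :=
  sval (cid (Lspace2_class_ex fL)).

Lemma Lspace2_classE f fL : @Lspace2_class f fL = f %[ae mu].
Proof. exact: svalP (cid (Lspace2_class_ex fL)). Qed.

Let zeroL : cst 0 \in Lfun mu 2%:E.
Proof. exact: (Lfun_addr_closed mu (lee1n 2)).1. Qed.
Let oppL (f : L2) : \- f \in Lfun mu 2%:E.
Proof.
exact: (@Lfun_oppr_closed _ _ _ mu 2%:E (f : T -> R) (Lspace2_Lfun f)).
Qed.
Let addL (f g : L2) : f \+ g \in Lfun mu 2%:E.
Proof. by apply: (Lfun_addr_closed mu (lee1n 2)).2; exact: Lspace2_Lfun. Qed.
Let scaleL (a : R) (f : L2) : a \*: f \in Lfun mu 2%:E.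
Proof.
have := (Lfun_submod_closed mu (lee1n 2)).2 a f 0 (Lspace2_Lfun f) zeroL.
by rewrite addr0.
Qed.

Definition Lspace2_zero : L2 := Lspace2_class zeroL.
Definition Lspace2_opp (f : L2) : L2 := Lspace2_class (oppL f).
Definition Lspace2_add (f g : L2) : L2 := Lspace2_class (addL f g).
Definition Lspace2_scale (a : R) (f : L2) : L2 := Lspace2_class (scaleL a f).

Let z0 : Lspace2_zero = (cst 0 : T -> R) %[ae mu] := Lspace2_classE zeroL.
Let oE f : Lspace2_opp f = \- f %[ae mu] := Lspace2_classE (oppL f).
Let aE f g : Lspace2_add f g = f \+ g %[ae mu] := Lspace2_classE (addL f g).
Let sE a f : Lspace2_scale a f = a \*: f %[ae mu] :=
  Lspace2_classE (scaleL a f).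

Let addA : associative Lspace2_add.
Proof.
move=> f g h; apply: Lspace2_eq.
apply: filterS (filterI (filterI (aE f (Lspace2_add g h)) (aE g h))
  (filterI (aE (Lspace2_add f g) h) (aE f g))) => x.
by case=> -[] /(_ I)-> /(_ I)/= -> [] /(_ I)-> /(_ I)/= ->; rewrite addrA.
Qed.

Let addC : commutative Lspace2_add.
Proof.
move=> f g; apply: Lspace2_eq.
by apply: filterS2 (aE f g) (aE g f) => x /(_ I)-> /(_ I)-> /=; rewrite addrC.
Qed.

Let add0 : left_id Lspace2_zero Lspace2_add.
Proof.
move=> f; apply: Lspace2_eq.
apply: filterS2 (aE Lspace2_zero f) z0 => x /(_ I)-> /(_ I)/= ->.
by rewrite add0r.
Qed.

Let addN : left_inverse Lspace2_zero Lspace2_opp Lspace2_add.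
Proof.
move=> f; apply: Lspace2_eq.
apply: filterS3 (aE (Lspace2_opp f) f) z0 (oE f) => x.
by move=> /(_ I)-> /(_ I)/= -> /(_ I)/= ->; rewrite addNr.
Qed.

HB.instance Definition _ := GRing.isZmodule.Build L2 addA addC add0 addN.

Let scaleA a b f :
  Lspace2_scale a (Lspace2_scale b f) = Lspace2_scale (a * b) f.
Proof.
apply: Lspace2_eq.
apply: filterS3 (sE a (Lspace2_scale b f)) (sE b f) (sE (a * b) f) => x.
by move=> /(_ I)-> /(_ I)/= -> /(_ I)/= ->; rewrite scalerA.
Qed.

Let scale1 : left_id 1 Lspace2_scale.
Proof.
move=> f; apply: Lspace2_eq.
by apply: filterS (sE 1 f) => x /(_ I)-> _; rewrite /= scale1r.
Qed.

Let scaleDr : right_distributive Lspace2_scale +%R.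
Proof.
move=> a f g; apply: Lspace2_eq.
apply: filterS (filterI (filterI (sE a (f + g)) (aE f g))
  (filterI (aE (Lspace2_scale a f) (Lspace2_scale a g))
    (filterI (sE a f) (sE a g)))) => x.
case=> -[] /(_ I)-> /(_ I)/= -> [] /(_ I)-> [] /(_ I)/= -> /(_ I)/= -> _.
by rewrite scalerDr.
Qed.

Let scaleDl f : {morph Lspace2_scale^~ f : a b / a + b}.
Proof.
move=> a b; apply: Lspace2_eq.
apply: filterS (filterI (sE (a + b) f)
  (filterI (aE (Lspace2_scale a f) (Lspace2_scale b f))
    (filterI (sE a f) (sE b f)))) => x.
case=> /(_ I)-> [] /(_ I)-> [] /(_ I)/= -> /(_ I)/= -> _.
by rewrite scalerDl.
Qed.

HB.instance Definition _ :=
  GRing.Zmodule_isLmodule.Build R L2 scaleA scale1 scaleDr scaleDl.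

Lemma Lspace2_0E : ((0 : L2) : T -> R) = cst 0 %[ae mu].
Proof. exact: z0. Qed.

Lemma Lspace2_DE (f g : L2) : ((f + g : L2) : T -> R) = f \+ g %[ae mu].
Proof. exact: aE. Qed.

Lemma Lspace2_NE (f : L2) : ((- f : L2) : T -> R) = \- f %[ae mu].
Proof. exact: oE. Qed.

Lemma Lspace2_ZE a (f : L2) : ((a *: f : L2) : T -> R) = a \*: f %[ae mu].
Proof. exact: sE. Qed.

End Lspace2.

Section unit_interval.
Variable R : realType.

Lemma lebesgue_unit_itv_lty :
  (@lebesgue_measure R `]0%R, 1%R[%classic < +oo)%E.
Proof.
by rewrite lebesgue_measure_itv/= lte_fin ltr01 -EFinB ltry.
Qed.

(* Lebesgue measure on R restricted to ]0, 1[: functions on R that agree a.e. on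
   ]0, 1[ are identified, so that LspaceType2 mu01 is L^2(0, 1). *)
Definition mu01 : {finite_measure set (measurableTypeR R) -> \bar R} :=
  @mfrestr _ (measurableTypeR R) R _ lebesgue_measure
    (measurable_itv `]0, 1[) lebesgue_unit_itv_lty.

Local Notation L2 := (LspaceType2 mu01).

Lemma continuous_Lfun (psi : R -> R) : continuous psi -> psi \in Lfun mu01 2%:E.
Proof.
move=> cpsi.
have mpsi : measurable_fun setT psi by exact: continuous_measurable_fun.
rewrite inE; apply/andP; split; rewrite inE//=.
have [M M0 psiM] : exists2 M, 0 <= M & forall x, x \in `[0, 1] -> `|psi x| <= M.
  have : {within `[0, 1], continuous (Num.norm \o psi : R -> R)}.
    apply: continuous_subspaceT => x.
    by apply: continuous_comp; [exact: cpsi|exact: norm_continuous].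
  move=> /(EVT_max (@ler01 R)) [c _ cM].
  by exists (`|psi c|).
have aeM : {ae mu01, forall z, `|psi z| <= M}.
  exists (~` `]0, 1[%classic); split => /=.
  - exact: measurableC.
  - by rewrite /mu01/= /mfrestr /mrestr setICl measure0.
  - move=> z /= /negP; rewrite -ltNge => Mz zI.
    move: Mz; apply/negP; rewrite -leNgt.
    by apply: psiM; exact: subset_itv_oo_cc zI.
have psiM2 : (\int[mu01]_z (`|(EFin \o psi) z| `^ 2) <=
    \int[mu01]_z (M `^ 2)%:E)%E.
  apply: ae_ge0_le_integral => //.
  - by move=> z _; rewrite poweR_ge0.
  - apply: (@measurableT_comp _ _ _ _ _ _ (fun x : \bar R => x `^ 2)%E) => //.
      exact: measurable_poweR.
    by apply: measurableT_comp => //; exact/measurable_EFinP.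
  - by move=> z _; rewrite lee_fin powR_ge0.
  - apply: filterS aeM; first exact: (ae_filter_ringOfSetsType mu01).
    move=> z zM _; by rewrite /= lee_fin ge0_ler_powR// nnegrE.
rewrite /finite_norm unlock poweR_lty//; apply: (le_lt_trans psiM2).
by apply: integrable_lty => //; exact: finite_measure_integrable_cst.
Qed.

Lemma integrable_L2_continuous (f : L2) (psi : R -> R) : continuous psi ->
  mu01.-integrable setT (EFin \o (f \* psi)).
Proof.
move=> cpsi; apply/Lfun1_integrable/Lfun2_mul_Lfun1.
  exact: Lspace2_Lfun.
exact: continuous_Lfun.
Qed.

Lemma Rintegral_L2_linear (a : R) (f g : L2) (psi : R -> R) : continuous psi ->
  \int[mu01]_z ((a *: f + g : L2) z * psi z) =
  a * \int[mu01]_z (f z * psi z) + \int[mu01]_z (g z * psi z).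
Proof.
move=> cpsi.
have := integrable_L2_continuous f cpsi.
have := integrable_L2_continuous g cpsi.
have := integrable_L2_continuous (a *: f + g) cpsi.
move=> ih ig jf.
have aif : mu01.-integrable setT (EFin \o (fun z => a * (f z * psi z))).
  rewrite (_ : _ \o _ = (fun z => a%:E * (f z * psi z)%R%:E)%E)//.
  exact: integrableZl.
rewrite -RintegralZl// -RintegralD//.
congr fine; apply: ae_eq_integral => //.
- exact: measurable_int ih.
- exact: measurable_int (integrableD measurableT aif ig).
- have FF := ae_filter_ringOfSetsType mu01.
  apply: (@filterS2 _ _ FF _ _ _ _ (Lspace2_DE (a *: f) g) (Lspace2_ZE a f)).
  by move=> z /(_ I)/= -> /(_ I)/= -> _; rewrite mulrDl mulrA.
Qed.

(* Test functions of class C^1 with compact support in ]0, 1[; in dimension one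
   they define the same weak derivative as the C^oo ones. *)
Definition test_function (phi : R -> R) : Prop :=
  [/\ forall z, derivable phi z 1, continuous (derive1 phi) &
      exists a b, [/\ 0 < a, b < 1 & forall z, phi z != 0 -> a <= z <= b]].

Definition weak_derivative (f g : L2) : Prop :=
  forall phi, test_function phi ->
  \int[mu01]_z (f z * derive1 phi z) = - \int[mu01]_z (g z * phi z).

Definition H1 : set L2 := [set f | exists g, weak_derivative f g].

(* The weak derivative of f if f is in H1, and 0 otherwise. *)
Definition dz (f : L2) : L2 := xget 0 [set g | weak_derivative f g].

Definition H2 : set L2 := [set f | H1 f /\ H1 (dz f)].

(* The point values of a class f, on the closed interval, are those of its
   continuous representative, which exists for f in H1. *)
Definition has_value (f : L2) (a c : R) : Prop :=
  exists u : R -> R, [/\ {within `[0, 1], continuous u},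
    (f : R -> R) = u %[ae mu01] & u a = c].

Definition value_at (f : L2) (a : R) : R := xget 0 [set c | has_value f a c].

Definition H10 : set L2 := [set f | H1 f /\ has_value f 0 0].

Definition H10_pred : {pred L2} := mem H10.

Lemma H10_submod_closed : submod_closed H10_pred.
Proof.
have test_cont phi : test_function phi -> continuous phi.
  move=> [dphi _ _] z; apply: differentiable_continuous.
  exact/derivable1_diffP.
split.
  rewrite inE; split.
    exists 0 => phi tphi; have [_ dphi _] := tphi.
    have int0 psi : continuous psi -> \int[mu01]_z ((0 : L2) z * psi z) = 0.
      move=> cpsi; have := Rintegral_L2_linear 1 0 0 cpsi.
      rewrite scaler0 addr0 mul1r => /eqP.
      by rewrite -subr_eq subrr eq_sym => /eqP.
    by rewrite !int0 ?oppr0//; exact: test_cont.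
  exists (cst 0); split => //; first exact: cst_continuous.
  exact: Lspace2_0E.
move=> a f g; rewrite !inE.
move=> -[[f' ff'] [u [cu fu u0]]] [[g' gg'] [v [cv gv v0]]].
split.
  exists (a *: f' + g') => phi tphi; have [_ dphi _] := tphi.
  rewrite !Rintegral_L2_linear//; last exact: test_cont.
  by rewrite ff'// gg'// mulrN opprD.
exists (fun z => a * u z + v z); split; last by rewrite u0 v0 mulr0 addr0.
  move=> z; apply: cvgD; last exact: cv.
  by apply: cvgMr; exact: cu.
have FF := ae_filter_ringOfSetsType mu01.
apply: (@filterS _ _ FF _ _ _ (@filterI _ _ FF _ _
  (@filterI _ _ FF _ _ (Lspace2_DE (a *: f) g) (Lspace2_ZE a f))
  (@filterI _ _ FF _ _ fu gv))).
move=> z [[/(_ I)/= + /(_ I)/= +] [/(_ I)/= + /(_ I)/= +]] _.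
by move=> -> -> -> ->.
Qed.

HB.instance Definition _ := GRing.isSubmodClosed.Build R L2 H10_pred
  H10_submod_closed.

Record H10type : Type := H10_Sub { H10_val : L2; _ : H10_val \in H10_pred }.

HB.instance Definition _ := [isSub for H10_val].
HB.instance Definition _ := [Choice of H10type by <:].
HB.instance Definition _ := [SubChoice_isSubLmodule of H10type by <:].

End unit_interval.

Coercion H10_val : H10type >-> LspaceType2.
Arguments mu01 : clear implicits.
Notation L2 R := (LspaceType2 (mu01 R)).

Section semigroup.
Context (R : realType) (V : lmodType R) (nrm : V -> R).

Definition opnorm (T : {linear V -> V}) : \bar R :=
  ereal_sup [set (nrm (T x))%:E | x in [set x | nrm x <= 1]].

Definition C0_semigroup (T : R -> {linear V -> V}) : Prop :=
  [/\ forall t : R, 0 <= t -> (opnorm (T t) < +oo)%E,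
      forall x, T 0 x = x,
      forall (s t : R) x, 0 <= s -> 0 <= t -> T (s + t) x = T s (T t x) &
      forall x, nrm (T t x - x) @[t --> 0^'+] --> 0].

(* y is the limit in norm of (T t x - x) / t when t tends to 0 from above. *)
Definition generator_graph (T : R -> {linear V -> V}) (x y : V) : Prop :=
  nrm (t^-1 *: (T t x - x) - y) @[t --> 0^'+] --> 0.

Definition is_generator (T : R -> {linear V -> V}) (D : set V) (A : V -> V) :
    Prop :=
  (forall x, D x <-> exists y, generator_graph T x y) /\
  (forall x, D x -> generator_graph T x (A x)).

End semigroup.

(* The data only; the sign conditions are hypotheses of the statements. *)
Record actuator (R : realType) := Actuator {
  rho : R; mu : R; beta : R; CE11 : R; gamma : R; gb : R; ha : R; hb : R }.

(* (v, w_z, q, v', w_z', q'), where ' is here the time derivative *)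
Definition state (R : realType) : lmodType R :=
  (H10type R * H10type R * H10type R * L2 R * L2 R * L2 R)%type.

Section actuator_operator.
Context (R : realType) (p : actuator R).

Definition stiffness : R := CE11 p + gamma p ^+ 2 * beta p.
Definition area : R := 2 * gb p * (hb p - ha p).
Definition inertia : R := 2 / 3 * gb p * (hb p ^+ 3 - ha p ^+ 3).
Definition inertia0 : R := gb p * (hb p ^+ 2 - ha p ^+ 2).

Local Notation rho := (rho p).
Local Notation mu := (mu p).
Local Notation beta := (beta p).
Local Notation gamma := (gamma p).
Local Notation C := stiffness.
Local Notation A := area.
Local Notation I := inertia.
Local Notation I0 := inertia0.

Definition energy_ip (x y : state R) : R :=
  let: (x1, x2, x3, x4, x5, x6) := x in
  let: (y1, y2, y3, y4, y5, y6) := y in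
  \int[mu01 R]_z (
    C * A * (dz x1 z * dz y1 z) + C * I * (dz x2 z * dz y2 z)
    - C * I0 * (dz x1 z * dz y2 z + dz x2 z * dz y1 z)
    - gamma * beta * A * (dz x1 z * dz y3 z + dz x3 z * dz y1 z)
    + gamma * beta * I0 * (dz x2 z * dz y3 z + dz x3 z * dz y2 z)
    + beta * A * (dz x3 z * dz y3 z)
    + rho * A * (x4 z * y4 z) + rho * I * (x5 z * y5 z)
    - rho * I0 * (x4 z * y5 z + x5 z * y4 z) + mu * A * (x6 z * y6 z)).

Definition energy_norm (x : state R) : R := Num.sqrt (energy_ip x x).

Definition actuator_dom : set (state R) := [set x : state R |
  let: (x1, x2, x3, x4, x5, x6) := x in
  let d1 := value_at (dz x1) 1 in
  let d2 := value_at (dz x2) 1 in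
  let d3 := value_at (dz x3) 1 in
  [/\ [/\ H2 x1, H2 x2 & H2 x3],
      [/\ H10 x4, H10 x5 & H10 x6],
      C * A * d1 - C * I0 * d2 - gamma * beta * A * d3 = 0,
      C * I * d2 - C * I0 * d1 + gamma * beta * I0 * d3 = 0 &
      beta * A * d3 - gamma * beta * (A * d1 - I0 * d2) = 0]].

(* insubd 0 casts a class of L^2 into H^1_0; it is the identity on H^1_0, hence
   on the components 4 to 6 of the elements of actuator_dom. *)
Definition actuator_op (x : state R) : state R :=
  let: (x1, x2, x3, x4, x5, x6) := x in
  let d2 f := dz (dz f) in
  (insubd 0 x4, insubd 0 x5, insubd 0 x6,
   (C / rho) *: d2 x1 - (gamma * beta / rho) *: d2 x3,
   (C / rho) *: d2 x2,
   - (gamma * beta / mu) *: d2 x1 + (gamma * beta * I0 / (mu * A)) *: d2 x2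
     + (beta / mu) *: d2 x3).

End actuator_operator.

(* Main.v *)
Require Import Defs.
From HB Require Import structures.
From mathcomp Require Import all_boot all_order all_algebra.
From mathcomp Require Import all_classical all_reals all_analysis.
From mathcomp Require Import measurable_realfun.
From mathcomp Require Import ring lra.
Set Implicit Arguments.
Unset Strict Implicit.
Unset Printing Implicit Defensive.
Import Order.TTheory GRing.Theory Num.Theory.
Import numFieldNormedType.Exports.
Local Open Scope classical_set_scope.
Local Open Scope ring_scope.

(** With the vector x of the three displacements the system reads
    M x_tt = K x_zz with constant symmetric matrices M and K, with x = 0 at 0 and
    K x_z = 0 at 1, and the squared norm of a state is the integral of
    x_z . K x_z + x_t . M x_t. Both forms are positive definite
    ([inertia_gt], [stiffness_gt0], and the determinant in [modes_exist]), so
    they can be diagonalised together: [modes_exist] provides coordinates in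
    which the system consists of three independent strings
    y_tt = c^2 y_zz, each fixed at 0 and free at 1, and in which the energy is a
    weighted sum of the energies of the strings ([energy_ipE]). The semigroup is
    then written down explicitly, without resolvents.

    The data (y_z, y_t) of a string of speed 1 are the even and the odd part of
    one function w on the line with w (z + 2) = - w z ([represents]), and by
    d'Alembert's formula the string evolves by translation of w ([wave]).
    Translations preserve the L^2 norm over a period ([period_sq_shift]), which is
    the energy ([period_sq_represents]), and they are strongly continuous because
    continuous functions are dense in L^2 ([period_sq_translation_cvg]). Hence the
    three strings make up a strongly continuous semigroup of isometries
    ([semigroup_C0], [opnorm_semigroup]).

    It remains to identify the generator B with the operator A. If a state lies
    in the domain of A, the boundary conditions make each w absolutely
    continuous across the integers, and the difference quotients of a primitive
    converge in L^2 ([period_sq_difference_quotient], [wave_derivative]); so B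
    extends A ([dom_generator_graph]). Moreover A is onto, since a right-hand
    side is integrated once from 0 and once from 1 ([op_onto]), and B is
    injective, since every string reverses its sign after half a period
    ([generator_graph_inj]). An injective extension of a surjective map is that
    map: if B x = y, choose x' with A x' = y; then x = x'
    ([generator_graph_dom]).

    Weak derivatives are handled through primitives: by the lemma of
    du Bois-Reymond a function with weak derivative g is a constant plus the
    primitive of g ([weak_derivative_primP]), which gives the uniqueness of weak
    derivatives and the point values in the boundary conditions. *)

(** * Lebesgue measure under translations and reflections *)

Section lebesgue_invariance.
Context {R : realType}.
Local Notation lam := (@lebesgue_measure R).
Local Notation mR := (measurableTypeR R).
Implicit Types (f : R -> \bar R) (a b t : R).

Lemma measurable_shift t : measurable_fun setT ((fun z => z + t) : mR -> mR).
Proof. by apply: measurable_funD => //; exact: measurable_cst. Qed.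

Lemma lebesgue_measure_shift t (A : set R) : measurable A ->
  pushforward lam ((fun z => z + t) : mR -> mR) A = lam A.
Proof.
move=> mA; apply/esym/lebesgue_measure_unique => //.
  exact: measurable_shift.
move=> ? _ [[a b]] _ <-.
have e : (fun z : R => z + t) @^-1` `]a, b]%classic = `]a - t, b - t]%classic.
  by apply/seteqP; split=> z /=; rewrite !in_itv/= ltrBlDr lerBrDr.
rewrite -[RHS]/(lam ((fun z : R => z + t) @^-1` `]a, b]%classic)) e.
rewrite !lebesgue_measure_itv/= !lte_fin ltrD2r.
by case: ifPn => // _; rewrite -!EFinB; congr EFin; ring.
Qed.

Lemma ge0_integral_shift t (D : set R) f : measurable D ->
  measurable_fun D f -> {in D, forall y, 0 <= f y}%E ->
  (\int[lam]_(z in D) f z =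
   \int[lam]_(z in (fun z => (z + t)%R) @^-1` D) f (z + t)%R)%E.
Proof.
move=> mD mf f0.
rewrite -[RHS](ge0_integral_pushforward (measurable_shift t) lam)//.
apply: eq_measure_integral => [|? A mA _]; first exact: measurable_shift.
exact/esym/lebesgue_measure_shift.
Qed.

Lemma ge0_integral_shift_itv t f (s1 s2 : bool) a b : measurable_fun setT f ->
  (forall y, 0 <= f y)%E ->
  (\int[lam]_(z in [set` Interval (BSide s1 a) (BSide s2 b)]) f (z + t)%R =
   \int[lam]_(z in [set` Interval (BSide s1 (a + t)%R) (BSide s2 (b + t)%R)]) f z)%E.
Proof.
move=> mf f0; rewrite [RHS](ge0_integral_shift t)//.
- congr integral; apply/seteqP; split=> z /=; rewrite !itv_boundlr;
  case: s1; case: s2; rewrite !bnd_simp ?lerD2r ?ltrD2r//.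
- exact: measurable_funTS.
Qed.

Lemma ge0_integral_reflect f (s1 s2 : bool) a b : measurable_fun setT f ->
  (forall y, 0 <= f y)%E ->
  (\int[lam]_(z in [set` Interval (BSide s1 a) (BSide s2 b)]) f (- z)%R =
   \int[lam]_(z in [set` Interval (BSide (~~ s2) (- b)%R) (BSide (~~ s1) (- a)%R)]) f z)%E.
Proof.
move=> mf f0.
have e : [set` Interval (BSide s1 a) (BSide s2 b)] =
  (-%R : mR -> mR) @^-1` [set` Interval (BSide (~~ s2) (- b)) (BSide (~~ s1) (- a))].
  apply/seteqP; split=> z /=; rewrite !itv_boundlr;
  case: s1; case: s2; rewrite /= !bnd_simp ?lerN2 ?ltrN2 andbC//.
rewrite e -ge0_integral_pushforward//.
- apply: eq_measure_integral => //= A mA _; exact: lebesgue_measureN.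
- exact: measurable_funTS.
Qed.

Lemma integral_shift_itv t f (s1 s2 : bool) a b : measurable_fun setT f ->
  (\int[lam]_(z in [set` Interval (BSide s1 a) (BSide s2 b)]) f (z + t)%R =
   \int[lam]_(z in [set` Interval (BSide s1 (a + t)%R) (BSide s2 (b + t)%R)]) f z)%E.
Proof.
move=> mf; rewrite integralE [RHS]integralE.
rewrite -(ge0_integral_shift_itv t (f := f^\+%E))//; last exact: measurable_funepos.
rewrite -(ge0_integral_shift_itv t (f := f^\-%E))//; last exact: measurable_funeneg.
by congr (_ - _)%E; apply: eq_integral => z _; rewrite !unlock.
Qed.

Lemma integral_reflect f (s1 s2 : bool) a b : measurable_fun setT f ->
  (\int[lam]_(z in [set` Interval (BSide s1 a) (BSide s2 b)]) f (- z)%R =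
   \int[lam]_(z in [set` Interval (BSide (~~ s2) (- b)%R) (BSide (~~ s1) (- a)%R)]) f z)%E.
Proof.
move=> mf; rewrite integralE [RHS]integralE.
rewrite -(ge0_integral_reflect (f := f^\+%E))//; last exact: measurable_funepos.
rewrite -(ge0_integral_reflect (f := f^\-%E))//; last exact: measurable_funeneg.
by congr (_ - _)%E; apply: eq_integral => z _; rewrite !unlock.
Qed.

(** For t up to one period, cut the translated interval at 1 and move the part
    that sticks out back by one period; longer translations are iterated short
    ones. *)
Lemma ge0_integral_periodic f t : measurable_fun setT f ->
  (forall y, 0 <= f y)%E -> (forall z, f (z + 2)%R = f z) -> 0 <= t ->
  (\int[lam]_(z in `[(-1)%R, 1%R[) f (z + t)%R =
   \int[lam]_(z in `[(-1)%R, 1%R[) f z)%E.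
Proof.
move=> mf f0 fp t0.
have small s : 0 <= s -> s <= 2 ->
  (\int[lam]_(z in `[(-1)%R, 1%R[) f (z + s)%R =
   \int[lam]_(z in `[(-1)%R, 1%R[) f z)%E.
  move=> s0 s2.
  rewrite (ge0_integral_shift_itv s true true (-1) 1)//.
  have m1 (a b : R) : measurable_fun `[a, b[%classic f by exact: measurable_funTS.
  have -> : `[-1, 1[%classic = `[-1, -1 + s[%classic `|` `[-1 + s, 1[%classic :> set R.
    by rewrite -itv_bndbnd_setU ?bnd_simp//; lra.
  have -> : `[-1 + s, 1 + s[%classic = `[-1 + s, 1[%classic `|` `[1, 1 + s[%classic :> set R.
    by rewrite -itv_bndbnd_setU ?bnd_simp//; lra.
  rewrite !ge0_integral_setU//=; try exact: measurable_itv; try exact: measurable_funTS.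
  - rewrite addeC; congr (_ + _)%E.
    under [RHS]eq_integral do rewrite -fp.
    rewrite (ge0_integral_shift_itv 2 true true (-1) _)//.
    have -> : (-1 + 2 : R) = 1 by ring.
    by have -> : -1 + s + 2 = 1 + s :> R by ring.
  - apply/disj_setPRL => z /=; rewrite !in_itv/= => /andP[h1 h2]; apply/negP.
    by rewrite negb_and -ltNge -leNgt h1 orbT.
  - apply/disj_setPRL => z /=; rewrite !in_itv/= => /andP[h1 h2]; apply/negP.
    by rewrite negb_and -ltNge -leNgt h1 orbT.
have [n] : exists n : nat, t <= n%:R * 2.
  exists (Num.bound t); have := archi_boundP t0 => h.
  by lra.
elim: n t t0 => [|n IH] t t0 tn.
  by apply: small => //; lra.
have [t2|t2] := leP t 2; first exact: small.
rewrite -(IH (t - 2)); [|lra|by move: tn; rewrite -natr1; lra].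
by apply: eq_integral => z _; rewrite -[RHS]fp; congr f; ring.
Qed.

End lebesgue_invariance.

(** * Integrals of squares *)

Section square_integral.
Context d (T : measurableType d) (R : realType).
Variable mu : {measure set T -> \bar R}.
Implicit Types (D : set T) (u v : T -> R).

Definition sqint D u : \bar R := (\int[mu]_(z in D) (u z ^+ 2)%:E)%E.

Lemma sqint_ge0 D u : (0 <= sqint D u)%E.
Proof. by apply: integral_ge0 => z _; rewrite lee_fin sqr_ge0. Qed.

Lemma measurable_sqr D u : measurable_fun D u ->
  measurable_fun D (fun z => (u z ^+ 2)%:E).
Proof. by move=> mu_; apply/measurable_EFinP; exact: measurable_funX. Qed.

Lemma eq_sqint D u v : {in D, u =1 v} -> sqint D u = sqint D v.
Proof. by move=> uv; apply: eq_integral => z zD; rewrite uv. Qed.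

Lemma sqintZ D (k : R) u : measurable D -> measurable_fun D u ->
  sqint D (fun z => k * u z) = ((k ^+ 2)%:E * sqint D u)%E.
Proof.
move=> mD mu_; rewrite /sqint -ge0_integralZl//.
- by apply: eq_integral => z _; rewrite exprMn.
- exact: measurable_sqr.
- by move=> z _; rewrite lee_fin sqr_ge0.
- by rewrite lee_fin sqr_ge0.
Qed.

Lemma le_sqint D u v : measurable D -> measurable_fun D u ->
  measurable_fun D v -> {in D, forall z, `|u z| <= `|v z|} ->
  (sqint D u <= sqint D v)%E.
Proof.
move=> mD mu_ mv uv; apply: ge0_le_integral => //.
- by move=> z _; rewrite lee_fin sqr_ge0.
- exact: measurable_sqr.
- exact: measurable_sqr.
- move=> z Dz; rewrite lee_fin -(real_normK (num_real (u z))).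
  rewrite -(real_normK (num_real (v z))) lerXn2r// ?nnegrE//.
  by apply: uv; rewrite inE.
Qed.

Lemma sqintD_le D u v : measurable D -> measurable_fun D u ->
  measurable_fun D v ->
  (sqint D (fun z => (u z + v z)%R) <= 2%:E * sqint D u + 2%:E * sqint D v)%E.
Proof.
move=> mD mu_ mv; have msq := measurable_sqr.
have sq0 w z : (0 <= (w z ^+ 2)%:E :> \bar R)%E by rewrite lee_fin sqr_ge0.
rewrite /sqint -!ge0_integralZl//; try (by move=> *; exact: sq0); try exact: msq.
rewrite -ge0_integralD//; last first.
- by apply: measurable_funeM; exact: msq.
- by move=> z _; rewrite mule_ge0.
- by apply: measurable_funeM; exact: msq.
- by move=> z _; rewrite mule_ge0.
apply: ge0_le_integral => //.
- by apply: msq; exact: measurable_funD.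
- apply: emeasurable_funD; apply: measurable_funeM; exact: msq.
- move=> z _; rewrite -!EFinM -EFinD lee_fin.
  have := sqr_ge0 (u z - v z); rewrite sqrrB sqrrD; lra.
Qed.

Lemma sqintD_lty D u v : measurable D -> measurable_fun D u ->
  measurable_fun D v -> (sqint D u < +oo)%E -> (sqint D v < +oo)%E ->
  (sqint D (fun z => (u z + v z)%R) < +oo)%E.
Proof.
move=> mD mu_ mv uoo voo; apply: (le_lt_trans (sqintD_le mD mu_ mv)).
by rewrite lte_add_pinfty// lte_mul_pinfty// lee_fin.
Qed.

Lemma sqintZ_lty D (k : R) u : measurable D -> measurable_fun D u ->
  (sqint D u < +oo)%E -> (sqint D (fun z => (k * u z)%R) < +oo)%E.
Proof.
by move=> mD mu_ uoo; rewrite sqintZ// lte_mul_pinfty// lee_fin sqr_ge0.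
Qed.

Lemma sqint_eq0 D u : measurable D -> measurable_fun D u ->
  sqint D u = 0%E <-> {ae mu, forall z, D z -> u z = 0}.
Proof.
move=> mD mu_; rewrite -[X in X = _](_ : (\int[mu]_(z in D) `|(u z ^+ 2)%:E|)%E = _); last first.
  by apply: eq_integral => z _; rewrite gee0_abs// lee_fin sqr_ge0.
have FF := ae_filter_ringOfSetsType mu.
split=> [/(ae_eq_integral_abs mu mD (measurable_sqr mu_))|h].
  by apply: filterS => z /= + Dz => /(_ Dz) [] /eqP; rewrite sqrf_eq0 => /eqP.
apply/(ae_eq_integral_abs mu mD (measurable_sqr mu_)).
by apply: filterS h => z /= + Dz => ->//; rewrite expr0n.
Qed.

Lemma sqint_integrable_sqr D u : measurable D -> measurable_fun D u ->
  (sqint D u < +oo)%E -> mu.-integrable D (EFin \o (fun z => u z ^+ 2)).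
Proof.
move=> mD mu_ uoo; apply/integrableP; split; first exact: measurable_sqr.
rewrite (eq_integral (fun z => (u z ^+ 2)%:E))// => z _.
by rewrite gee0_abs// lee_fin sqr_ge0.
Qed.

Lemma integrable_cst_fin D (c : R) : measurable D -> (mu D < +oo)%E ->
  mu.-integrable D (EFin \o cst c).
Proof.
move=> mD Doo; apply/integrableP; split; first exact/measurable_EFinP.
by rewrite (eq_integral (cst `|c|%:E))// integral_cst// lte_mul_pinfty// lee_fin.
Qed.

Lemma sqint_integrable D u : measurable D -> (mu D < +oo)%E ->
  measurable_fun D u -> (sqint D u < +oo)%E ->
  mu.-integrable D (EFin \o u).
Proof.
move=> mD Doo mu_ uoo.
apply: (@le_integrable _ _ _ mu D mD _ ((EFin \o cst 1%R) \+ (EFin \o (fun z => (u z ^+ 2)%R)))%E).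
- exact/measurable_EFinP.
- move=> z _ /=; rewrite lee_fin [leRHS]ger0_norm ?addr_ge0 ?sqr_ge0//.
  rewrite -(real_normK (num_real (u z))).
  have := sqr_ge0 (`|u z| - 1); have := normr_ge0 (u z); nra.
- by apply: integrableD; [|exact: integrable_cst_fin|exact: sqint_integrable_sqr].
Qed.

End square_integral.

(** * Density of the continuous functions in L^2 *)

Section density.
Context {R : realType}.
Local Notation lam := (@lebesgue_measure R).
Implicit Types (w g : R -> R) (D : set R).

(** Truncation to [- M, M], a 1-Lipschitz map. *)
Definition clip (M x : R) := Num.max (- M) (Num.min M x).

Lemma clip_bound M x : 0 <= M -> `|clip M x| <= M.
Proof. by move=> M0; rewrite ler_norml le_max lexx/= ge_max ge_min lexx andbT; lra. Qed.

Lemma clip_dist M x y : `|clip M x - clip M y| <= `|x - y|.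
Proof.
wlog xy : x y / x <= y => [h|].
  by have [/h//|/ltW/h] := leP x y; rewrite distrC [leRHS]distrC.
rewrite distrC [leRHS]distrC [leRHS]ger0_norm ?subr_ge0// ler_norml /clip.
case: (leP M x) => h1; case: (leP M y) => h2;
  rewrite /Num.max; case: ifPn; rewrite -?leNgt => h3;
  try (case: ifPn; rewrite -?leNgt => h4); lra.
Qed.

Lemma clip_id M x : `|x| <= M -> clip M x = x.
Proof.
by rewrite ler_norml => /andP[h1 h2]; rewrite /clip min_r// max_r.
Qed.

Lemma clip_err M x : 0 <= M -> `|x - clip M x| <= `|x|.
Proof.
move=> M0; rewrite /clip /Num.max.
have [x0|x0] := leP 0 x; [rewrite [leRHS]ger0_norm//|rewrite [leRHS]ltr0_norm//];
  case: (leP M x) => h1; case: ifPn; rewrite -?leNgt ler_norml => h2; lra.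
Qed.

Lemma continuous_clip M : continuous (clip M).
Proof.
move=> x; apply: (@continuous_max R R (cst (- M)) (fun y => Num.min M y) x).
  exact: cst_continuous.
by apply: (@continuous_min R R (cst M) idfun x); [exact: cst_continuous|].
Qed.

Lemma measurable_clip M w D : measurable_fun D w -> measurable_fun D (clip M \o w).
Proof.
move=> mw; apply: (@measurable_comp _ _ _ _ _ _ setT) => //.
by apply: continuous_measurable_fun; exact: continuous_clip.
Qed.

Lemma sqint_clip_approx D w : measurable D -> measurable_fun D w ->
  (sqint lam D w < +oo)%E -> forall e : R, 0 < e ->
  exists n : nat, (sqint lam D (fun z => (w z - clip n%:R (w z))%R) <= e%:E)%E.
Proof.
move=> mD mw woo e e0.
have msub n : measurable_fun D (fun z => w z - clip n (w z)).
  by apply: measurable_funB => //; exact: measurable_clip.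
have [] := @dominated_convergence _ _ _ lam D mD
  (fun n z => ((w z - clip n%:R (w z)) ^+ 2)%:E) (cst 0%E)
  (fun z => (w z ^+ 2)%:E).
- by move=> n; apply: measurable_sqr; exact: msub.
- exact: measurable_cst.
- apply: aeW => z Dz; apply: cvg_near_cst.
  exists (Num.bound (`|w z|)) => // n /= wn; rewrite clip_id ?subrr ?expr0n//.
  by rewrite (le_trans (ltW (archi_boundP _)))// ler_nat.
- apply/integrableP; split; first exact: measurable_sqr.
  apply: le_lt_trans woo; rewrite le_eqVlt; apply/orP; left; apply/eqP.
  by apply: eq_integral => z _; rewrite gee0_abs// lee_fin sqr_ge0.
- apply: aeW => z n Dz; rewrite gee0_abs ?lee_fin ?sqr_ge0//.
  rewrite -(real_normK (num_real (w z - _))) -(real_normK (num_real (w z))).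
  by rewrite lerXn2r// ?nnegrE// clip_err.
move=> _ _; rewrite integral0 => /(@fine_cvgP _ _ _ _ _ 0)[fin].
move=> /cvgrPdist_lt/(_ e e0); move: fin.
move=> [n1 _ h1] [n2 _ h2]; exists (maxn n1 n2).
have := h2 (maxn n1 n2) (leq_maxr _ _); have := h1 (maxn n1 n2) (leq_maxl _ _).
rewrite /= sub0r normrN => fin lt.
by rewrite /sqint -(fineK fin) lee_fin (le_trans (ler_norm _))// ltW.
Qed.

(** Truncation makes the function bounded at a small cost. Two functions bounded
    by n satisfy |v - g|^2 <= 2 (n + 1) |v - g|, so that approximation in L^1,
    followed by truncation of the approximant, is approximation in L^2. *)
Lemma continuous_sqint_dense D w : measurable D -> (lam D < +oo)%E ->
  measurable_fun D w -> (sqint lam D w < +oo)%E -> forall e : R, 0 < e ->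
  exists2 g, continuous g & (sqint lam D (fun z => (w z - g z)%R) <= e%:E)%E.
Proof.
move=> mD Doo mw woo e e0.
have e40 : 0 < e / 4 by lra.
have [n hn] := sqint_clip_approx mD mw woo e40.
have M0 : 0 < n%:R + 1 :> R by rewrite ltr_wpDl// ler0n.
set v := fun z => clip n%:R (w z).
have mv : measurable_fun D v by exact: measurable_clip.
have vn z : `|v z| <= n%:R by apply: clip_bound; exact: ler0n.
have iv : lam.-integrable D (EFin \o v).
  apply: measurable_bounded_integrable => //.
  exists n%:R; split; first exact: num_real.
  by move=> x nx z _; apply: (le_trans (vn z)); exact: ltW.
have [g_ [cg _ /fine_cvgP[[n1 _ fin] /cvgrPdist_lt]]] :=
  approximation_continuous_integrable mD Doo iv.
move=> /(_ (e / 4 / (2 * (n%:R + 1)))) [|n2 _ h2]; first by rewrite !divr_gt0// mulr_gt0.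
have {fin} fin := fin (maxn n1 n2) (leq_maxl _ _).
have {h2} h2 := h2 (maxn n1 n2) (leq_maxr _ _).
move: fin h2; set g := g_ _; rewrite /= sub0r normrN => fin h2.
have {fin h2} h : (\int[lam]_(x in D) `|(v x - g x)%:E| <=
    (e / 4 / (2 * (n%:R + 1)))%:E)%E.
  by rewrite -(fineK fin) lee_fin (le_trans (ler_norm _))// ltW.
have mg : measurable_fun D g.
  by apply: measurable_funTS; apply: continuous_measurable_fun; exact: cg.
exists (clip n%:R \o g).
  by move=> x; apply: continuous_comp; [exact: cg|exact: continuous_clip].
have mcg : measurable_fun D (clip n%:R \o g) by exact: measurable_clip.
have -> : sqint lam D (fun z => w z - (clip n%:R \o g) z) =
  sqint lam D (fun z => (w z - v z) + (v z - clip n%:R (g z))).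
  by apply: eq_sqint => z _ /=; rewrite addrA subrK.
apply: (le_trans (sqintD_le _ _ _ _)) => //.
- exact: measurable_funB.
- exact: measurable_funB.
have -> : e%:E = (2%:E * (e / 4)%:E + 2%:E * (e / 4)%:E)%E.
  by rewrite -!EFinM -EFinD; congr EFin; field.
apply: leeD; rewrite lee_pmul2l//.
apply: (@le_trans _ _ (\int[lam]_(x in D) ((2 * (n%:R + 1))%:E * `|(v x - g x)%:E|))%E).
  apply: ge0_le_integral => //.
  - by move=> z _; rewrite lee_fin sqr_ge0.
  - by apply: measurable_sqr; exact: measurable_funB.
  - apply: measurable_funeM; apply: measurableT_comp => //.
    by apply/measurable_EFinP; exact: measurable_funB.
  - move=> z Dz; rewrite -EFinM lee_fin.
    rewrite -(real_normK (num_real (v z - _))) expr2 ler_pM//.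
      rewrite (le_trans (ler_normB _ _))//.
      have := vn z; have := clip_bound (g z) (ler0n R n); lra.
    by rewrite -[in leLHS](clip_id (vn z)); exact: clip_dist.
rewrite ge0_integralZl//.
- rewrite -lee_pdivlMl ?mulr_gt0//.
  by rewrite -EFinM mulrC.
- apply: measurableT_comp => //.
  by apply/measurable_EFinP; exact: measurable_funB.
Qed.

End density.

(** * Antiperiodic functions and their translations *)

Section antiperiodic.
Context {R : realType}.
Local Notation lam := (@lebesgue_measure R).
Implicit Types (u v w g : R -> R) (t : R).

(** The squared L^2 norm over one period of w ^+ 2, for antiperiodic w. *)
Definition period_sq w : \bar R := sqint lam `[-1, 1[ w.

Definition antiper w : Prop :=
  [/\ measurable_fun setT w, forall z, w (z + 2) = - w z & (period_sq w < +oo)%E].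

Lemma measurable_comp_shift t w : measurable_fun setT w ->
  measurable_fun setT (fun z : R => w (z + t)).
Proof. by move=> mw; apply: measurableT_comp => //; exact: measurable_shift. Qed.

Lemma period_sq_shift w t : measurable_fun setT w -> (forall z, w (z + 2) = - w z) ->
  0 <= t -> period_sq (fun z : R => w (z + t)) = period_sq w.
Proof.
move=> mw wp t0; rewrite /period_sq /sqint.
rewrite (ge0_integral_periodic (f := fun z => (w z ^+ 2)%:E))//.
- exact: measurable_sqr.
- by move=> z; rewrite lee_fin sqr_ge0.
- by move=> z; rewrite wp sqrrN.
Qed.

Lemma antiper_shift w t : 0 <= t -> antiper w -> antiper (fun z : R => w (z + t)).
Proof.
move=> t0 [mw wp woo]; split.
- exact: measurable_comp_shift.
- by move=> z; rewrite addrAC wp.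
- by rewrite period_sq_shift.
Qed.

Lemma antiperD u v : antiper u -> antiper v -> antiper (fun z => u z + v z).
Proof.
move=> [mu up uoo] [mv vp voo]; split.
- exact: measurable_funD.
- by move=> z; rewrite up vp opprD.
- by apply: sqintD_lty => //; exact: measurable_funTS.
Qed.

Lemma antiperZ (k : R) u : antiper u -> antiper (fun z => k * u z).
Proof.
move=> [mu up uoo]; split.
- by apply: measurable_funM => //; exact: measurable_cst.
- by move=> z; rewrite up mulrN.
- by apply: sqintZ_lty => //; exact: measurable_funTS.
Qed.

Lemma period_sqD_le u v : measurable_fun setT u -> measurable_fun setT v ->
  (period_sq (fun z => (u z + v z)%R) <= 2%:E * period_sq u + 2%:E * period_sq v)%E.
Proof. by move=> mu mv; apply: sqintD_le => //; exact: measurable_funTS. Qed.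

Lemma continuous_translation g (e : R) : continuous g -> 0 < e ->
  \forall t \near 0^'+, `[-1, 1]%classic `<=` [set z | `|g (z + t) - g z| <= e].
Proof.
move=> cg e0.
have /compact_near_coveringP := @segment_compact R (-1) 1.
apply => z _.
have e20 : 0 < e / 2 by lra.
have /cvgrPdist_lt/(_ _ e20) := cg z; rewrite -near_nbhs => -[/= d d0 hd].
have td : \forall t \near (0 : R)^'+, 0 < t < d / 2.
  near=> t; apply/andP; split; first by near: t; exact: nbhs_right_gt.
  by near: t; apply: nbhs_right_lt; lra.
exists (ball z (d / 2), [set t | 0 < t < d / 2]) => /=.
  by split; [apply: nbhsx_ballx; lra|exact: td].
move=> [z' t]/= [zz' /andP[t0 td']].
have h1 : `|g z - g z'| < e / 2.
  apply: hd => /=; move: zz'; rewrite /ball/= => zz'; lra.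
have h2 : `|g z - g (z' + t)| < e / 2.
  apply: hd => /=; move: zz'; rewrite /ball/= opprD addrA => zz'.
  by rewrite (le_lt_trans (ler_normB _ _))// [`|t|]gtr0_norm//; lra.
have -> : g (z' + t) - g z' = (g z - g z') - (g z - g (z' + t)) by ring.
by rewrite (le_trans (ler_normB _ _))//; lra.
Unshelve. all: by end_near. Qed.

Lemma antiper_two_periods w : antiper w -> (sqint lam `[(-1)%R, 3%R[ w < +oo)%E.
Proof.
move=> [mw wp woo].
rewrite /sqint (_ : `[-1, 3[%classic = `[-1, 1[%classic `|` `[1, 3[%classic :> set R); last first.
  by rewrite -itv_bndbnd_setU ?bnd_simp//; lra.
have msq : measurable_fun [set: R] (fun z => (w z ^+ 2)%:E) by exact: measurable_sqr.
have sq0 z : (0 <= (w z ^+ 2)%:E :> \bar R)%E by rewrite lee_fin sqr_ge0.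
rewrite ge0_integral_setU//=; [|exact: measurable_funTS|]; last first.
  apply/disj_setPRL => z /=; rewrite !in_itv/= => /andP[h1 h2]; apply/negP.
  by rewrite negb_and -ltNge -leNgt h1 orbT.
rewrite lte_add_pinfty//.
have -> : `[1, 3[%classic = `[-1 + 2, 1 + 2[%classic :> set R.
  have -> : (-1 + 2 : R) = 1 by ring.
  by have -> : (1 + 2 : R) = 3 by ring.
rewrite -(ge0_integral_shift_itv 2 true true)//.
by under eq_integral do rewrite wp sqrrN.
Qed.

(** A continuous g close to w in L^2 is moved by little uniformly, by
    compactness, and the distance from w to g is the same after translation. The
    approximation has to hold on two periods, because the translate of [-1, 1[
    leaves the period. *)
Lemma period_sq_translation_cvg w : antiper w -> forall e : R, 0 < e ->
  \forall t \near 0^'+, (period_sq (fun z => (w (z + t) - w z)%R) <= e%:E)%E.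
Proof.
move=> [mw wp woo] e e0.
have wJ := antiper_two_periods (And3 mw wp woo).
have e120 : 0 < e / 12 by lra.
have Joo : (lam `[(-1)%R, 3%R[ < +oo)%E.
  by rewrite lebesgue_measure_itv/=; case: ifPn => _; rewrite ?ltry// -EFinB ltry.
have [g cg hg] :=
  continuous_sqint_dense (measurable_itv _) Joo (measurable_funTS mw) wJ e120.
have mg : measurable_fun setT g by exact: continuous_measurable_fun.
have mwg : measurable_fun setT (fun z => w z - g z) by exact: measurable_funB.
have hJ (a b : R) : -1 <= a -> b <= 3 ->
    (sqint lam `[a, b[ (fun z => (w z - g z)%R) <= (e / 12)%:E)%E.
  move=> a1 b3; apply: le_trans hg; apply: ge0_subset_integral => //.
  - by apply: measurable_sqr; exact: measurable_funTS.
  - by move=> z _; rewrite lee_fin sqr_ge0.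
  - by apply: subset_itv; rewrite bnd_simp.
(* the uniform bound eta contributes 2 eta^2 <= e / 8 over the period *)
pose eta := Num.min 1 (e / 16).
have eta0 : 0 < eta by rewrite lt_min ltr01/=; lra.
near=> t.
have t0 : 0 < t by near: t; exact: nbhs_right_gt.
have t1 : t < 1 by near: t; exact: nbhs_right_lt.
have ht : `[-1, 1]%classic `<=` [set z | `|g (z + t) - g z| <= eta].
  by near: t; exact: continuous_translation.
have -> : (fun z : R => w (z + t) - w z) = (fun z : R => (w (z + t) - g (z + t)) +
    ((g (z + t) - g z) + -1 * (w z - g z))).
  by apply/funext => z; ring.
have mgt := measurable_comp_shift t mg.
have mwgt := measurable_comp_shift t mwg.
have mgg : measurable_fun setT (fun z : R => g (z + t) - g z).
  exact: measurable_funB.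
have mwg1 : measurable_fun setT (fun z => -1 * (w z - g z)).
  by apply: measurable_funM => //; exact: measurable_cst.
apply: (le_trans (period_sqD_le _ _)) => //; first exact: measurable_funD.
have H1 : (period_sq (fun z : R => (w (z + t) - g (z + t))%R) <= (e / 12)%:E)%E.
  rewrite /period_sq /sqint.
  rewrite (ge0_integral_shift_itv t (f := fun z => ((w z - g z) ^+ 2)%:E) true true).
  - by apply: hJ; lra.
  - exact: measurable_sqr.
  - by move=> z; rewrite lee_fin sqr_ge0.
have H2 : (period_sq (fun z : R => (g (z + t) - g z)%R) <= (e / 8)%:E)%E.
  apply: (@le_trans _ _ (\int[lam]_(z in `[(-1)%R, 1%R[) (eta ^+ 2)%:E)%E).
    apply: ge0_le_integral => //.
    - by move=> z _; rewrite lee_fin sqr_ge0.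
    - by apply: measurable_sqr; exact: measurable_funTS.
    - move=> z zI; rewrite lee_fin -(real_normK (num_real (g _ - _))).
      rewrite lerXn2r// ?nnegrE ?(ltW eta0)//; apply: ht => /=.
      by move: zI; rewrite /= !in_itv/= => /andP[-> /ltW].
  rewrite integral_cst//= lebesgue_measure_itv/= lte_fin ifT; last by lra.
  rewrite -EFinB -EFinM lee_fin.
  have h1 : eta <= 1 by rewrite ge_min lexx.
  have h2 : eta <= e / 16 by rewrite ge_min lexx orbT.
  by rewrite expr2; nra.
have H3 : (period_sq (fun z => (-1 * (w z - g z))%R) <= (e / 12)%:E)%E.
  rewrite /period_sq sqintZ//; last exact: measurable_funTS.
  by rewrite sqrrN expr1n mul1e; apply: hJ; lra.
have H4 : (period_sq (fun z : R => ((g (z + t) - g z) + -1 * (w z - g z))%R) <=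
    (2 * (e / 8) + 2 * (e / 12))%:E)%E.
  apply: (le_trans (period_sqD_le _ _)) => //.
  by rewrite [leRHS]EFinD; apply: leeD; rewrite EFinM lee_pmul2l.
apply: (@le_trans _ _ (2 * (e / 12) + 2 * (2 * (e / 8) + 2 * (e / 12)))%:E).
  by rewrite [leRHS]EFinD; apply: leeD; rewrite EFinM lee_pmul2l.
by rewrite lee_fin; lra.
Unshelve. all: by end_near. Qed.

End antiperiodic.

(** * Difference quotients of primitives in L^2 *)

Section mean_square.
Context {R : realType}.
Local Notation lam := (@lebesgue_measure R).
Implicit Types (k : R -> R) (s : R).

(** Integrate 2 m k - m^2 <= k^2, where m is the mean of k. *)
Lemma sqr_mean_le (D : set R) k s : measurable D -> lam D = s%:E -> 0 < s ->
  lam.-integrable D (EFin \o k) ->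
  (((s^-1 * \int[lam]_(z in D) k z) ^+ 2)%:E <=
    (s^-1)%:E * sqint lam D k)%E.
Proof.
move=> mD Ds s0 ik.
have mk : measurable_fun D k by apply/measurable_EFinP; exact: measurable_int ik.
have [koo|] := ltP (sqint lam D k) +oo%E; last first.
  by rewrite leye_eq => /eqP ->; rewrite gt0_muley ?leey// lte_fin invr_gt0.
set m := s^-1 * _.
have ik2 : lam.-integrable D (EFin \o (fun z => k z ^+ 2)).
  exact: sqint_integrable_sqr.
have i1 : lam.-integrable D (EFin \o (fun z => 2 * m * k z)).
  rewrite (_ : _ \o _ = (fun z => (2 * m)%:E * (k z)%:E)%E)//.
  exact: integrableZl.
have Doo : (lam D < +oo)%E by rewrite Ds ltry.
have i2 : lam.-integrable D (EFin \o (fun z => m ^+ 2)).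
  exact: integrable_cst_fin.
have -> : sqint lam D k = (\int[lam]_(z in D) (k z ^+ 2))%:E.
  by rewrite /Rintegral fineK//; exact: integrable_fin_num.
rewrite -EFinM lee_fin -ler_pdivrMl ?invr_gt0// invrK.
have <- : \int[lam]_(z in D) (2 * m * k z - m ^+ 2) = s * m ^+ 2.
  rewrite RintegralB// RintegralZl// Rintegral_cst//= Ds/=.
  have -> : \int[lam]_(x in D) k x = s * m by rewrite /m mulrA mulfV ?mul1r// gt_eqF.
  ring.
apply: le_Rintegral => //.
  rewrite (_ : _ \o _ = (EFin \o (fun z => (2 * m * k z)%R)) \- (EFin \o (fun z => (m ^+ 2)%R)))%E//.
  exact: integrableB.
by move=> z _; have := sqr_ge0 (k z - m); rewrite sqrrB; nra.
Qed.

End mean_square.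

Section difference_quotient.
Context {R : realType}.
Local Notation lam := (@lebesgue_measure R).
Local Notation mR := (measurableTypeR R).
Implicit Types (w h : R -> R) (s t : R).

Lemma near0_rightP (P : R -> Prop) : (\forall t \near 0^'+, P t) <->
  exists2 d, 0 < d & forall t, 0 < t < d -> P t.
Proof.
split=> [[d /= d0 hd]|[d d0 hd]].
  exists d => // t /andP[t0 td]; apply: hd => //=.
  by rewrite sub0r normrN gtr0_norm.
near=> t; apply: hd; apply/andP; split; first by near: t; exact: nbhs_right_gt.
by near: t; exact: nbhs_right_lt.
Unshelve. all: by end_near. Qed.

(** Tonelli on a rectangle, from the case of the plane by cutting off. *)
Lemma tonelli_dom (A B : set R) (F : R -> R -> \bar R) :
  measurable A -> measurable B ->
  measurable_fun setT ((fun p => F p.1 p.2) : (mR * mR)%type -> \bar R) ->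
  (forall x y, 0 <= F x y)%E ->
  (\int[lam]_(x in A) \int[lam]_(y in B) F x y =
   \int[lam]_(y in B) \int[lam]_(x in A) F x y)%E.
Proof.
move=> mA mB mF F0.
pose G : (mR * mR)%type -> \bar R := (fun p => F p.1 p.2) \_ (A `*` B).
have mG : measurable_fun setT G.
  apply/(measurable_restrictT _ _).1; first exact: measurableX.
  exact: measurable_funTS.
have G0 p : (0 <= G p)%E by apply: erestrict_ge0.
have Gin x y : (x \in A) -> (y \in B) -> G (x, y) = F x y.
  by move=> xA yB; rewrite /G patchE in_setX xA yB.
have Gout x y : (x \notin A) || (y \notin B) -> G (x, y) = 0%E.
  by rewrite -negb_and => /negbTE xyAB; rewrite /G patchE in_setX xyAB.
rewrite [LHS](_ : _ = \int[lam]_x \int[lam]_y G (x, y))%E; last first.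
  rewrite [LHS]integral_mkcond; apply: eq_integral => x _.
  rewrite patchE; case: ifPn => xA.
    rewrite integral_mkcond; apply: eq_integral => y _; rewrite patchE.
    by case: ifPn => yB; [rewrite Gin|rewrite Gout// yB orbT].
  by rewrite -[LHS](integral0 lam setT); apply: eq_integral => y _; rewrite Gout// xA.
rewrite [RHS](_ : _ = \int[lam]_y \int[lam]_x G (x, y))%E; last first.
  rewrite [LHS]integral_mkcond; apply: eq_integral => x _.
  rewrite patchE; case: ifPn => xA.
    rewrite integral_mkcond; apply: eq_integral => y _; rewrite patchE.
    by case: ifPn => yB; [rewrite Gin|rewrite Gout// yB].
  by rewrite -[LHS](integral0 lam setT); apply: eq_integral => y _; rewrite Gout// xA orbT.
exact: fubini_tonelli.
Qed.

Lemma measurable_integral_dom (B : set R) (F : R -> R -> \bar R) :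
  measurable B ->
  measurable_fun setT ((fun p => F p.1 p.2) : (mR * mR)%type -> \bar R) ->
  (forall x y, 0 <= F x y)%E ->
  measurable_fun setT ((fun x => \int[lam]_(y in B) F x y)%E : mR -> \bar R).
Proof.
move=> mB mF F0.
pose G : (mR * mR)%type -> \bar R := (fun p => F p.1 p.2) \_ (setT `*` B).
have mG : measurable_fun setT G.
  apply/(measurable_restrictT _ _).1; first exact: measurableX.
  exact: measurable_funTS.
have G0 p : (0 <= G p)%E by apply: erestrict_ge0.
rewrite (_ : (fun _ => _) = fubini_F lam G).
  exact: measurable_fun_fubini_tonelli_F.
apply/funext => x; rewrite /fubini_F [LHS]integral_mkcond.
by apply: eq_integral => y _; rewrite /G !patchE in_setX in_setT.
Qed.

(** The error at z is the mean over r in ]0, s] of h (z + r) - h z. Its square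
    is at most the mean of the squares, and exchanging the two integrals leaves
    the mean over r of the squared distances from h to its translates, which are
    all small. *)
Lemma period_sq_difference_quotient h w : antiper h -> measurable_fun setT w ->
  (forall z s, -1 <= z -> 0 < s -> z + s < 3 ->
    lam.-integrable `]z, z + s] (EFin \o h) /\
    w (z + s) - w z = \int[lam]_(y in `]z, z + s]) h y) ->
  forall e : R, 0 < e ->
  \forall s \near 0^'+,
    (period_sq (fun z => (s^-1 * (w (z + s) - w z) - h z)%R) <= e%:E)%E.
Proof.
move=> ah mw wh e e0; have [mh hp hoo] := ah.
have /near0_rightP[d d0 hd] := period_sq_translation_cvg ah e0.
near=> s.
have s0 : 0 < s by near: s; exact: nbhs_right_gt.
have s1 : s < 1 by near: s; exact: nbhs_right_lt.
have sd : s < d by near: s; exact: nbhs_right_lt.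
have mF : measurable_fun setT
    ((fun p => ((h (p.2 + p.1) - h p.1) ^+ 2)%:E) : (mR * mR)%type -> \bar R).
  apply/measurable_EFinP; apply: measurable_funX; apply: measurable_funB.
    apply: (measurableT_comp mh); apply: measurable_funD.
      exact: measurable_snd.
    exact: measurable_fst.
  by apply: (measurableT_comp mh); exact: measurable_fst.
pose F z r := ((h (r + z) - h z) ^+ 2)%:E.
have F0 z r : (0 <= F z r)%E by rewrite lee_fin sqr_ge0.
apply: (@le_trans _ _ (\int[lam]_(z in `[(-1)%R, 1%R[)
   ((s^-1)%:E * \int[lam]_(r in `]0%R, s]) F z r))%E).
  apply: ge0_le_integral => //.
  - by move=> z _; rewrite lee_fin sqr_ge0.
  - apply: measurable_sqr; apply: measurable_funTS; apply: measurable_funB => //.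
    apply: measurable_funM; first exact: measurable_cst.
    by apply: measurable_funB => //; exact: measurable_comp_shift.
  - apply: measurable_funeM; apply: measurable_funTS.
    exact: measurable_integral_dom.
  - move=> z; rewrite /= in_itv/= => /andP[z1 z2].
    have [] := wh z s z1 s0 _; first by lra.
    move=> ih ->.
    have ls : lam `]z, z + s]%classic = s%:E.
      rewrite lebesgue_measure_itv/= lte_fin ltrDl s0 -EFinB; congr EFin; ring.
    have icst : lam.-integrable `]z, z + s] (EFin \o cst (h z)).
      by apply: integrable_cst_fin => //=; rewrite ls ltry.
    have ihc : lam.-integrable `]z, z + s] (EFin \o (fun y => h y - h z)).
      rewrite (_ : _ \o _ = (EFin \o h) \- (EFin \o cst (h z)))%E//.
      exact: integrableB.
    have -> : s^-1 * (\int[lam]_(y in `]z, z + s]) h y) - h z =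
        s^-1 * \int[lam]_(y in `]z, z + s]) (h y - h z).
      rewrite RintegralB// Rintegral_cst//= ls/= mulrBr; congr (_ - _).
      by rewrite mulrCA mulVf ?mulr1// gt_eqF.
    apply: (le_trans (sqr_mean_le _ ls s0 ihc)) => //.
    rewrite lee_pmul2l ?lte_fin ?invr_gt0// /sqint /F.
    rewrite (ge0_integral_shift_itv z (f := fun y => ((h y - h z) ^+ 2)%:E) false false).
    - by rewrite add0r addrC.
    - by apply: measurable_sqr; apply: measurable_funB => //; exact: measurable_cst.
    - by move=> y; rewrite lee_fin sqr_ge0.
rewrite ge0_integralZl//; last 3 first.
- by apply: measurable_funTS; exact: measurable_integral_dom.
- by move=> z _; apply: integral_ge0.
- by rewrite lee_fin invr_ge0 ltW.
rewrite tonelli_dom//.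
rewrite -lee_pdivlMl ?invr_gt0// invrK.
apply: (@le_trans _ _ (\int[lam]_(r in `]0%R, s]) e%:E)%E).
  apply: ge0_le_integral => //.
  - by move=> r _; apply: integral_ge0.
  - apply: measurable_funTS.
    apply: (@measurable_integral_dom _ (fun r z => F z r)) => //.
    apply/measurable_EFinP; apply: measurable_funX; apply: measurable_funB.
      by apply: (measurableT_comp mh); exact: measurable_funD.
    by apply: (measurableT_comp mh); exact: measurable_snd.
  - move=> r; rewrite /= in_itv/= => /andP[r0 rs].
    apply: le_trans (hd r _); last by rewrite r0 (le_lt_trans rs).
    rewrite le_eqVlt; apply/orP; left; apply/eqP; apply: eq_integral => z _.
    by rewrite /F [r + z]addrC.
rewrite integral_cst//= lebesgue_measure_itv/= lte_fin s0 -EFinB subr0.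
by rewrite -EFinM mulrC.
Unshelve. all: by end_near. Qed.

End difference_quotient.

(** * The space L^2 (0, 1) *)

Section unit_interval_measure.
Context {R : realType}.
Local Notation lam := (@lebesgue_measure R).
Local Notation I01 := (`]0%R, 1%R[%classic : set R).

Lemma mu01E (A : set R) : measurable A -> mu01 R A = lam (A `&` I01).
Proof. by []. Qed.

Lemma mu01_ae (P : R -> Prop) :
  {ae mu01 R, forall z, P z} <-> {ae lam, forall z, I01 z -> P z}.
Proof.
split=> [[N [mN N0 PN]]|[N [mN N0 PN]]].
  exists (N `&` I01); split; first exact: measurableI.
    exact: N0.
  move=> z /= /not_implyP[zI nP]; split=> //; exact: PN.
exists (N `|` ~` I01); split; first by apply: measurableU => //; exact: measurableC.
  rewrite mu01E; last by apply: measurableU => //; exact: measurableC.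
  rewrite setIUl setICl setU0; apply/eqP; rewrite -measure_le0 -N0.
  by apply: le_measure; rewrite ?inE//; exact: measurableI.
move=> z /= nP; have [zI|zI] := pselect (I01 z); last by right.
by left; apply: PN => /= /(_ zI).
Qed.

Lemma ge0_integral_mu01 (f : R -> \bar R) : measurable_fun setT f ->
  (forall z, 0 <= f z)%E -> (\int[mu01 R]_z f z = \int[lam]_(z in I01) f z)%E.
Proof.
move=> mf f0.
have m0 : mu01 R (~` I01) = 0%E.
  by rewrite mu01E ?setICl ?measure0//; exact: measurableC.
have mC : measurable (~` I01) by exact: measurableC.
rewrite (@ge0_negligible_integral _ _ _ (mu01 R) setT (~` I01))//.
rewrite setDE setTI setCK; apply: eq_measure_integral => A mA AI.
by rewrite -[in RHS](setIidl AI).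
Qed.

Lemma integral_mu01 (f : R -> \bar R) : measurable_fun setT f ->
  (\int[mu01 R]_z f z = \int[lam]_(z in I01) f z)%E.
Proof.
move=> mf; rewrite integralE [RHS]integralE.
by rewrite !ge0_integral_mu01//; [exact: measurable_funeneg|exact: measurable_funepos].
Qed.

Lemma Rintegral_mu01 (f : R -> R) : measurable_fun setT f ->
  \int[mu01 R]_z f z = \int[lam]_(z in I01) f z.
Proof. by move=> mf; rewrite /Rintegral integral_mu01//; exact/measurable_EFinP. Qed.

Lemma measurable_L2 (f : L2 R) : measurable_fun setT (f : R -> R).
Proof. by have := Lspace2_Lfun f; rewrite inE => /andP[]; rewrite inE. Qed.

Lemma sqint_mu01 (f : R -> R) : measurable_fun setT f ->
  sqint (mu01 R) setT f = sqint lam I01 f.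
Proof.
move=> mf; rewrite /sqint ge0_integral_mu01//; first exact: measurable_sqr.
by move=> z; rewrite lee_fin sqr_ge0.
Qed.

Lemma sqint_L2_lty (f : L2 R) : (sqint lam I01 f < +oo)%E.
Proof.
rewrite -sqint_mu01; last exact: measurable_L2.
apply: le_lt_trans (integrable_lty measurableT (Lfun2_integrable_sqr (Lspace2_Lfun f))).
by [].
Qed.

Lemma Lfun2P (f : R -> R) : measurable_fun setT f ->
  (sqint lam I01 f < +oo)%E -> f \in Lfun (mu01 R) 2%:E.
Proof.
move=> mf foo; rewrite inE; apply/andP; split; rewrite inE//=.
rewrite /finite_norm unlock poweR_lty//.
have -> : (\int[mu01 R]_x `|(EFin \o f) x| `^ 2)%E = sqint (mu01 R) setT f.
  apply: eq_integral => z _ /=; congr EFin.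
  by rewrite powR_mulrn// real_normK ?num_real.
by rewrite sqint_mu01.
Qed.

End unit_interval_measure.

(** * Primitives and integration by parts *)

Section primitives_on_the_line.
Context {R : realType}.
Local Notation lam := (@lebesgue_measure R).
Local Notation mR := (measurableTypeR R).
Local Notation I01 := (`]0%R, 1%R[%classic : set R).
Implicit Types (h phi : R -> R).

Definition prim h (z : R) : R := \int[lam]_(y in `[0, z]) h y.

Lemma integrableT_itv h (i : interval R) : lam.-integrable setT (EFin \o h) ->
  lam.-integrable [set` i] (EFin \o h).
Proof. by apply: integrableS => //; exact: measurable_itv. Qed.

Lemma continuous_bounded01 phi : {within `[0, 1], continuous phi} ->
  exists2 M, 0 <= M & forall x, x \in `[0, 1] -> `|phi x| <= M.
Proof.
move=> cphi.
have : {within `[0, 1], continuous (Num.norm \o phi : R -> R)}.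
  by move=> x; apply: cvg_norm; exact: cphi.
by move=> /(EVT_max (@ler01 R)) [c _ cM]; exists (`|phi c|).
Qed.

Lemma EFin_integralZl (D : set R) c h : measurable D ->
  lam.-integrable D (EFin \o h) ->
  (\int[lam]_(y in D) (c * h y)%:E = c%:E * \int[lam]_(y in D) (h y)%:E)%E.
Proof.
move=> mD ih; rewrite -integralZl//.
Qed.

Lemma integrable_mul_continuous h phi : lam.-integrable I01 (EFin \o h) ->
  continuous phi -> lam.-integrable I01 (EFin \o (h \* phi)).
Proof.
move=> ih cphi; have [M M0 phiM] := continuous_bounded01 (continuous_subspaceT cphi).
have mh : measurable_fun I01 h by apply/measurable_EFinP; exact: measurable_int ih.
have iMh : lam.-integrable I01 (fun y => M%:E * (h y)%:E)%E by exact: integrableZl.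
apply: (le_integrable _ _ _ iMh) => //.
  apply/measurable_EFinP; apply: measurable_funM => //.
  by apply: measurable_funTS; exact: continuous_measurable_fun.
move=> y yI /=; rewrite lee_fin !normrM mulrC ler_wpM2r//.
rewrite [leRHS]ger0_norm//; apply: phiM; exact: subset_itv_oo_cc.
Qed.

Lemma EFin_prim h z : lam.-integrable setT (EFin \o h) ->
  (prim h z)%:E = (\int[lam]_(y in `[0%R, z]) (h y)%:E)%E.
Proof.
move=> ih; rewrite /prim /Rintegral fineK//.
by apply: integrable_fin_num => //; exact: integrableT_itv.
Qed.

Lemma prim_diff h x y : lam.-integrable setT (EFin \o h) -> 0 <= x -> x <= y ->
  prim h y - prim h x = \int[lam]_(t in `]x, y]) h t.
Proof.
move=> ih x0 xy; apply: Rintegral_itvB; rewrite ?bnd_simp//.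
exact: integrableT_itv.
Qed.

Lemma prim_continuous h : lam.-integrable setT (EFin \o h) ->
  {within `[0, 1], continuous (prim h)}.
Proof.
by move=> ih; apply: parameterized_integral_continuous => //; exact: integrableT_itv.
Qed.

(** By Lebesgue's theorem h is almost everywhere the derivative of its
    primitive. *)
Lemma prim_cst_ae0 h : lam.-integrable setT (EFin \o h) ->
  (forall x y, 0 < x -> x < y -> y < 1 -> prim h x = prim h y) ->
  {ae lam, forall z, I01 z -> h z = 0}.
Proof.
move=> ih hc.
have := @FTC1 R h (BLeft 0) _ _.
move=> /(_ (fun y => integrableT_itv _ ih) (open_integrable_locally openT ih)).
apply: filterS; first exact: (ae_filter_ringOfSetsType lam).
move=> z + /=; rewrite in_itv/= => + /andP[z0 z1].
rewrite lte_fin => /(_ z0)[_ <-].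
rewrite derive1E (@near_eq_derive _ _ _ _ (cst (prim h z))) ?derive_cst//.
near=> x.
have x0 : 0 < x by near: x; exact: lt_nbhsr.
have x1 : x < 1 by near: x; exact: lt_nbhsl.
rewrite -[LHS]/(prim h x) /cst.
by have [xz|zx|->//] := ltgtP x z; [exact: hc|apply/esym/hc].
Unshelve. all: by end_near. Qed.

Lemma integral_derive1_tail (c y : R) phi : I01 y ->
  (forall z, derivable phi z 1) -> continuous (derive1 phi) -> phi 1 = 0 ->
  (\int[lam]_(z in `[y, 1%R[) (c * derive1 phi z)%:E = (- (c * phi y))%:E)%E.
Proof.
rewrite /= in_itv/= => /andP[y0 y1] dphi cphi' phi1.
have cphi : continuous phi.
  move=> z; apply: differentiable_continuous; exact/derivable1_diffP.
rewrite integral_itv_bndo_bndc//; last first.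
  apply: measurable_funTS; apply/measurable_EFinP; apply: measurable_funM => //.
  exact: continuous_measurable_fun.
rewrite EFin_integralZl//; last first.
  apply: continuous_compact_integrable; first exact: segment_compact.
  exact: continuous_subspaceT.
rewrite (@continuous_FTC2 R (derive1 phi) phi y 1 y1)//.
- by rewrite phi1 sub0e -EFinN -EFinM mulrN.
- exact: continuous_subspaceT.
- by split=> //; [apply: cvg_at_right_filter|apply: cvg_at_left_filter]; exact: cphi.
Qed.

(** Both sides are iterated integrals of h y * phi' z over the triangle
    0 <= y <= z < 1. As h is only integrable, its primitive need not be
    differentiable, so the formula is obtained from Fubini's theorem. *)
Lemma prim_by_parts h phi : lam.-integrable setT (EFin \o h) ->
  measurable_fun setT h ->
  (forall z, derivable phi z 1) -> continuous (derive1 phi) -> phi 1 = 0 ->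
  \int[lam]_(z in I01) (prim h z * derive1 phi z) =
  - (\int[lam]_(z in I01) (h z * phi z)).
Proof.
move=> ih mh dphi cphi' phi1.
have cphi : continuous phi.
  move=> z; apply: differentiable_continuous; exact/derivable1_diffP.
have mphi' : measurable_fun setT (derive1 phi) by exact: continuous_measurable_fun.
have goalR : - (\int[lam]_(z in I01) (h z * phi z)) =
    fine (\int[lam]_(y in I01) (- (h y * phi y))%:E)%E.
  have ihphi : lam.-integrable I01 (EFin \o (h \* phi)).
    by apply: integrable_mul_continuous => //; exact: integrableT_itv.
  under eq_integral do rewrite EFinN.
  by rewrite integralN ?fineN//; exact: integrable_add_def.
pose S : set (mR * mR)%type := (fst @^-1` I01) `&`
  (snd @^-1` `[0, +oo[%classic) `&` ((fun p => p.1 - p.2) @^-1` `[0, +oo[%classic).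
have mpre (f : (mR * mR)%type -> mR) (i : interval R) : measurable_fun setT f ->
    measurable (f @^-1` [set` i]).
  by move=> mf; rewrite -[X in measurable X]setTI; apply: mf => //; exact: measurable_itv.
have mS : measurable S.
  apply: measurableI; first apply: measurableI.
  - by apply: mpre; exact: measurable_fst.
  - by apply: mpre; exact: measurable_snd.
  - apply: mpre; apply: measurable_funB; [exact: measurable_fst|exact: measurable_snd].
have SP z y : S (z, y) <-> I01 z /\ 0 <= y <= z.
  rewrite /S /= !in_itv/= !andbT subr_ge0.
  by split=> [[[-> ->] ->]|[-> /andP[]]].
pose k : (mR * mR)%type -> \bar R :=
  (fun p => (h p.2 * derive1 phi p.1)%:E) \_ S.
have mk : measurable_fun setT k.
  apply/(measurable_restrictT _ _).1 => //; apply: measurable_funTS.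
  apply/measurable_EFinP; apply: measurable_funM.
    exact: (measurableT_comp mh measurable_snd).
  exact: (measurableT_comp mphi' measurable_fst).
have [M M0 phiM] := continuous_bounded01 (continuous_subspaceT cphi').
have kz z : I01 z -> (fun y => k (z, y)) = (fun y => (h y * derive1 phi z)%:E) \_ `[0, z].
  move=> zI; apply/funext => y; rewrite /k !patchE.
  congr (if _ then _ else _); apply/idP/idP; rewrite !inE; first by move/SP => [].
  by move=> yz; apply/SP.
have kz0 z : ~ I01 z -> (fun y => k (z, y)) = cst 0%E.
  move=> zI; apply/funext => y; rewrite /k patchE ifF//.
  by apply/negP; rewrite inE => /SP[].
have ky y : I01 y -> (fun z => k (z, y)) = (fun z => (h y * derive1 phi z)%:E) \_ `[y, 1[.
  rewrite /= in_itv/= => /andP[y0 y1]; apply/funext => z; rewrite /k !patchE.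
  congr (if _ then _ else _); apply/idP/idP; rewrite !inE.
    by move/SP => []; rewrite /= !in_itv/= => /andP[_ ->] /andP[_ ->].
  rewrite /= in_itv/= => /andP[yz z1]; apply/SP.
  by rewrite /= in_itv/= z1 yz (lt_le_trans y0 yz) (ltW y0).
have ky0 y : ~ `[0, 1[%classic y -> (fun z => k (z, y)) = cst 0%E.
  move=> yI; apply/funext => z; rewrite /k patchE ifF//.
  apply/negP; rewrite inE => /SP[]; rewrite /= in_itv/= => /andP[z0 z1] /andP[y0 yz].
  by apply: yI; rewrite /= in_itv/= y0 (le_lt_trans yz).
have ik : (lam \x lam)%E.-integrable setT k.
  apply/integrable12ltyP => //.
  pose c := (\int[lam]_y `|(EFin \o h) y|)%E.
  have coo : (c < +oo)%E by case/integrableP: ih.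
  apply: (@le_lt_trans _ _ (\int[lam]_(z in I01) (M%:E * c))%E); last first.
    rewrite integral_cst//= lebesgue_measure_itv/= lte_fin ltr01 oppr0 adde0 mule1.
    by rewrite lte_mul_pinfty.
  rewrite [leRHS]integral_mkcond; apply: ge0_le_integral => //.
  - by move=> z _; apply: integral_ge0.
  - apply: (@measurable_fun_fubini_tonelli_F _ _ _ _ _ lam (abse \o k)).
      exact: measurableT_comp.
    by move=> x; exact: abse_ge0.
  - apply/(measurable_restrictT _ _).1 => //; exact: measurable_cst.
  - move=> z _; rewrite patchE; case: ifPn => [|/negP] zI; last first.
      rewrite (eq_integral (cst 0%E)) ?integral0// => y _.
      rewrite -[k (z, y)]/((fun y => k (z, y)) y) kz0 ?abse0// => zI'.
      by apply: zI; rewrite inE.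
    rewrite inE in zI.
    rewrite -ge0_integralZl//; last first.
      by apply: measurableT_comp => //; exact/measurable_EFinP.
    apply: ge0_le_integral => //.
    + apply: measurableT_comp => //; rewrite kz//.
      apply/(measurable_restrictT _ _).1 => //; apply: measurable_funTS.
      by apply/measurable_EFinP; apply: measurable_funM => //; exact: measurable_cst.
    + apply: measurable_funeM; apply: measurableT_comp => //; exact/measurable_EFinP.
    + move=> y _; rewrite -[k (z, y)]/((fun y => k (z, y)) y) kz//.
      rewrite patchE; case: ifPn => _; last by rewrite abse0 mule_ge0.
      rewrite /= -EFinM lee_fin normrM mulrC ler_wpM2r// phiM//.
      by apply: subset_itv_oo_cc.
have fubini : (\int[lam]_z \int[lam]_y k (z, y) = \int[lam]_y \int[lam]_z k (z, y))%E.
  exact: Fubini.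
have L : (\int[lam]_z \int[lam]_y k (z, y) =
    \int[lam]_(z in I01) (prim h z * derive1 phi z)%:E)%E.
  rewrite [RHS]integral_mkcond; apply: eq_integral => z _; rewrite patchE.
  case: ifPn => [|/negP] zI; last first.
    have zI' : ~ I01 z by move=> h'; apply: zI; rewrite inE.
    by rewrite (kz0 z zI') integral0.
  rewrite inE in zI; rewrite (kz z zI) -integral_mkcond.
  have ih0z : lam.-integrable `[0, z] (EFin \o h) by exact: integrableT_itv.
  transitivity (\int[lam]_(y in `[0%R, z]) ((derive1 phi z)%:E * (h y)%:E))%E.
    by apply: eq_integral => y _; rewrite -EFinM mulrC.
  rewrite [in RHS]mulrC [RHS]EFinM (EFin_prim _ ih).
  rewrite -(EFin_integralZl _ (measurable_itv _) ih0z).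
  by apply: eq_integral => y _; rewrite EFinM.
have Rr : (\int[lam]_y \int[lam]_z k (z, y) =
    \int[lam]_(y in I01) (- (h y * phi y))%:E)%E.
  have -> : (\int[lam]_y \int[lam]_z k (z, y) =
      \int[lam]_(y in `[0%R, 1%R[) \int[lam]_z k (z, y))%E.
    rewrite [RHS]integral_mkcond; apply: eq_integral => y _; rewrite patchE.
    case: ifPn => [//|/negP yI].
    have yI' : ~ `[0, 1[%classic y by move=> h'; apply: yI; rewrite inE.
    by rewrite (ky0 y yI') integral0.
  rewrite -[LHS]integral_itv_obnd_cbnd; last first.
    apply: measurable_funTS; exact: (measurable_fubini_G ik).
  apply: eq_integral => y; rewrite inE => yI; rewrite (ky y yI) -integral_mkcond.
  exact: integral_derive1_tail.
by rewrite goalR -Rr -fubini L.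
Qed.

End primitives_on_the_line.

(** * The lemma of du Bois-Reymond *)

Section du_bois_reymond.
Context {R : realType}.
Local Notation lam := (@lebesgue_measure R).
Local Notation I01 := (`]0%R, 1%R[%classic : set R).
Implicit Types (h phi psi : R -> R) (a b : R).

Lemma Rintegral_support psi a b (D : set R) : measurable D ->
  (forall z, psi z != 0 -> a <= z <= b) -> `[a, b] `<=` D ->
  \int[lam]_(z in D) psi z = \int[lam]_(z in `[a, b]) psi z.
Proof.
move=> mD supp abD; rewrite Rintegral_mkcond [RHS]Rintegral_mkcond.
apply: eq_Rintegral => z _; rewrite !patchE.
case: ifPn => zD; case: ifPn => zab //.
- move: zab; rewrite notin_setE/= in_itv/= => /negP; apply: contraNeq => h.
  exact: supp.
- by case/negP: zD; rewrite inE; apply: abD; rewrite -inE.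
Qed.

(** The primitive from the left vanishes to the right of the support because the
    mean is zero. *)
Lemma test_function_primitive psi a b : continuous psi -> 0 < a -> b < 1 ->
  (forall z, psi z != 0 -> a <= z <= b) -> \int[lam]_(z in I01) psi z = 0 ->
  exists2 phi, test_function phi & derive1 phi = psi.
Proof.
move=> cpsi a0 b1 supp ipsi0.
have iab : lam.-integrable `[a, b] (EFin \o psi).
  apply: continuous_compact_integrable; first exact: segment_compact.
  exact: continuous_subspaceT.
have ipsi : lam.-integrable setT (EFin \o psi).
  rewrite (_ : EFin \o psi = (EFin \o psi) \_ `[a, b]); last first.
    apply/funext => z; rewrite patchE; case: ifPn => // /negP zab /=.
    have [->//|/supp zab'] := eqVneq (psi z) 0.
    by case: zab; rewrite inE/= in_itv.
  by rewrite -integrable_mkcond.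
pose phi z := \int[lam]_(y in `]-oo, z]) psi y.
have dphi z : derivable phi z 1 /\ derive1 phi z = psi z.
  apply: (@continuous_FTC1 R psi -oo%O z (z + 1)); rewrite ?ltrDl//.
  - by apply: integrableS ipsi.
  - by rewrite ltNyr.
  - exact: cpsi.
exists phi; last by apply/funext => z; case: (dphi z).
split.
- by move=> z; case: (dphi z).
- by have -> : derive1 phi = psi by apply/funext => z; case: (dphi z).
- exists a, b; split=> // z; apply: contraNT.
  rewrite negb_and -!ltNge => /orP[za|bz].
    rewrite /phi (@eq_Rintegral _ _ _ _ _ (cst 0)).
      by rewrite Rintegral_cst// mul0r.
    move=> y; rewrite inE/= in_itv/= => yz.
    have [->//|/supp/andP[ay _]] := eqVneq (psi y) 0.
    by have := le_lt_trans (le_trans ay yz) za; rewrite ltxx.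
  apply/eqP; rewrite /phi (@Rintegral_support _ a b)//; last first.
    by apply: subset_itv; rewrite bnd_simp// ltW.
  rewrite -(@Rintegral_support _ a b I01)//.
  by apply: subset_itv; rewrite bnd_simp.
Qed.

(** A continuous approximation of the indicator of ]a, b[ that vanishes outside
    [a, b]. *)
Definition trapezoid (n : nat) a b (z : R) : R :=
  Num.max 0 (Num.min 1 (Num.min (n%:R * (z - a)) (n%:R * (b - z)))).

Lemma trapezoid_continuous n a b : continuous (trapezoid n a b).
Proof.
move=> z.
have lin (k c : R) : {for z, continuous (fun x => k * (x - c))}.
  by apply: cvgMr; apply: cvgB; [exact: cvg_id|exact: cvg_cst].
have lin' (k c : R) : {for z, continuous (fun x => k * (c - x))}.
  by apply: cvgMr; apply: cvgB; [exact: cvg_cst|exact: cvg_id].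
pose m1 (x : R) := Num.min (n%:R * (x - a)) (n%:R * (b - x)).
pose m2 (x : R) := Num.min 1 (m1 x).
have cm1 : {for z, continuous m1} by exact: (@continuous_min R R _ _ z (lin _ _) (lin' _ _)).
have cm2 : {for z, continuous m2}.
  by apply: (@continuous_min R R (cst 1) m1 z) => //; exact: cst_continuous.
by apply: (@continuous_max R R (cst 0) m2 z) => //; exact: cst_continuous.
Qed.

Lemma trapezoid_bound n a b z : 0 <= trapezoid n a b z <= 1.
Proof. by rewrite /trapezoid le_max lexx/= ge_max ler01 ge_min lexx. Qed.

Lemma trapezoid_supp n a b z : trapezoid n a b z != 0 -> a <= z <= b.
Proof.
apply: contraNT; rewrite negb_and -!ltNge => zab.
rewrite eq_le; have /andP[-> _] := trapezoid_bound n a b z; rewrite andbT.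
rewrite /trapezoid ge_max lexx/= !ge_min; apply/orP; right.
have n0 := ler0n R n.
by case/orP: zab => zab; apply/orP; [left|right]; nra.
Qed.

Lemma trapezoid_cvg a b z :
  trapezoid n a b z @[n --> \oo] --> (\1_(`]a, b[%classic) z : R).
Proof.
rewrite indicE; have [zab|zab] := boolP (z \in _).
  move: zab; rewrite inE/= in_itv/= => /andP[az zb].
  apply: cvg_near_cst.
  exists (Num.bound (Num.max (z - a)^-1 (b - z)^-1)) => // n /= hn.
  have h0 : 0 <= Num.max (z - a)^-1 (b - z)^-1.
    by rewrite le_max invr_ge0 subr_ge0 (ltW az).
  have hn' : Num.max (z - a)^-1 (b - z)^-1 <= n%:R.
    by rewrite (le_trans (ltW (archi_boundP h0)))// ler_nat.
  move: hn'; rewrite ge_max => /andP[h1 h2].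
  rewrite /trapezoid min_l ?max_r// le_min.
  by rewrite -!ler_pdivrMr ?subr_gt0// !div1r h1 h2.
apply: cvg_near_cst; apply: nearW => n.
rewrite /trapezoid max_l// !ge_min; apply/orP; right.
move: zab; rewrite notin_setE/= in_itv/= => /negP; rewrite negb_and -!leNgt.
have n0 := ler0n R n.
by move=> /orP[h|h]; apply/orP; [left|right]; nra.
Qed.

Lemma trapezoid_int_cvg h a b : lam.-integrable I01 (EFin \o h) ->
  0 <= a -> b <= 1 ->
  \int[lam]_(z in I01) (h z * trapezoid n a b z) @[n --> \oo] -->
  \int[lam]_(z in `]a, b[) h z.
Proof.
move=> ih a0 b1.
have mh : measurable_fun I01 h by apply/measurable_EFinP; exact: measurable_int ih.
have abI : `]a, b[ `<=` I01 by apply: subset_itv; rewrite bnd_simp.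
have mt n : measurable_fun I01 (trapezoid n a b).
  apply: measurable_funTS; apply: continuous_measurable_fun.
  exact: trapezoid_continuous.
have [] := @dominated_convergence _ _ _ lam I01 (measurable_itv _)
  (fun n z => (h z * trapezoid n a b z)%:E)
  (fun z => (h z * \1_(`]a, b[%classic) z)%:E) (fun z => `|(h z)%:E|)%E.
- move=> n; apply/measurable_EFinP; apply: measurable_funM; first exact: mh.
  exact: mt.
- by apply/measurable_EFinP; apply: measurable_funM.
- apply: aeW => z _; apply: cvg_EFin; first exact: nearW.
  by apply: cvgMr; exact: trapezoid_cvg.
- exact: integrable_abse.
- apply: aeW => z n _; rewrite lee_fin normrM ler_piMr//.
  by have /andP[t0 t1] := trapezoid_bound n a b z; rewrite ger0_norm.
move=> _ _.
have -> : (\int[lam]_(z in I01) (h z * \1_(`]a, b[%classic) z)%:E =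
    (\int[lam]_(z in `]a, b[) h z)%:E)%E.
  rewrite /Rintegral fineK; last first.
    by apply: integrable_fin_num => //; apply: integrableS ih.
  rewrite [LHS]integral_mkcond [RHS]integral_mkcond; apply: eq_integral => z _.
  rewrite !patchE indicE; case: (boolP (z \in `]a, b[%classic)) => zab.
    by rewrite mem_set ?mulr1//; apply: abI; rewrite -inE.
  by rewrite mulr0; case: ifPn.
by move=> /fine_cvgP[].
Qed.

End du_bois_reymond.

Section weak_derivatives.
Context {R : realType}.
Local Notation lam := (@lebesgue_measure R).
Local Notation I01 := (`]0%R, 1%R[%classic : set R).
Implicit Types (f g : L2 R) (h u phi psi : R -> R).

Lemma lebesgue_I01_lty : (lam I01 < +oo)%E.
Proof. exact: lebesgue_unit_itv_lty. Qed.

Lemma integrable_L2 f : lam.-integrable I01 (EFin \o (f : R -> R)).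
Proof.
apply: sqint_integrable => //; first exact: lebesgue_I01_lty.
  by apply: measurable_funTS; exact: measurable_L2.
exact: sqint_L2_lty.
Qed.

Lemma restrict_integrable h : lam.-integrable I01 (EFin \o h) ->
  lam.-integrable setT (EFin \o (h \_ I01)).
Proof.
move=> ih; rewrite (_ : _ \o _ = (EFin \o h) \_ I01) -?integrable_mkcond//.
by apply/funext => z; rewrite /= !patchE; case: ifPn.
Qed.

Lemma measurable_restrict_I01 h : measurable_fun I01 h ->
  measurable_fun setT (h \_ I01).
Proof. by move=> mh; apply/(measurable_restrictT _ _).1. Qed.

Lemma weak_derivativeP f g : weak_derivative f g <-> forall phi, test_function phi ->
  \int[lam]_(z in I01) (f z * derive1 phi z) =
  - (\int[lam]_(z in I01) (g z * phi z)).
Proof.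
have H phi : test_function phi ->
    \int[mu01 R]_z (f z * derive1 phi z) = \int[lam]_(z in I01) (f z * derive1 phi z) /\
    \int[mu01 R]_z (g z * phi z) = \int[lam]_(z in I01) (g z * phi z).
  move=> [dphi cphi' _]; split; apply: Rintegral_mu01; apply: measurable_funM.
  - exact: measurable_L2.
  - exact: continuous_measurable_fun.
  - exact: measurable_L2.
  - apply: continuous_measurable_fun => z.
    by apply: differentiable_continuous; exact/derivable1_diffP.
by split=> wd phi tphi; have := wd phi tphi; have [-> ->] := H phi tphi.
Qed.

Lemma ae_L2_eq (f g : L2 R) :
  {ae lam, forall z, I01 z -> f z = g z} -> f = g.
Proof.
move=> /mu01_ae fg; apply: Lspace2_eq.
have FF := ae_filter_ringOfSetsType (mu01 R).
by apply: filterS fg => z.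
Qed.

Lemma L2_ae_eq f h : (f : R -> R) = h %[ae mu01 R] <->
  {ae lam, forall z, I01 z -> f z = h z}.
Proof.
have FF := ae_filter_ringOfSetsType (mu01 R).
split=> [fh|/mu01_ae fh]; [apply/mu01_ae|]; apply: filterS fh => z //.
exact.
Qed.

Lemma eq_ae_Rintegral (D : set R) h u : measurable D -> measurable_fun D h ->
  measurable_fun D u -> {ae lam, forall z, D z -> h z = u z} ->
  \int[lam]_(z in D) h z = \int[lam]_(z in D) u z.
Proof.
move=> mD mh mu hu; rewrite /Rintegral; congr fine.
apply: ae_eq_integral => //; [exact/measurable_EFinP|exact/measurable_EFinP|].
have FF := ae_filter_ringOfSetsType lam.
by apply: filterS hu => z /= + Dz => ->.
Qed.

Lemma Rintegral_L2_0 psi : continuous psi ->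
  \int[lam]_(z in I01) ((0 : L2 R) z * psi z) = 0.
Proof.
move=> cpsi; rewrite (@eq_ae_Rintegral _ _ (cst 0))//.
- by rewrite Rintegral_cst// mul0r.
- apply: measurable_funTS; apply: measurable_funM; first exact: measurable_L2.
  exact: continuous_measurable_fun.
- have /L2_ae_eq := Lspace2_0E (mu01 R).
  have FF := ae_filter_ringOfSetsType lam.
  by apply: filterS => z /= + zI => /(_ zI) ->; rewrite mul0r.
Qed.

(** A weight of nonzero mean, by which a function is corrected to have mean
    zero. *)
Lemma exists_bump : exists n,
  \int[lam]_(z in I01) trapezoid n (4^-1) (3 / 4) z != 0.
Proof.
apply: contrapT => nex.
have h n : \int[lam]_(z in I01) trapezoid n (4^-1) (3 / 4) z = 0.
  by apply/eqP/negPn/negP => h; apply: nex; exists n.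
have i1 : lam.-integrable I01 (EFin \o cst 1).
  by apply: integrable_cst_fin => //; exact: lebesgue_I01_lty.
have q0 : 0 <= 4^-1 :> R by lra.
have q1 : 3 / 4 <= 1 :> R by lra.
have := trapezoid_int_cvg i1 q0 q1.
have -> : \int[lam]_(z in `]4^-1, (3 / 4)[) (cst 1 : R -> R) z = 2^-1.
  rewrite Rintegral_cst//= lebesgue_measure_itv/= lte_fin ifT; last by lra.
  by rewrite mul1r/=; lra.
have -> : (fun n => \int[lam]_(z in I01) (cst 1 z * trapezoid n 4^-1 (3 / 4) z)) =
    (cst 0 : nat -> R).
  by apply/funext => n; rewrite -[RHS](h n); apply: eq_Rintegral => z _; rewrite mul1r.
move=> h0; suff : 2^-1 = 0 :> R by lra.
rewrite -(cvg_lim (@Rhausdorff R) h0); apply: cvg_lim; [exact: Rhausdorff|exact: cvg_cst].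
Qed.

(** f is orthogonal to the continuous functions of compact support and mean zero,
    which are the derivatives of test functions. So its integral against a
    trapezoid is k times that of the trapezoid, where k does not depend on the
    trapezoid; in the limit f - k has integral 0 over every interval. *)
Lemma du_bois_reymond f : weak_derivative f 0 ->
  exists k : R, {ae lam, forall z, I01 z -> f z = k}.
Proof.
move=> /weak_derivativeP wd.
have key psi a b : continuous psi -> 0 < a -> b < 1 ->
    (forall z, psi z != 0 -> a <= z <= b) -> \int[lam]_(z in I01) psi z = 0 ->
    \int[lam]_(z in I01) (f z * psi z) = 0.
  move=> cpsi a0 b1 supp ipsi.
  have [phi tphi phi'] := test_function_primitive cpsi a0 b1 supp ipsi.
  rewrite -phi' wd// Rintegral_L2_0 ?oppr0//.
  move=> z; have [dphi _ _] := tphi.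
  by apply: differentiable_continuous; exact/derivable1_diffP.
have [n0 eta0] := exists_bump.
set eta := trapezoid n0 (4^-1) (3 / 4) in eta0.
have ceta : continuous eta by exact: trapezoid_continuous.
pose k := (\int[lam]_(z in I01) (f z * eta z)) / \int[lam]_(z in I01) eta z.
have iint psi : continuous psi -> lam.-integrable I01 (EFin \o psi).
  move=> cpsi; apply: (@integrableS _ _ _ lam `[0, 1]) => //.
    exact: subset_itv_oo_cc.
  apply: continuous_compact_integrable; first exact: segment_compact.
  exact: continuous_subspaceT.
have ifpsi psi : continuous psi -> lam.-integrable I01 (EFin \o (f \* psi)).
  by move=> cpsi; apply: integrable_mul_continuous => //; exact: integrable_L2.
have trap n a b : 0 < a -> b < 1 ->
    \int[lam]_(z in I01) (f z * trapezoid n a b z) =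
    k * \int[lam]_(z in I01) (trapezoid n a b z).
  move=> a0 b1.
  set tau := trapezoid n a b.
  have ctau : continuous tau by exact: trapezoid_continuous.
  pose r := (\int[lam]_(z in I01) tau z) / \int[lam]_(z in I01) eta z.
  pose psi z := tau z - r * eta z.
  have creta : continuous (fun z => r * eta z).
    by move=> z; apply: cvgMr; exact: ceta.
  have cpsi : continuous psi.
    by move=> z; apply: cvgB; [exact: ctau|exact: creta].
  have psi0 : \int[lam]_(z in I01) psi z = 0.
    rewrite /psi RintegralB//; [|exact: iint|exact: iint].
    rewrite RintegralZl//; last exact: iint.
    by rewrite /r divfK// subrr.
  have := key psi (Num.min a 4^-1) (Num.max b (3 / 4)) cpsi.
  rewrite lt_min gt_max a0 b1 /= => /(_ _ _ _ psi0) fpsi0.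
  have : \int[lam]_(z in I01) (f z * psi z) = 0.
    apply: fpsi0; [lra|lra|] => z psiz.
    have : (tau z != 0) || (eta z != 0).
      by apply: contraNT psiz; rewrite negb_or !negbK => /andP[/eqP h1 /eqP h2];
        rewrite /psi h1 h2 mulr0 subr0.
    rewrite ge_min le_max => /orP[/trapezoid_supp|/trapezoid_supp] /andP[-> ->];
      by rewrite ?orbT.
  have -> : \int[lam]_(z in I01) (f z * psi z) =
     \int[lam]_(z in I01) (f z * tau z - r * (f z * eta z)).
    by apply: eq_Rintegral => z _; rewrite /psi; ring.
  have ireta : lam.-integrable I01 (EFin \o (fun z => r * (f z * eta z))).
    rewrite (_ : _ \o _ = EFin \o (f \* (fun z => r * eta z))); first exact: ifpsi.
    by apply/funext => z /=; congr EFin; ring.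
  rewrite RintegralB//; last exact: ifpsi.
  rewrite RintegralZl//; last exact: ifpsi.
  move=> /eqP; rewrite subr_eq0 => /eqP ->.
  by rewrite /r /k; ring.
exists k.
have int_ab a b : 0 < a -> b < 1 -> \int[lam]_(z in `]a, b[) f z =
    \int[lam]_(z in `]a, b[) k.
  move=> a0 b1.
  have c1 := trapezoid_int_cvg (integrable_L2 f) (ltW a0) (ltW b1).
  have ik : lam.-integrable I01 (EFin \o cst k).
    by apply: integrable_cst_fin => //; exact: lebesgue_I01_lty.
  have c2 := trapezoid_int_cvg ik (ltW a0) (ltW b1).
  rewrite -(cvg_lim (@Rhausdorff R) c1) -(cvg_lim (@Rhausdorff R) c2).
  congr (limn _); apply/funext => n; rewrite trap// RintegralZl//; apply: iint.
  exact: trapezoid_continuous.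
pose h z := f z - k.
have mh : measurable_fun setT h.
  by apply: measurable_funB; [exact: measurable_L2|exact: measurable_cst].
have ih : lam.-integrable I01 (EFin \o h).
  rewrite (_ : _ \o _ = (EFin \o (f : R -> R)) \- (EFin \o cst k))%E//.
  apply: integrableB => //; first exact: integrable_L2.
  by apply: integrable_cst_fin => //; exact: lebesgue_I01_lty.
have FF := ae_filter_ringOfSetsType lam.
suff : {ae lam, forall z, I01 z -> (h \_ I01) z = 0}.
  apply: filterS => z /= + zI => /(_ zI).
  by rewrite patchE mem_set// /h => /subr0_eq.
apply: prim_cst_ae0; first exact: restrict_integrable.
move=> x y x0 xy y1.
have xyI : `]x, y] `<=` I01.
  move=> z /=; rewrite !in_itv/= => /andP[xz zy].
  by rewrite (lt_trans x0 xz) (le_lt_trans zy y1).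
apply/esym/eqP; rewrite -subr_eq0 prim_diff ?(ltW x0) ?(ltW xy)//; last first.
  exact: restrict_integrable.
rewrite (@eq_Rintegral _ _ _ _ _ h); last first.
  by move=> z; rewrite inE => zxy; rewrite patchE mem_set//; exact: xyI.
have xyI' : `]x, y[ `<=` I01.
  by apply: subset_trans xyI; apply: subset_itv; rewrite bnd_simp.
rewrite -Rintegral_itv_bndo_bndc; last first.
  by apply: (@integrableS _ _ _ lam I01 `]x, y[%classic) => //.
rewrite RintegralB//; last 2 first.
- by apply: (@integrableS _ _ _ lam I01 `]x, y[%classic) => //; exact: integrable_L2.
- apply: integrable_cst_fin => //=.
  by rewrite lebesgue_measure_itv/=; case: ifPn => _; rewrite ?ltry// -EFinB ltry.
by rewrite int_ab// subrr.
Qed.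

End weak_derivatives.

(** * Sobolev functions on the unit interval *)

Section sobolev.
Context {R : realType}.
Local Notation lam := (@lebesgue_measure R).
Local Notation I01 := (`]0%R, 1%R[%classic : set R).
Implicit Types (f g : L2 R) (h u v phi : R -> R) (a b x : R).

(** Otherwise the functions differ on a nonempty open interval. *)
Lemma eq_continuous_ae u v : {within `[0, 1], continuous u} ->
  {within `[0, 1], continuous v} -> {ae lam, forall z, I01 z -> u z = v z} ->
  forall x, 0 <= x <= 1 -> u x = v x.
Proof.
move=> cu cv [N [mN N0 uvN]] x x01; apply: contrapT => /eqP.
rewrite -subr_eq0 => uvx.
have xI : `[0, 1]%classic x by rewrite /= in_itv.
have : within `[0, 1]%classic (nbhs x) [set y | u y - v y != 0].
  rewrite (nbhs_subspace_in xI).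
  have cd : {within `[0, 1], continuous (fun y => u y - v y)}.
    by move=> z; apply: cvgB; [exact: cu|exact: cv].
  exact: (cvgr_neq0 _ (cd x) uvx).
move=> [e /= e0 he].
pose p := Num.max 0 (x - e); pose q := Num.min 1 (x + e).
case/andP: x01 => x0 x1.
have pq : p < q by rewrite lt_min !gt_max; apply/andP; split; apply/andP; split; lra.
have sub : `]p, q[ `<=` N.
  move=> z; rewrite /= in_itv/= gt_max lt_min => /andP[/andP[z0 z1] /andP[z2 z3]].
  have zI : I01 z by rewrite /= in_itv/= z0 z2.
  apply: uvN => /= /(_ zI) uvz.
  have : u z - v z != 0.
    apply: he => /=; first by rewrite ltr_distlC; apply/andP; split; lra.
    by rewrite in_itv/= !ltW.
  by rewrite uvz subrr eqxx.
have : (lam `]p, q[ <= lam N)%E by apply: le_measure; rewrite ?inE.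
rewrite N0 lebesgue_measure_itv/= lte_fin pq -EFinB lee_fin; lra.
Qed.

Lemma has_value_unique f a b c : 0 <= a <= 1 -> has_value f a b -> has_value f a c ->
  b = c.
Proof.
move=> a01 [u [cu /L2_ae_eq fu <-]] [v [cv /L2_ae_eq fv <-]].
apply: eq_continuous_ae => //.
have FF := ae_filter_ringOfSetsType lam.
by apply: filterS2 fu fv => z h1 h2 zI; rewrite -h1// -h2.
Qed.

Lemma value_at_eq f a b : 0 <= a <= 1 -> has_value f a b -> value_at f a = b.
Proof.
move=> a01 fab; rewrite /value_at.
by apply: (has_value_unique a01 _ fab); exact: (@xgetPex _ 0 [set c | has_value f a c] (ex_intro _ b fab)).
Qed.

(** Outside the unit interval a class of L^2 (0, 1) carries no information; this
    representative is integrable on the whole line. *)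
Definition cut f : R -> R := (f : R -> R) \_ I01.

Lemma cut_integrable f : lam.-integrable setT (EFin \o cut f).
Proof. by apply: restrict_integrable; exact: integrable_L2. Qed.

Lemma measurable_cut f : measurable_fun setT (cut f).
Proof.
apply: measurable_restrict_I01; apply: measurable_funTS; exact: measurable_L2.
Qed.

Lemma cutE f z : I01 z -> cut f z = f z.
Proof. by move=> zI; rewrite /cut patchE mem_set. Qed.

Lemma ae_cut f : {ae lam, forall z, I01 z -> f z = cut f z}.
Proof. by apply: aeW => z zI; rewrite cutE. Qed.

Lemma continuous_L2_class u : {within `[0, 1], continuous u} ->
  exists f : L2 R, {ae lam, forall z, I01 z -> f z = u z}.
Proof.
move=> cu.
have mu : measurable_fun I01 u.
  have mu1 : measurable_fun (`[0, 1]%classic : set R) u.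
    exact: subspace_continuous_measurable_fun.
  by apply: measurable_funS mu1 => //; exact: subset_itv_oo_cc.
have [M M0 uM] := continuous_bounded01 cu.
have mcu := measurable_restrict_I01 mu.
have uL : u \_ I01 \in Lfun (mu01 R) 2%:E.
  apply: Lfun2P => //.
  apply: (@le_lt_trans _ _ (sqint lam I01 (cst M))).
    apply: le_sqint => //; first exact: measurable_funTS.
    move=> z zI; rewrite patchE zI [leRHS]ger0_norm//; apply: uM.
    by apply: subset_itv_oo_cc; rewrite inE in zI.
  rewrite /sqint (eq_integral (cst (M ^+ 2)%:E))// integral_cst//= lte_mul_pinfty ?lee_fin ?sqr_ge0//.
  exact: lebesgue_I01_lty.
have := Lspace2_classE uL; move=> /L2_ae_eq fu.
exists (Lspace2_class uL).
have FF := ae_filter_ringOfSetsType lam.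
by apply: filterS fu => z /= + zI => /(_ zI) ->; rewrite patchE mem_set.
Qed.

Lemma prim_continuous_cut g : {within `[0, 1], continuous (prim (cut g))}.
Proof. by apply: prim_continuous; exact: cut_integrable. Qed.

Definition primitive_class g : L2 R := sval (cid (continuous_L2_class (@prim_continuous_cut g))).

Lemma primitive_classE g : {ae lam, forall z, I01 z -> primitive_class g z = prim (cut g) z}.
Proof. exact: svalP (cid (continuous_L2_class (@prim_continuous_cut g))). Qed.

Lemma test_function_ends phi : test_function phi -> phi 0 = 0 /\ phi 1 = 0.
Proof.
move=> [_ _ [a [b [a0 b1 supp]]]]; split; apply/eqP/negPn/negP => /supp /andP[]; lra.
Qed.

Lemma test_function_continuous phi : test_function phi -> continuous phi.
Proof.
move=> [dphi _ _] z; apply: differentiable_continuous; exact/derivable1_diffP.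
Qed.

Lemma measurable_continuous_L2M f phi : continuous phi ->
  measurable_fun I01 (fun z => f z * phi z).
Proof.
move=> cphi; apply: measurable_funTS; apply: measurable_funM.
  exact: measurable_L2.
exact: continuous_measurable_fun.
Qed.

Lemma weak_derivative_prim f g (c : R) :
  {ae lam, forall z, I01 z -> f z = c + prim (cut g) z} -> weak_derivative f g.
Proof.
move=> fg; apply/weak_derivativeP => phi tphi; have [dphi cphi' _] := tphi.
have [phi0 phi1] := test_function_ends tphi.
have cphi := test_function_continuous tphi.
have iprim : lam.-integrable I01 (EFin \o prim (cut g)).
  apply: (@integrableS _ _ _ lam `[0, 1]) => //; first exact: subset_itv_oo_cc.
  apply: continuous_compact_integrable; first exact: segment_compact.
  exact: prim_continuous_cut.
have mprim : measurable_fun I01 (prim (cut g)).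
  by apply/measurable_EFinP; exact: measurable_int iprim.
have iphi' : lam.-integrable `[0, 1] (EFin \o derive1 phi).
  apply: continuous_compact_integrable; first exact: segment_compact.
  exact: continuous_subspaceT.
have iphi'I : lam.-integrable I01 (EFin \o derive1 phi).
  by apply: integrableS iphi' => //; exact: subset_itv_oo_cc.
have phi'0 : \int[lam]_(z in I01) derive1 phi z = 0.
  rewrite Rintegral_itv_bndo_bndc// Rintegral_itv_obnd_cbnd; last first.
    by apply: integrableS iphi' => //; apply: subset_itv; rewrite bnd_simp.
  rewrite /Rintegral (@continuous_FTC2 R (derive1 phi) phi 0 1 ltr01)//.
  - by rewrite phi0 phi1 subee.
  - exact: continuous_subspaceT.
  - by split=> //; [apply: cvg_at_right_filter|apply: cvg_at_left_filter]; exact: cphi.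
rewrite (@eq_ae_Rintegral _ _ _ (fun z => c * derive1 phi z +
    prim (cut g) z * derive1 phi z))//; last 3 first.
- exact: measurable_continuous_L2M.
- have mphi' : measurable_fun I01 (derive1 phi).
    by apply: measurable_funTS; exact: continuous_measurable_fun.
  by apply: measurable_funD; apply: measurable_funM.
- have FF := ae_filter_ringOfSetsType lam.
  by apply: filterS fg => z /= + zI => /(_ zI) ->; rewrite mulrDl.
have icphi' : lam.-integrable I01 (EFin \o (fun z => c * derive1 phi z)).
  rewrite (_ : _ \o _ = (fun z => c%:E * (derive1 phi z)%:E)%E)//.
  exact: integrableZl.
rewrite RintegralD//; last exact: integrable_mul_continuous.
rewrite RintegralZl// phi'0 mulr0 add0r.
rewrite (prim_by_parts (cut_integrable g) (measurable_cut g))//.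
by congr (- _); apply: eq_Rintegral => z; rewrite inE => zI; rewrite cutE.
Qed.

Lemma weak_derivativeD (k : R) f g f' g' : weak_derivative f f' ->
  weak_derivative g g' -> weak_derivative (k *: f + g) (k *: f' + g').
Proof.
move=> ff' gg' phi tphi; have [_ cphi' _] := tphi.
have cphi := test_function_continuous tphi.
by rewrite !Rintegral_L2_linear// ff'// gg'// mulrN opprD.
Qed.

Lemma weak_derivative0 : weak_derivative (0 : L2 R) 0.
Proof.
apply/weak_derivativeP => phi tphi; have [_ cphi' _] := tphi.
by rewrite !Rintegral_L2_0 ?oppr0//; exact: test_function_continuous.
Qed.

(** The difference of f and a primitive of g has weak derivative 0, hence is
    constant by the lemma of du Bois-Reymond. *)
Lemma weak_derivative_primP f g : weak_derivative f g <->
  exists c : R, {ae lam, forall z, I01 z -> f z = c + prim (cut g) z}.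
Proof.
split=> [fg|[c]]; last exact: weak_derivative_prim.
have Gg : weak_derivative (primitive_class g) g.
  apply: (@weak_derivative_prim _ _ 0).
  have FF := ae_filter_ringOfSetsType lam.
  by apply: filterS (primitive_classE g) => z /= + zI => /(_ zI) ->; rewrite add0r.
have := weak_derivativeD (-1) Gg fg; rewrite !scaleN1r addNr.
move=> /du_bois_reymond[k hk]; exists k.
have FF := ae_filter_ringOfSetsType lam.
have /L2_ae_eq h1 := Lspace2_DE (- primitive_class g) f.
have /L2_ae_eq h2 := Lspace2_NE (primitive_class g).
apply: filterS (filterI (filterI h1 h2) (filterI hk (primitive_classE g))) => z /=.
move=> [[e1 e2] [e3 e4]] zI; move: (e1 zI) (e2 zI) (e3 zI) (e4 zI).
rewrite /= => -> -> <- <-; ring.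
Qed.

(** The difference of two weak derivatives of f is a weak derivative of 0, so
    its primitive is constant. *)
Lemma weak_derivative_unique f g g' : weak_derivative f g ->
  weak_derivative f g' -> g = g'.
Proof.
move=> fg fg'.
have := weak_derivativeD (-1) fg fg'; rewrite !scaleN1r !addNr.
set d := - g + g'; move=> /weak_derivative_primP[c hc].
have FF := ae_filter_ringOfSetsType lam.
have d0 : {ae lam, forall z, I01 z -> - c = prim (cut d) z}.
  have /L2_ae_eq h0 := Lspace2_0E (mu01 R).
  apply: filterS2 hc h0 => z e1 e2 zI; have := etrans (esym (e2 zI)) (e1 zI).
  by move=> /esym/eqP; rewrite /= addrC addr_eq0 => /eqP ->.
have {}d0 x : 0 < x -> x < 1 -> prim (cut d) x = - c.
  move=> x0 x1; apply/esym.
  apply: (@eq_continuous_ae (cst (- c)) (prim (cut d))) => //.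
  - by apply: continuous_subspaceT => y; exact: cvg_cst.
  - exact: prim_continuous_cut.
  - by rewrite !ltW.
have : {ae lam, forall z, I01 z -> cut d z = 0}.
  apply: prim_cst_ae0; first exact: cut_integrable.
  by move=> x y x0 xy y1; rewrite !d0// ?(lt_trans xy)// (lt_trans x0).
move=> dz0; apply/esym/eqP; rewrite -subr_eq0 addrC -/d; apply/eqP.
apply: ae_L2_eq; have /L2_ae_eq h0 := Lspace2_0E (mu01 R).
by apply: filterS2 dz0 h0 => z + + zI => /(_ zI) + /(_ zI) ->; rewrite cutE.
Qed.

Lemma dz_eq f g : weak_derivative f g -> dz f = g.
Proof.
move=> fg; apply: (weak_derivative_unique _ fg).
exact: (@xgetPex _ 0 [set g | weak_derivative f g] (ex_intro _ g fg)).
Qed.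

Lemma dzP f : H1 f -> weak_derivative f (dz f).
Proof. by move=> [g fg]; rewrite (dz_eq fg). Qed.

Lemma H1D (k : R) f g : H1 f -> H1 g -> H1 (k *: f + g).
Proof. by move=> [f' ff'] [g' gg']; exists (k *: f' + g'); exact: weak_derivativeD. Qed.

Lemma dzD (k : R) f g : H1 f -> H1 g -> dz (k *: f + g) = k *: dz f + dz g.
Proof. by move=> /dzP ff' /dzP gg'; apply: dz_eq; exact: weak_derivativeD. Qed.

Lemma H1_primE f : H1 f ->
  exists c : R, {ae lam, forall z, I01 z -> f z = c + prim (cut (dz f)) z}.
Proof. by move=> /dzP /weak_derivative_primP. Qed.

Lemma prim_has_value f g (c a : R) :
  {ae lam, forall z, I01 z -> f z = c + prim (cut g) z} ->
  has_value f a (c + prim (cut g) a).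
Proof.
move=> fg; exists (fun z => c + prim (cut g) z); split=> //; last exact/L2_ae_eq.
by move=> z; apply: cvgD; [exact: cvg_cst|exact: prim_continuous_cut].
Qed.

Lemma prim0 h : prim h 0 = 0.
Proof. by rewrite /prim set_itv1 Rintegral_set1. Qed.

Lemma H10_primE f : H10 f -> {ae lam, forall z, I01 z -> f z = prim (cut (dz f)) z}.
Proof.
move=> [/H1_primE[c fc] f0].
have c0 : c = 0.
  apply: (has_value_unique (a := 0) _ _ f0); first by rewrite lexx ler01.
  by have := prim_has_value 0 fc; rewrite prim0 addr0.
have FF := ae_filter_ringOfSetsType lam.
by apply: filterS fc => z /= + zI => /(_ zI) ->; rewrite c0 add0r.
Qed.

Lemma H1_value1_primE f : H1 f -> value_at f 1 = 0 ->
  {ae lam, forall z, I01 z -> f z = prim (cut (dz f)) z - prim (cut (dz f)) 1}.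
Proof.
move=> /H1_primE[c fc] f1.
have := prim_has_value 1 fc.
move=> /(value_at_eq _); rewrite f1 lexx ler01 => /(_ isT) /esym /eqP.
rewrite addr_eq0 => /eqP cE.
have FF := ae_filter_ringOfSetsType lam.
by apply: filterS fc => z /= + zI => /(_ zI) ->; rewrite cE addrC.
Qed.

Lemma primitive_class_H10 g : H10 (primitive_class g).
Proof.
have hg : {ae lam, forall z, I01 z -> primitive_class g z = 0 + prim (cut g) z}.
  have FF := ae_filter_ringOfSetsType lam.
  by apply: filterS (primitive_classE g) => z /= + zI => /(_ zI) ->; rewrite add0r.
split; first by exists g; exact: weak_derivative_prim hg.
by have := prim_has_value 0 hg; rewrite prim0 addr0.
Qed.

Lemma dz_primitive_class g : dz (primitive_class g) = g.
Proof.
apply: dz_eq; apply: (@weak_derivative_prim _ _ 0).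
have FF := ae_filter_ringOfSetsType lam.
by apply: filterS (primitive_classE g) => z /= + zI => /(_ zI) ->; rewrite add0r.
Qed.

Lemma H10_dz_inj f g : H10 f -> H10 g -> dz f = dz g -> f = g.
Proof.
move=> Hf Hg fg; apply: ae_L2_eq.
have FF := ae_filter_ringOfSetsType lam.
apply: filterS2 (H10_primE Hf) (H10_primE Hg) => z + + zI.
by move=> /(_ zI) -> /(_ zI) ->; rewrite fg.
Qed.

End sobolev.

(** * Even and odd antiperiodic extensions *)

Section reflection.
Context {R : realType}.
Local Notation lam := (@lebesgue_measure R).
Local Notation I01 := (`]0%R, 1%R[%classic : set R).
Implicit Types (al be w h : R -> R) (x z : R).

(** Equal to acos on [-1, 1] and measurable on the whole line. *)
Definition acos_ext (x : R) : R :=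
  (acos \_ `]-1, 1[) x + pi * \1_[set -1 : R] x.

Lemma acos_extE x : -1 <= x <= 1 -> acos_ext x = acos x.
Proof.
move=> /andP[x1 x2]; rewrite /acos_ext patchE indicE.
have [->|xN1] := eqVneq x (-1).
  have -> : (-1 : R) \in [set -1] = true by rewrite mem_set.
  rewrite mulr1 ifF ?acosN1; first by rewrite [point]/(0 : R) add0r.
  by apply/negP; rewrite inE/= in_itv/= ltxx.
have -> : x \in [set -1] = false by rewrite memNset//; exact/eqP.
rewrite mulr0 addr0; have [->|xN] := eqVneq x 1.
  rewrite ifF ?acos1//.
  by apply/negP; rewrite inE/= in_itv/= ltxx andbF.
by rewrite mem_set//= in_itv/= !lt_neqAle x1 x2 xN eq_sym xN1.
Qed.

Lemma measurable_acos_ext : measurable_fun setT acos_ext.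
Proof.
apply: measurable_funD.
  apply/(measurable_restrictT _ _).1 => //.
  apply: open_continuous_measurable_fun; first exact: interval_open.
  by move=> x; rewrite inE/= in_itv/= => xI; exact: continuous_acos.
apply: measurable_funM; first exact: measurable_cst.
by apply: measurable_indic.
Qed.

(** The distance from z to the nearest even integer. *)
Definition fold z : R := acos_ext (cos (pi * z)) / pi.

Lemma fold_id z : 0 <= z <= 1 -> fold z = z.
Proof.
move=> /andP[z0 z1]; rewrite /fold acos_extE ?cos_geN1 ?cos_le1//.
have pi0 := pi_gt0 R.
rewrite cosK; first by rewrite mulrC mulKf// gt_eqF.
by rewrite in_itv/= mulr_ge0 ?(ltW pi0)//= ler_piMr// ltW.
Qed.

Lemma foldN z : fold (- z) = fold z.
Proof. by rewrite /fold mulrN cosN. Qed.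

Lemma foldD2 z : fold (z + 2) = fold z.
Proof. by rewrite /fold mulrDr (mulr_natr pi 2) cosD2pi. Qed.

Lemma measurable_fold : measurable_fun setT fold.
Proof.
apply: measurable_funM; last exact: measurable_cst.
apply: (measurableT_comp measurable_acos_ext).
apply: continuous_measurable_fun => x; apply: continuous_comp; last exact: continuous_cos.
by apply: cvgMr; exact: cvg_id.
Qed.

Lemma measurable_sg (h : R -> R) : continuous h ->
  measurable_fun setT (fun z => Num.sg (h z)).
Proof.
move=> ch.
have -> : (fun z => Num.sg (h z)) = (fun z => \1_(h @^-1` `]0, +oo[) z - \1_(h @^-1` `]-oo, 0[) z).
  apply/funext => z; rewrite !indicE.
  have [h0|h0|h0] := sgrP (h z).
  - by rewrite !memNset/= ?subr0// in_itv/= ?h0 ltxx.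
  - rewrite mem_set/= ?in_itv/= ?h0// memNset/= ?subr0// in_itv/=.
    by rewrite ltNge (ltW h0).
  - rewrite memNset/= ?in_itv/= ?andbT; last by rewrite ltNge (ltW h0).
    by rewrite mem_set/= ?in_itv/= ?sub0r.
have mh : measurable_fun setT h by exact: continuous_measurable_fun.
have mpre (i : interval R) : measurable (h @^-1` [set` i]).
  by rewrite -[X in measurable X]setTI; apply: mh => //; exact: measurable_itv.
by apply: measurable_funB; apply: measurable_indic; exact: mpre.
Qed.

(** al extended evenly and be extended oddly about 0, both then continued with
    ext (z + 2) = - ext z. The two signs are those of the square waves that equal
    1 on ]-1, 1[ and on ]0, 2[. *)
Definition ext al be z : R :=
  Num.sg (cos (pi * z / 2)) * al (fold z) + Num.sg (sin (pi * z / 2)) * be (fold z).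

Lemma extD2 al be z : ext al be (z + 2) = - ext al be z.
Proof.
rewrite /ext foldD2 mulrDr mulrDl mulfK ?pnatr_eq0//.
by rewrite cosDpi sinDpi !sgrN !mulNr opprD.
Qed.

Lemma ext_pos al be z : al 1 = 0 -> be 0 = 0 -> 0 <= z <= 1 ->
  ext al be z = al z + be z.
Proof.
move=> al1 be0 z01; rewrite /ext fold_id//; congr (_ + _); case/andP: z01 => z0 z1.
- move: z1; rewrite le_eqVlt => /predU1P[->|z1]; first by rewrite al1 mulr0.
  rewrite gtr0_sg ?mul1r// cos_gt0_pihalf//; have pi0 := pi_gt0 R.
  by apply/andP; split; nra.
- move: z0; rewrite le_eqVlt => /predU1P[<-|z0]; first by rewrite be0 mulr0.
  rewrite gtr0_sg ?mul1r// sin_gt0_pi//; have pi0 := pi_gt0 R.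
  by apply/andP; split; nra.
Qed.

Lemma ext_neg al be z : al 1 = 0 -> be 0 = 0 -> 0 <= z <= 1 ->
  ext al be (- z) = al z - be z.
Proof.
move=> al1 be0 z01.
have := ext_pos (be := fun y => - be y) al1 _ z01.
rewrite be0 oppr0 => /(_ erefl) <-.
rewrite /ext foldN mulrN mulNr cosN sinN sgrN; congr (_ + _).
by rewrite mulNr mulrN.
Qed.

Lemma ext_pos_oo al be z : 0 < z < 1 -> ext al be z = al z + be z.
Proof.
move=> /andP[z0 z1]; have pi0 := pi_gt0 R.
rewrite /ext fold_id ?(ltW z0) ?(ltW z1)// !gtr0_sg ?mul1r//.
  by apply: sin_gt0_pi; apply/andP; split; nra.
by apply: cos_gt0_pihalf; apply/andP; split; nra.
Qed.

Lemma ext_neg_oo al be z : 0 < z < 1 -> ext al be (- z) = al z - be z.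
Proof.
move=> z01; have <- := ext_pos_oo al (fun y => - be y) z01.
rewrite /ext foldN mulrN mulNr cosN sinN sgrN; congr (_ + _).
by rewrite mulNr mulrN.
Qed.

Lemma measurable_ext al be : measurable_fun setT al -> measurable_fun setT be ->
  measurable_fun setT (ext al be).
Proof.
move=> mal mbe.
have cpi : continuous (fun z : R => pi * z / 2).
  by move=> z; apply: cvgMl; apply: cvgMr; exact: cvg_id.
apply: measurable_funD; apply: measurable_funM.
- apply: measurable_sg => z; apply: continuous_comp; [exact: cpi|exact: continuous_cos].
- exact: (measurableT_comp mal measurable_fold).
- apply: measurable_sg => z; apply: continuous_comp; [exact: cpi|exact: continuous_sin].
- exact: (measurableT_comp mbe measurable_fold).
Qed.

Definition even_part w z : R := (w z + w (- z)) / 2.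
Definition odd_part w z : R := (w z - w (- z)) / 2.

Lemma measurable_even_part w : measurable_fun setT w ->
  measurable_fun setT (even_part w).
Proof.
move=> mw; apply: measurable_funM; last exact: measurable_cst.
apply: measurable_funD => //; apply: (measurableT_comp mw); exact: oppr_measurable.
Qed.

Lemma measurable_odd_part w : measurable_fun setT w ->
  measurable_fun setT (odd_part w).
Proof.
move=> mw; apply: measurable_funM; last exact: measurable_cst.
apply: measurable_funB => //; apply: (measurableT_comp mw); exact: oppr_measurable.
Qed.

(** The cross terms at z and - z cancel. *)
Lemma period_sq_parts w : measurable_fun setT w ->
  period_sq w = (2%:E * (sqint lam I01 (even_part w) + sqint lam I01 (odd_part w)))%E.
Proof.
move=> mw.
have mwN : measurable_fun setT (fun z : R => w (- z)).
  apply: (measurableT_comp mw); exact: oppr_measurable.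
have me := measurable_even_part mw; have mo := measurable_odd_part mw.
have msq := @measurable_sqr.
have mT (f : R -> R) : measurable_fun setT f -> measurable_fun I01 (fun z => (f z ^+ 2)%:E).
  by move=> mf; apply: measurable_sqr; exact: measurable_funTS.
have sq0 (f : R -> R) z : (0 <= (f z ^+ 2)%:E :> \bar R)%E by rewrite lee_fin sqr_ge0.
rewrite /period_sq {1}/sqint (_ : `[-1, 1[%classic = `[-1, 0[%classic `|` `[0, 1[%classic :> set R); last first.
  by rewrite -itv_bndbnd_setU ?bnd_simp//; lra.
rewrite ge0_integral_setU//=; last 2 first.
- by apply: measurable_sqr; exact: measurable_funTS.
- apply/disj_setPRL => z /=; rewrite !in_itv/= => /andP[h1 h2]; apply/negP.
  by rewrite negb_and -ltNge -leNgt h1 orbT.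
have -> : (\int[lam]_(z in `[(-1)%R, 0%R[) (w z ^+ 2)%:E =
    \int[lam]_(z in I01) ((w (- z)) ^+ 2)%:E)%E.
  rewrite -integral_itv_obnd_cbnd; last first.
    by apply: measurable_sqr; exact: measurable_funTS.
  rewrite (ge0_integral_reflect (f := fun z => ((w z) ^+ 2)%:E) false true)//=.
    by rewrite oppr0.
  exact: measurable_sqr.
rewrite -integral_itv_obnd_cbnd; last by apply: measurable_sqr; exact: measurable_funTS.
rewrite -ge0_integralD//; [|exact: mT|exact: mT].
rewrite /sqint -ge0_integralD//; [|exact: mT|exact: mT].
rewrite -ge0_integralZl//; last first.
- by move=> z _; rewrite adde_ge0.
- by apply: emeasurable_funD; exact: mT.
apply: eq_integral => z _; rewrite -!EFinD -EFinM; congr EFin.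
by rewrite /even_part /odd_part; field.
Qed.

End reflection.

(** * The vibrating string as a translation group *)

Section scalar_wave_group.
Context {R : realType}.
Local Notation lam := (@lebesgue_measure R).
Local Notation I01 := (`]0%R, 1%R[%classic : set R).
Local Notation pairL2 := (L2 R * L2 R)%type.
Implicit Types (f : L2 R) (h w : R -> R) (p q : pairL2) (s t : R).

Definition L2_class h : L2 R :=
  xget 0 [set f : L2 R | {ae lam, forall z, I01 z -> f z = h z}].

Lemma L2_classE h : measurable_fun setT h -> (sqint lam I01 h < +oo)%E ->
  {ae lam, forall z, I01 z -> L2_class h z = h z}.
Proof.
move=> mh hoo; have hL := Lfun2P mh hoo.
have := Lspace2_classE hL; move=> /L2_ae_eq hE.
exact: (@xgetPex _ 0 [set f : L2 R | {ae lam, forall z, I01 z -> f z = h z}]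
  (ex_intro _ (Lspace2_class hL) hE)).
Qed.

(** d'Alembert's coding of the data p = (y_z, y_t) of a vibrating string y that
    is fixed at 0 and free at 1. The solution is y = F (z + t) - F (t - z) with
    w = 2 F', and the conditions y = 0 at 0 and y_z = 0 at 1 are the parity of
    the two parts and the antiperiodicity of w. *)
Definition represents p w : Prop :=
  [/\ antiper w, {ae lam, forall z, I01 z -> p.1 z = even_part w z} &
      {ae lam, forall z, I01 z -> p.2 z = odd_part w z}].

Definition sq_norm p : \bar R := (sqint lam I01 p.1 + sqint lam I01 p.2)%E.

Lemma sqint_ae_eq h w : measurable_fun setT h -> measurable_fun setT w ->
  {ae lam, forall z, I01 z -> h z = w z} -> sqint lam I01 h = sqint lam I01 w.
Proof.
move=> mh mw hw; apply: ae_eq_integral => //.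
- by apply: measurable_sqr; exact: measurable_funTS.
- by apply: measurable_sqr; exact: measurable_funTS.
- have FF := ae_filter_ringOfSetsType lam.
  by apply: filterS hw => z + zI => ->.
Qed.

Lemma period_sq_represents p w : represents p w -> period_sq w = (2%:E * sq_norm p)%E.
Proof.
move=> [[mw _ _] e1 e2]; rewrite period_sq_parts// /sq_norm.
by rewrite (sqint_ae_eq _ _ e1) ?(sqint_ae_eq _ _ e2)//;
  [exact: measurable_L2|exact: measurable_odd_part|exact: measurable_L2|
   exact: measurable_even_part].
Qed.

Lemma even_part_ext (al be : R -> R) z : I01 z -> even_part (ext al be) z = al z.
Proof.
rewrite /= in_itv/= => zI; rewrite /even_part ext_pos_oo// ext_neg_oo//.
by field.
Qed.

Lemma odd_part_ext (al be : R -> R) z : I01 z -> odd_part (ext al be) z = be z.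
Proof.
rewrite /= in_itv/= => zI; rewrite /odd_part ext_pos_oo// ext_neg_oo//.
by field.
Qed.

Lemma represents_ext p (al be : R -> R) : measurable_fun setT al ->
  measurable_fun setT be -> {ae lam, forall z, I01 z -> p.1 z = al z} ->
  {ae lam, forall z, I01 z -> p.2 z = be z} -> represents p (ext al be).
Proof.
move=> mal mbe p1 p2.
have FF := ae_filter_ringOfSetsType lam.
have mext := measurable_ext mal mbe.
have e1 : {ae lam, forall z, I01 z -> p.1 z = even_part (ext al be) z}.
  by apply: filterS p1 => z + zI => ->//; rewrite even_part_ext.
have e2 : {ae lam, forall z, I01 z -> p.2 z = odd_part (ext al be) z}.
  by apply: filterS p2 => z + zI => ->//; rewrite odd_part_ext.
split=> //; split=> //; first exact: extD2.
rewrite period_sq_parts// -(sqint_ae_eq _ _ e1) -?(sqint_ae_eq _ _ e2);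
  [|exact: measurable_L2|exact: measurable_odd_part|exact: measurable_L2|
   exact: measurable_even_part].
by rewrite lte_mul_pinfty ?lee_fin// lte_add_pinfty//; exact: sqint_L2_lty.
Qed.

Definition extL p : R -> R := ext p.1 p.2.

Lemma represents_extL p : represents p (extL p).
Proof.
by apply: represents_ext; [exact: measurable_L2|exact: measurable_L2|exact: aeW|exact: aeW].
Qed.

Definition parts w : pairL2 := (L2_class (even_part w), L2_class (odd_part w)).

Lemma represents_parts w : antiper w -> represents (parts w) w.
Proof.
move=> aw; have [mw wp woo] := aw.
have := period_sq_parts mw => normE.
have [oe oo] : (sqint lam I01 (even_part w) < +oo)%E /\ (sqint lam I01 (odd_part w) < +oo)%E.
  have e0 := sqint_ge0 lam I01 (even_part w).
  have o0 := sqint_ge0 lam I01 (odd_part w).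
  have le2 : (sqint lam I01 (even_part w) + sqint lam I01 (odd_part w) <= period_sq w)%E.
    by rewrite normE; apply: lee_pemull; [exact: adde_ge0|rewrite lee1n].
  by split; apply: le_lt_trans woo; apply: le_trans le2; [exact: leeDl|exact: leeDr].
by split=> //=; apply: L2_classE => //; [exact: measurable_even_part|exact: measurable_odd_part].
Qed.

Lemma representsD (k : R) p q w h : represents p w -> represents q h ->
  represents (k *: p + q) (fun z => k * w z + h z).
Proof.
move=> [aw p1 p2] [ah q1 q2]; split.
- by apply: antiperD => //; exact: antiperZ.
- have FF := ae_filter_ringOfSetsType lam.
  have /L2_ae_eq h1 := Lspace2_DE (k *: p.1) q.1.
  have /L2_ae_eq h2 := Lspace2_ZE k p.1.
  apply: filterS (filterI (filterI p1 q1) (filterI h1 h2)).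
  move=> z [[e1 e2] [e3 e4]] zI.
  by rewrite (e3 zI)/= (e4 zI)/= (e1 zI) (e2 zI) /even_part /GRing.scale/=; field.
- have FF := ae_filter_ringOfSetsType lam.
  have /L2_ae_eq h1 := Lspace2_DE (k *: p.2) q.2.
  have /L2_ae_eq h2 := Lspace2_ZE k p.2.
  apply: filterS (filterI (filterI p2 q2) (filterI h1 h2)).
  move=> z [[e1 e2] [e3 e4]] zI.
  by rewrite (e3 zI)/= (e4 zI)/= (e1 zI) (e2 zI) /odd_part /GRing.scale/=; field.
Qed.

Lemma representsB p q w h : represents p w -> represents q h ->
  represents (p - q) (fun z => w z - h z).
Proof.
move=> pw qh; have := representsD (-1) qh pw; rewrite scaleN1r addrC.
by congr represents; apply/funext => z; rewrite mulN1r addrC.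
Qed.

Lemma representsZ (k : R) p w : represents p w -> represents (k *: p) (fun z => k * w z).
Proof.
move=> pw; have := representsD (k - 1) pw pw; rewrite scalerBl scale1r subrK.
by congr represents; apply/funext => z; ring.
Qed.

Lemma sq_norm_eq0 p : sq_norm p = 0%E -> p = 0.
Proof.
case: p => f g; rewrite /sq_norm /=.
move=> /eqP; rewrite padde_eq0 ?sqint_ge0// => /andP[/eqP f0 /eqP g0].
have z0 (f' : L2 R) : sqint lam I01 f' = 0%E -> f' = 0.
  have mf : measurable_fun I01 f' by apply: measurable_funTS; exact: measurable_L2.
  move=> /(sqint_eq0 lam (measurable_itv _) mf) f'0.
  apply: ae_L2_eq; have /L2_ae_eq h0 := Lspace2_0E (mu01 R).
  have FF := ae_filter_ringOfSetsType lam.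
  by apply: filterS2 f'0 h0 => z + + zI => -> // ->.
by rewrite (z0 _ f0) (z0 _ g0).
Qed.

(** A pair represented by 0 has norm 0, by the norm identity. *)
Lemma represents_unique p q w : represents p w -> represents q w -> p = q.
Proof.
move=> pw qw; apply/eqP; rewrite -subr_eq0; apply/eqP/sq_norm_eq0.
have := period_sq_represents (representsB pw qw).
rewrite (_ : (fun z => _) = cst 0); last by apply/funext => z; rewrite subrr.
rewrite /period_sq /sqint integral0_eq => [/esym/eqP|z _]; last by rewrite expr0n.
by rewrite mule_eq0 => /orP[|/eqP//]; rewrite eqe pnatr_eq0.
Qed.

(** The string evolves by translation of the representing function. The absolute
    value extends the definition to negative times. *)
Definition wave s p : pairL2 := parts (fun z => extL p (z + `|s|)).

(** The result does not depend on the representative because translation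
    preserves the norm of the difference of two representatives. *)
Lemma wave_represents s p w : 0 <= s -> represents p w ->
  represents (wave s p) (fun z => w (z + s)).
Proof.
move=> s0 pw; have [aw _ _] := pw.
have pe := represents_extL p; have [ae _ _] := pe.
have as_ : antiper (fun z : R => w (z + s)) by exact: antiper_shift.
have aes : antiper (fun z : R => extL p (z + s)) by exact: antiper_shift.
rewrite /wave ger0_norm//.
suff -> : parts (fun z => extL p (z + s)) = parts (fun z => w (z + s)).
  exact: represents_parts.
have h1 := representsB (represents_parts aes) (represents_parts as_).
apply/eqP; rewrite -subr_eq0; apply/eqP/sq_norm_eq0.
have [[md dp _] _ _] := representsB pe pw.
have := period_sq_represents (representsB pe pw).
rewrite -(period_sq_shift md dp s0) (period_sq_represents h1) subrr.
rewrite (_ : sq_norm 0 = 0%E); last first.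
  rewrite /sq_norm/=.
  have -> : sqint lam I01 (0 : L2 R) = 0%E.
    apply/(sqint_eq0 lam (measurable_itv _)).
      by apply: measurable_funTS; exact: measurable_L2.
    by have /L2_ae_eq := Lspace2_0E (mu01 R).
  by rewrite adde0.
rewrite mule0 => /eqP; rewrite mule_eq0 => /orP[|/eqP//].
by rewrite eqe pnatr_eq0.
Qed.

Lemma wave_linear s : linear (wave s).
Proof.
move=> k p q.
have -> : wave s = wave `|s| by apply/funext => r; rewrite /wave normr_id.
have s0 := normr_ge0 s.
have pe := represents_extL p; have qe := represents_extL q.
apply: represents_unique (wave_represents s0 (representsD k pe qe)) _.
by apply: representsD; exact: wave_represents.
Qed.

Lemma waveB s (u v : L2 R * L2 R) : wave s (u - v) = wave s u - wave s v.
Proof. by rewrite -scaleN1r addrC wave_linear scaleN1r addrC. Qed.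

Lemma wave0 p : wave 0 p = p.
Proof.
have pe := represents_extL p.
apply: (represents_unique (wave_represents (lexx 0) pe)).
by move: pe; congr represents; apply/funext => z; rewrite addr0.
Qed.

Lemma waveD s t p : 0 <= s -> 0 <= t -> wave (s + t) p = wave s (wave t p).
Proof.
move=> s0 t0; have pe := represents_extL p.
apply: (represents_unique (wave_represents (addr_ge0 s0 t0) pe)).
have := wave_represents s0 (wave_represents t0 pe).
by congr represents; apply/funext => z; congr (extL p); ring.
Qed.

Lemma wave2 p : wave 2 p = - p.
Proof.
have pe := represents_extL p; have [[_ ap _] _ _] := pe.
apply: (represents_unique (wave_represents (ler0n R 2) pe)).
have := representsZ (-1) pe; rewrite scaleN1r.
by congr represents; apply/funext => z; rewrite ap mulN1r.
Qed.

Lemma sq_norm_wave s p : 0 <= s -> sq_norm (wave s p) = sq_norm p.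
Proof.
move=> s0; have pe := represents_extL p; have [[me ep _] _ _] := pe.
have := period_sq_represents (wave_represents s0 pe).
rewrite period_sq_shift// (period_sq_represents pe).
have fin (r : pairL2) : sq_norm r \is a fin_num.
  by rewrite fin_numD !ge0_fin_numE ?sqint_ge0// !sqint_L2_lty.
by rewrite -(fineK (fin _)) -(fineK (fin (wave s p))) -!EFinM => -[] /mulfI -> //;
  rewrite pnatr_eq0.
Qed.

Lemma sq_norm_half p w (e : R) : represents p w -> (period_sq w <= (2 * e)%:E)%E ->
  (sq_norm p <= e%:E)%E.
Proof. by move=> pw; rewrite (period_sq_represents pw) EFinM lee_pmul2l// lte_fin. Qed.

Lemma wave_continuous p (e : R) : 0 < e ->
  \forall s \near 0^'+, (sq_norm (wave s p - p)%R <= e%:E)%E.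
Proof.
move=> e0; have pe := represents_extL p; have [ae _ _] := pe.
have e20 : 0 < 2 * e by rewrite mulr_gt0.
near=> s.
have s0 : 0 < s by near: s; exact: nbhs_right_gt.
apply: (sq_norm_half (representsB (wave_represents (ltW s0) pe) pe)).
by near: s; exact: period_sq_translation_cvg.
Unshelve. all: by end_near. Qed.

End scalar_wave_group.

(** * The time derivative of the string *)

Section wave_generator.
Context {R : realType}.
Local Notation lam := (@lebesgue_measure R).
Local Notation mR := (measurableTypeR R).
Local Notation I01 := (`]0%R, 1%R[%classic : set R).
Local Notation pairL2 := (L2 R * L2 R)%type.
Implicit Types (f g : L2 R) (h w : R -> R) (t x y z : R).

Lemma antiper_integrable h x y : antiper h -> -1 <= x -> y < 3 ->
  lam.-integrable `]x, y] (EFin \o h).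
Proof.
move=> ah x1 y3; have [mh _ _] := ah.
have Joo : (lam `[(-1)%R, 3%R[ < +oo)%E.
  by rewrite lebesgue_measure_itv/=; case: ifPn => _; rewrite ?ltry// -EFinB ltry.
have ih : lam.-integrable `[(-1), 3[ (EFin \o h).
  apply: sqint_integrable => //; first exact: measurable_funTS.
  exact: antiper_two_periods.
by apply: integrableS ih => //; apply: subset_itv; rewrite bnd_simp.
Qed.

(** w is a primitive of h as far as x and y are concerned. A piecewise
    description of w suffices for this relation, which is glued at the
    breakpoints. *)
Definition increment h w x y : Prop := w y - w x = \int[lam]_(t in `]x, y]) h t.

Lemma increment_trans h w x y z : antiper h -> -1 <= x -> x <= y -> y <= z -> z < 3 ->
  increment h w x y -> increment h w y z -> increment h w x z.
Proof.
rewrite /increment => ah x1 xy yz z3 e1 e2.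
have ih := antiper_integrable ah x1 z3.
have xyb : (BRight x <= BRight y)%O by rewrite bnd_simp.
have yzb : (BRight y <= BRight z)%O by rewrite bnd_simp.
have := Rintegral_itvB ih xyb yzb; rewrite -e1 -e2; lra.
Qed.

Lemma increment_glue h w a b c : antiper h -> -1 <= a -> c < 3 -> a <= b <= c ->
  (forall x y, a <= x -> x <= y -> y <= b -> increment h w x y) ->
  (forall x y, b <= x -> x <= y -> y <= c -> increment h w x y) ->
  forall x y, a <= x -> x <= y -> y <= c -> increment h w x y.
Proof.
move=> ah a1 c3 /andP[ab bc] h1 h2 x y ax xy yc.
have [yb|by_] := leP y b; first exact: h1.
have [xb|bx] := leP x b; last by apply: h2 => //; exact: ltW.
apply: (increment_trans ah (le_trans a1 ax) xb (ltW by_) (le_lt_trans yc c3)).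
  exact: h1.
by apply: h2 => //; exact: ltW.
Qed.

Lemma increment_shift h w x y : antiper h -> (forall z, w (z + 2) = - w z) ->
  -1 <= x -> y < 3 -> increment h w x y -> increment h w (x + 2) (y + 2).
Proof.
move=> ah wp x1 y3; have [mh hp _] := ah; rewrite /increment !wp => e.
rewrite /Rintegral -(integral_shift_itv 2 (f := EFin \o h) false false); last first.
  exact/measurable_EFinP.
transitivity (\int[lam]_(z in `]x, y]) (-1 * h z)).
  by rewrite RintegralZl// -?e; [ring|exact: antiper_integrable].
by congr fine; apply: eq_integral => z _; rewrite /= hp mulN1r.
Qed.

Section increment_ext.
Variables al be al' be' : R -> R.
Hypothesis ial' : lam.-integrable setT (EFin \o al').
Hypothesis ibe' : lam.-integrable setT (EFin \o be').
Hypothesis ah : antiper (ext be' al').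
Hypotheses (al1 : al 1 = 0) (be0 : be 0 = 0) (al'0 : al' 0 = 0) (be'1 : be' 1 = 0).
Hypothesis alI : forall x y, 0 <= x -> x <= y -> y <= 1 -> increment al' al x y.
Hypothesis beI : forall x y, 0 <= x -> x <= y -> y <= 1 -> increment be' be x y.

Lemma increment_ext_pos x y : 0 <= x -> x <= y -> y <= 1 ->
  increment (ext be' al') (ext al be) x y.
Proof.
move=> x0 xy y1; rewrite /increment.
rewrite !ext_pos//; [|by rewrite x0 (le_trans xy)|by rewrite (le_trans x0)].
rewrite (@eq_Rintegral _ _ _ _ _ (fun z : mR => be' z + al' z)); last first.
  move=> z; rewrite inE/= in_itv/= => /andP[xz zy].
  by rewrite ext_pos// (le_trans x0 (ltW xz)) (le_trans zy).
rewrite RintegralD//; [|exact: integrableT_itv|exact: integrableT_itv].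
by rewrite -(alI x0 xy y1) -(beI x0 xy y1); ring.
Qed.

Lemma increment_ext_neg x y : -1 <= x -> x <= y -> y <= 0 ->
  increment (ext be' al') (ext al be) x y.
Proof.
move=> x1 xy y0; rewrite /increment -{1}[y]opprK -{1}[x]opprK.
have yN0 : 0 <= - y by lra.
have yxN : - y <= - x by lra.
have xN1 : - x <= 1 by lra.
rewrite !ext_neg//; [|by rewrite (le_trans yN0)|by rewrite yN0 (le_trans yxN)].
have [mh _ _] := ah.
have mhN : measurable_fun setT (fun z : R => ext be' al' (- z)).
  by apply: (measurableT_comp mh); exact: oppr_measurable.
have -> : \int[lam]_(t in `]x, y]) ext be' al' t =
    \int[lam]_(t in `]- y, - x]) ext be' al' (- t).
  rewrite /Rintegral -[x in LHS]opprK -[y in LHS]opprK.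
  rewrite -(integral_reflect (f := EFin \o ext be' al') true true)/=; last first.
    exact/measurable_EFinP.
  have mE (i : interval R) : measurable_fun [set` i] (fun z : R => (ext be' al' (- z))%:E).
    by apply: measurable_funTS; exact/measurable_EFinP.
  by rewrite integral_itv_bndo_bndc ?integral_itv_obnd_cbnd.
rewrite (@eq_Rintegral _ _ _ _ _ (fun z : mR => be' z - al' z)); last first.
  move=> z; rewrite inE/= in_itv/= => /andP[yz zx].
  by rewrite ext_neg// (le_trans yN0 (ltW yz)) (le_trans zx).
rewrite RintegralB//; [|exact: integrableT_itv|exact: integrableT_itv].
by rewrite -(alI yN0 yxN xN1) -(beI yN0 yxN xN1); ring.
Qed.

(** The conditions al 1 = 0 and be 0 = 0 make ext al be continuous at the odd and
    at the even integers, which is what gluing needs. Differentiation exchanges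
    the even and the odd part. *)
Lemma increment_ext x y : -1 <= x -> x <= y -> y < 3 ->
  increment (ext be' al') (ext al be) x y.
Proof.
have h1 : forall x y, -1 <= x -> x <= y -> y <= 1 ->
    increment (ext be' al') (ext al be) x y.
  apply: (@increment_glue _ _ (-1) 0 1) => //; [lra|by apply/andP; split; lra| |].
  - exact: increment_ext_neg.
  - exact: increment_ext_pos.
have h2 x' y' : 1 <= x' -> x' <= y' -> y' <= 3 ->
    increment (ext be' al') (ext al be) x' y'.
  move=> x1 xy y3; rewrite -(subrK 2 x') -(subrK 2 y').
  apply: increment_shift => //; [exact: extD2|lra|lra|].
  by apply: h1; lra.
move=> x1 xy y3; have [y1|y1] := leP y 1; first exact: h1.
apply: (@increment_glue _ _ (-1) 1 y) => //.
- by apply/andP; split; lra.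
- by move=> x' y' x1' xy' y1'; apply: h2 => //; lra.
Qed.

End increment_ext.

Definition prim01 h : R -> R := prim h \_ `[0, 1].

Lemma prim01E h z : 0 <= z <= 1 -> prim01 h z = prim h z.
Proof. by move=> z01; rewrite /prim01 patchE mem_set//= in_itv. Qed.

Lemma measurable_prim01 h : lam.-integrable setT (EFin \o h) ->
  measurable_fun setT (prim01 h).
Proof.
move=> ih; apply/(measurable_restrictT _ _).1 => //.
apply: subspace_continuous_measurable_fun => //.
exact: prim_continuous.
Qed.

(** The representing function is a primitive of the antiperiodic function that
    represents (dz g, dz f), and difference quotients of a primitive converge in
    L^2. *)
Lemma wave_derivative f g (e : R) : H1 f -> value_at f 1 = 0 -> H10 g -> 0 < e ->
  \forall s \near 0^'+,
    (sq_norm (s^-1 *: (wave s (f, g) - (f, g)) - (dz g, dz f))%R <= e%:E)%E.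
Proof.
move=> Hf f1 Hg e0.
pose al' := cut (dz f); pose be' := cut (dz g).
pose al z := prim01 al' z - prim al' 1.
pose be := prim01 be'.
have [ial' ibe'] : lam.-integrable setT (EFin \o al') /\ lam.-integrable setT (EFin \o be').
  by split; exact: cut_integrable.
have mal' : measurable_fun setT al' by exact: measurable_cut.
have mbe' : measurable_fun setT be' by exact: measurable_cut.
have mal : measurable_fun setT al.
  by apply: measurable_funB; [exact: measurable_prim01|exact: measurable_cst].
have mbe : measurable_fun setT be by exact: measurable_prim01.
have FF := ae_filter_ringOfSetsType lam.
have I01' z : I01 z -> 0 <= z <= 1 by rewrite /= in_itv/= => /andP[/ltW -> /ltW ->].
have pw : represents (f, g) (ext al be).
  apply: represents_ext => //=.
  - apply: filterS (H1_value1_primE Hf f1) => z + zI => -> //.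
    by rewrite /al prim01E//; exact: I01'.
  - apply: filterS (H10_primE Hg) => z + zI => -> //.
    by rewrite /be prim01E//; exact: I01'.
have qh : represents (dz g, dz f) (ext be' al').
  by apply: represents_ext => //=; exact: ae_cut.
have [ah _ _] := qh.
have cut0 (u : L2 R) z : (z == 0) || (z == 1) -> cut u z = 0.
  move=> z01; rewrite /cut patchE memNset//= in_itv/=.
  by case/orP: z01 => /eqP ->; rewrite ltxx ?andbF.
have c0 x : 0 <= x -> x <= 1 -> 0 <= x <= 1 by move=> -> ->.
have incr (k : R) h x y : lam.-integrable setT (EFin \o h) -> 0 <= x -> x <= y -> y <= 1 ->
    increment h (fun z => prim01 h z - k) x y.
  move=> ih x0 xy y1; rewrite /increment !prim01E ?(le_trans x0)// ?x0 ?(le_trans xy)//.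
  by rewrite -(prim_diff ih x0 xy); ring.
have mw : measurable_fun setT (ext al be) by exact: measurable_ext.
have e20 : 0 < 2 * e by rewrite mulr_gt0.
have dq := period_sq_difference_quotient ah mw.
near=> s.
have s0 : 0 < s by near: s; exact: nbhs_right_gt.
have rep := representsB (representsZ s^-1
  (representsB (wave_represents (ltW s0) pw) pw)) qh.
apply: (sq_norm_half rep).
near: s; apply: dq => // z s z1 s0 zs3.
have zzs : z <= z + s by rewrite lerDl ltW.
split; first exact: antiper_integrable.
apply: increment_ext => //.
- by rewrite /al prim01E ?subrr// ler01 lexx.
- by rewrite /be prim01E ?prim0// ler01 lexx.
- by rewrite /al' cut0// eqxx.
- by rewrite /be' cut0// eqxx orbT.
- by move=> x y x0 xy y1; exact: incr.
- move=> x y x0 xy y1; have := incr 0 be' x y ibe' x0 xy y1.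
  by rewrite /increment !subr0.
Unshelve. all: by end_near. Qed.

End wave_generator.

(** * Normal modes of the actuator *)

Section normal_modes.
Context {R : realType}.

(** The second equation says that the rotation of cosine k and sine s makes the
    off-diagonal entry of the matrix with entries a, b, b, d vanish. For b != 0
    the rotation is read off the eigenvector (b, v). *)
Lemma rotation_diagonalises (a b d : R) : exists k s : R,
  k ^+ 2 + s ^+ 2 = 1 /\ k * s * (d - a) + b * (k ^+ 2 - s ^+ 2) = 0.
Proof.
have [->|b0] := eqVneq b 0.
  by exists 1, 0; split; ring.
pose r := Num.sqrt (((d - a) / 2) ^+ 2 + b ^+ 2).
have r2 : r ^+ 2 = ((d - a) / 2) ^+ 2 + b ^+ 2.
  by rewrite sqr_sqrtr// addr_ge0 ?sqr_ge0.
pose v := (d - a) / 2 + r.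
have v2 : v ^+ 2 = v * (d - a) + b ^+ 2.
  by rewrite /v sqrrD r2; field.
have bv : 0 < b ^+ 2 + v ^+ 2.
  by rewrite ltr_pwDl ?sqr_ge0// lt_def sqrf_eq0 b0 sqr_ge0.
pose n := Num.sqrt (b ^+ 2 + v ^+ 2).
have n2 : n ^+ 2 = b ^+ 2 + v ^+ 2 by rewrite sqr_sqrtr// ltW.
have n0 : n != 0 by rewrite gt_eqF// sqrtr_gt0.
exists (b / n), (v / n); split.
  by rewrite !exprMn -mulrDl -n2 exprVn divff// sqrf_eq0.
have -> : b / n * (v / n) * (d - a) + b * ((b / n) ^+ 2 - (v / n) ^+ 2) =
  b / n ^+ 2 * (v * (d - a) + b ^+ 2 - v ^+ 2) by field.
by rewrite v2 subrr mulr0.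
Qed.

Variable p : actuator R.
Local Notation C := (stiffness p).
Local Notation A := (area p).
Local Notation I := (inertia p).
Local Notation I0 := (inertia0 p).

Definition energy_density (f g : 'I_3 -> R) : R :=
  let f1 := f 0 in let f2 := f 1 in let f3 := f 2%:R in
  let g1 := g 0 in let g2 := g 1 in let g3 := g 2%:R in
  C * A * (f1 * f1) + C * I * (f2 * f2) - C * I0 * (f1 * f2 + f2 * f1)
  - gamma p * beta p * A * (f1 * f3 + f3 * f1)
  + gamma p * beta p * I0 * (f2 * f3 + f3 * f2) + beta p * A * (f3 * f3)
  + rho p * A * (g1 * g1) + rho p * I * (g2 * g2)
  - rho p * I0 * (g1 * g2 + g2 * g1) + mu p * A * (g3 * g3).

Definition vec3 (T : Type) (x1 x2 x3 : T) (i : 'I_3) : T :=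
  match val i with 0%N => x1 | 1%N => x2 | _ => x3 end.

Definition mx3 (r1 r2 r3 : 'I_3 -> R) : 'M[R]_3 :=
  \matrix_(i, j) vec3 r1 r2 r3 i j.

(** The matrix M^-1 K of the system M x_tt = K x_zz. *)
Definition wave_matrix : 'M[R]_3 :=
  mx3 (vec3 (C / rho p) 0 (- (gamma p * beta p / rho p)))
      (vec3 0 (C / rho p) 0)
      (vec3 (- (gamma p * beta p / mu p)) (gamma p * beta p * I0 / (mu p * A))
            (beta p / mu p)).

Lemma sum3 (V : nmodType) (F : 'I_3 -> V) : \sum_i F i = F 0 + F 1 + F 2%:R.
Proof.
rewrite !big_ord_recl big_ord0 addr0 addrA; congr (F _ + F _ + F _);
  exact/val_inj.
Qed.

Lemma forall3 (P : 'I_3 -> Prop) : P 0 -> P 1 -> P 2%:R -> forall i, P i.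
Proof.
move=> h0 h1 h2 [[|[|[|//]]] hi].
- by rewrite (_ : Ordinal hi = 0)//; exact/val_inj.
- by rewrite (_ : Ordinal hi = 1)//; exact/val_inj.
- by rewrite (_ : Ordinal hi = 2%:R)//; exact/val_inj.
Qed.

(** A simultaneous diagonalisation of the kinetic and the stiffness form: in the
    coordinates given by the matrix modal the system splits into three wave equations
    with their own speeds, and the energy into three energies of strings. *)
Record modes := Modes {
  modal : 'M[R]_3; modal_inv : 'M[R]_3; speed : 'I_3 -> R; weight : 'I_3 -> R;
  speed_gt0 : forall i, 0 < speed i;
  weight_gt0 : forall i, 0 < weight i;
  modalK : modal *m modal_inv = 1%:M;
  energy_modes : forall f g, energy_density f g = \sum_i weight i *
    ((speed i * \sum_j modal i j * f j) ^+ 2 + (\sum_j modal i j * g j) ^+ 2);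
  wave_modes : forall i j,
    \sum_k modal i k * wave_matrix k j = speed i ^+ 2 * modal i j }.

Hypotheses (hrho : 0 < rho p) (hmu : 0 < mu p) (hbeta : 0 < beta p)
  (hCE11 : 0 < CE11 p) (hgb : 0 < gb p) (hab : ha p < hb p).

Lemma area_gt0 : 0 < A.
Proof. by rewrite /area !mulr_gt0// subr_gt0. Qed.

Lemma stiffness_gt0 : 0 < C.
Proof. by rewrite /stiffness ltr_pwDl// mulr_ge0 ?sqr_ge0// ltW. Qed.

(** The Cauchy-Schwarz inequality for the functions 1 and h on the cross
    section. *)
Lemma inertia_gt : 0 < I - I0 ^+ 2 / A.
Proof.
have -> : I - I0 ^+ 2 / A = gb p * (hb p - ha p) ^+ 3 / 6.
  rewrite /inertia /inertia0 /area; field.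
  by rewrite !gt_eqF ?subr_gt0.
by rewrite divr_gt0// mulr_gt0// exprn_gt0// subr_gt0.
Qed.

(** The combination U = f 0 - (I0 / A) f 1 completes the square in both forms.
    It separates f 1, which moves with squared speed C / rho and weight
    rho (I - I0^2 / A), from the pair (U, f 2). Scaling the pair by the square
    roots of rho and mu turns its kinetic form into the Euclidean one, and a
    rotation then diagonalises its stiffness form, which is definite because the
    determinant beta CE11 / (rho mu) is positive. *)
Lemma modes_exist : modes.
Proof.
have A0 := area_gt0; have C0 := stiffness_gt0; have J0 := inertia_gt.
set J := I - I0 ^+ 2 / A in J0.
pose r := Num.sqrt (rho p); pose m := Num.sqrt (mu p).
have r2 : r ^+ 2 = rho p by rewrite sqr_sqrtr// ltW.
have m2 : m ^+ 2 = mu p by rewrite sqr_sqrtr// ltW.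
have r0 : 0 < r by rewrite sqrtr_gt0.
have m0 : 0 < m by rewrite sqrtr_gt0.
clearbody r m.
have rn0 : r != 0 by rewrite gt_eqF.
have mn0 : m != 0 by rewrite gt_eqF.
have An0 : A != 0 by rewrite gt_eqF.
pose a := C / rho p; pose b := - (gamma p * beta p / (r * m)); pose d := beta p / mu p.
have /cid[k /cid[s [ks1 ks2]]] := rotation_diagonalises a b d.
pose l1 := a * k ^+ 2 + 2 * b * k * s + d * s ^+ 2.
pose l2 := a * s ^+ 2 - 2 * b * k * s + d * k ^+ 2.
have a0 : 0 < a by rewrite divr_gt0.
have det0 : 0 < a * d - b ^+ 2.
  have -> : a * d - b ^+ 2 = beta p * CE11 p / (rho p * mu p).
    rewrite /a /b /d /stiffness -r2 -m2; field; by rewrite rn0 mn0.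
  by rewrite divr_gt0// mulr_gt0.
have pos (x y : R) : x ^+ 2 + y ^+ 2 = 1 ->
    0 < a * x ^+ 2 + 2 * b * x * y + d * y ^+ 2.
  move=> xy1; rewrite -(pmulr_rgt0 _ a0).
  have -> : a * (a * x ^+ 2 + 2 * b * x * y + d * y ^+ 2) =
    (a * x + b * y) ^+ 2 + (a * d - b ^+ 2) * y ^+ 2 by ring.
  have [y0|y0] := eqVneq y 0.
    move: xy1; rewrite y0 expr0n addr0 => x1.
    by rewrite !mulr0 !addr0 exprMn x1 mulr1 exprn_gt0.
  by rewrite ltr_wpDl ?sqr_ge0// mulr_gt0// lt_def sqrf_eq0 y0 sqr_ge0.
have l10 : 0 < l1 by exact: pos.
have l20 : 0 < l2.
  have -> : l2 = a * s ^+ 2 + 2 * b * s * (- k) + d * (- k) ^+ 2 by rewrite /l2; ring.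
  by apply: pos; rewrite sqrrN addrC.
pose P := mx3 (vec3 (k * r) (- (k * r * I0 / A)) (s * m))
              (vec3 (- (s * r)) (s * r * I0 / A) (k * m))
              (vec3 0 1 0).
pose Q := mx3 (vec3 (k / r) (- (s / r)) (I0 / A)) (vec3 0 0 1)
              (vec3 (s / m) (k / m) 0).
pose c := vec3 (Num.sqrt l1) (Num.sqrt l2) (Num.sqrt (C / rho p)).
pose w := vec3 A A (rho p * J).
have c2 i : c i ^+ 2 = vec3 l1 l2 (C / rho p) i.
  by move: i; apply: forall3; rewrite /c /vec3 /= sqr_sqrtr ?ltW// divr_gt0.
pose E := k * s * (d - a) + b * (k ^+ 2 - s ^+ 2).
have E0 : E = 0 by exact: ks2.
(* (k, s) and (- s, k) are eigenvectors of the 2 x 2 block, with eigenvalues l1, l2 *)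
have E1 : l1 * k = k * a + s * b.
  by rewrite -[RHS]mulr1 -ks1 -[RHS]addr0 -(mulr0 s) -E0 /E /l1; ring.
have E2 : l1 * s = k * b + s * d.
  by rewrite -[RHS]mulr1 -ks1 -[RHS]addr0 -(mulr0 (- k)) -E0 /E /l1; ring.
have E3 : l2 * s = s * a - k * b.
  by rewrite -[RHS]mulr1 -ks1 -[RHS]addr0 -(mulr0 k) -E0 /E /l2; ring.
have E4 : l2 * k = k * d - s * b.
  by rewrite -[RHS]mulr1 -ks1 -[RHS]addr0 -(mulr0 (- s)) -E0 /E /l2; ring.
have Na : C / rho p = a by [].
have Nb : gamma p * beta p = - b * (r * m) by rewrite /b opprK divfK// mulf_neq0.
have Nd : beta p = d * m ^+ 2 by rewrite /d m2 divfK// gt_eqF.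
have NC : C = a * r ^+ 2 by rewrite /a r2 divfK// gt_eqF.
have NI : I = J + I0 ^+ 2 / A by rewrite /J subrK.
have quad U V : l1 * (k * U + s * V) ^+ 2 + l2 * (- s * U + k * V) ^+ 2 =
    a * U ^+ 2 + 2 * b * U * V + d * V ^+ 2.
  have -> : l1 * (k * U + s * V) ^+ 2 + l2 * (- s * U + k * V) ^+ 2 =
    (l1 * k * U + l1 * s * V) * (k * U + s * V) +
    (- (l2 * s) * U + l2 * k * V) * (- s * U + k * V) by ring.
  rewrite E1 E2 E3 E4.
  transitivity ((k ^+ 2 + s ^+ 2) * (a * U ^+ 2 + 2 * b * U * V + d * V ^+ 2)).
    by ring.
  by rewrite ks1 mul1r.
have kin U V : (k * U + s * V) ^+ 2 + (- s * U + k * V) ^+ 2 = U ^+ 2 + V ^+ 2.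
  by rewrite -[RHS]mulr1 -ks1; ring.
apply: (@Modes P Q c w).
- by apply: forall3; rewrite /c /vec3 /= sqrtr_gt0// divr_gt0.
- by apply: forall3; rewrite /w /vec3 /=; [exact: A0|exact: A0|exact: mulr_gt0].
- apply/matrixP => i j; rewrite !mxE sum3 !mxE.
  move: i j; apply: forall3; apply: forall3; rewrite /vec3 /=.
  + by rewrite -ks1; field; rewrite ?rn0 ?mn0 ?An0.
  + by field; rewrite ?rn0 ?mn0 ?An0.
  + by field; rewrite ?rn0 ?mn0 ?An0.
  + by field; rewrite ?rn0 ?mn0 ?An0.
  + by rewrite -ks1; field; rewrite ?rn0 ?mn0 ?An0.
  + by field; rewrite ?rn0 ?mn0 ?An0.
  + by ring.
  + by ring.
  + by ring.
- move=> f g; rewrite !sum3 !exprMn !c2 !mxE /w /vec3 /=.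
  set f1 := f 0; set f2 := f 1; set f3 := f 2%:R.
  set g1 := g 0; set g2 := g 1; set g3 := g 2%:R.
  pose U (y1 y2 : R) := r * (y1 - I0 / A * y2).
  have row1 (y1 y2 y3 : R) : k * r * y1 + - (k * r * I0 / A) * y2 + s * m * y3 =
    k * U y1 y2 + s * (m * y3) by rewrite /U; ring.
  have row2 (y1 y2 y3 : R) : - (s * r) * y1 + s * r * I0 / A * y2 + k * m * y3 =
    - s * U y1 y2 + k * (m * y3) by rewrite /U; ring.
  rewrite !row1 !row2.
  transitivity (A * (l1 * (k * U f1 f2 + s * (m * f3)) ^+ 2 +
      l2 * (- s * U f1 f2 + k * (m * f3)) ^+ 2) +
    A * ((k * U g1 g2 + s * (m * g3)) ^+ 2 + (- s * U g1 g2 + k * (m * g3)) ^+ 2) +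
    rho p * J * (C / rho p * f2 ^+ 2 + g2 ^+ 2)); last by ring.
  rewrite quad kin /energy_density -/f1 -/f2 -/f3 -/g1 -/g2 -/g3 Nb NI NC Nd -r2 -m2 /U.
  by field; rewrite ?rn0 ?mn0 ?An0.
- move=> i j; rewrite sum3 c2 !mxE.
  move: i j; apply: forall3; apply: forall3; rewrite /vec3 /= ?Nb ?Na.
  + have -> : l1 * (k * r) = l1 * k * r by ring.
    by rewrite E1 -?r2 -?m2; field; rewrite ?rn0 ?mn0 ?An0.
  + have -> : l1 * - (k * r * I0 / A) = - (l1 * k) * r * I0 / A by ring.
    by rewrite E1 -?r2 -?m2; field; rewrite ?rn0 ?mn0 ?An0.
  + have -> : l1 * (s * m) = l1 * s * m by ring.
    by rewrite E2 Nd -?r2 -?m2; field; rewrite ?rn0 ?mn0 ?An0.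
  + have -> : l2 * - (s * r) = - (l2 * s) * r by ring.
    by rewrite E3 -?r2 -?m2; field; rewrite ?rn0 ?mn0 ?An0.
  + have -> : l2 * (s * r * I0 / A) = (l2 * s) * r * I0 / A by ring.
    by rewrite E3 -?r2 -?m2; field; rewrite ?rn0 ?mn0 ?An0.
  + have -> : l2 * (k * m) = l2 * k * m by ring.
    by rewrite E4 Nd -?r2 -?m2; field; rewrite ?rn0 ?mn0 ?An0.
  + by ring.
  + by ring.
  + by ring.
Qed.

End normal_modes.

(** * States in strain and velocity coordinates *)

Section matrix_action.
Context {R : realType} {V : lmodType R}.
Implicit Types (P Q : 'M[R]_3) (F G : 'I_3 -> V).

Definition act P F (i : 'I_3) : V := \sum_j P i j *: F j.

Lemma act_comp P Q F i : act P (act Q F) i = act (P *m Q) F i.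
Proof.
rewrite /act; under eq_bigr do rewrite scaler_sumr.
rewrite exchange_big /=; apply: eq_bigr => j _.
by rewrite mxE scaler_suml; apply: eq_bigr => k _; rewrite scalerA.
Qed.

Lemma act1 F i : act 1%:M F i = F i.
Proof.
rewrite /act (bigD1 i)//= big1 ?addr0 => [|j ji]; first by rewrite mxE eqxx scale1r.
by rewrite mxE eq_sym (negbTE ji) scale0r.
Qed.

Lemma eq_act P F G i : F =1 G -> act P F i = act P G i.
Proof. by move=> FG; apply: eq_bigr => j _; rewrite FG. Qed.

Lemma actD P (k : R) F G i :
  act P (fun j => k *: F j + G j) i = k *: act P F i + act P G i.
Proof.
rewrite /act scaler_sumr -big_split; apply: eq_bigr => j _ /=.
by rewrite scalerDr !scalerA mulrC.
Qed.

End matrix_action.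

Section state_coordinates.
Context {R : realType}.
Local Notation lam := (@lebesgue_measure R).
Local Notation I01 := (`]0%R, 1%R[%classic : set R).
Local Notation pairL2 := (L2 R * L2 R)%type.
Implicit Types (x y : state R) (F G : 'I_3 -> L2 R).

Definition strain x : 'I_3 -> L2 R :=
  let: (x1, x2, x3, _, _, _) := x in vec3 (dz x1) (dz x2) (dz x3).

Definition velocity x : 'I_3 -> L2 R :=
  let: (_, _, _, x4, x5, x6) := x in vec3 x4 x5 x6.

Lemma H10typeP (f : H10type R) : H10 (f : L2 R).
Proof. by have := valP f; rewrite inE. Qed.

Definition H10_of (g : L2 R) : H10type R := H10_Sub (mem_set (primitive_class_H10 g)).

Lemma dz_H10_of g : dz (H10_of g) = g.
Proof. exact: dz_primitive_class. Qed.

(** A state is recovered from its strains because its first three components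
    vanish at 0. *)
Definition state_of F G : state R :=
  (H10_of (F 0), H10_of (F 1), H10_of (F 2%:R), G 0, G 1, G 2%:R).

Lemma strain_state_of F G : strain (state_of F G) =1 F.
Proof. by apply: forall3; rewrite /= /vec3 /= dz_H10_of. Qed.

Lemma velocity_state_of F G : velocity (state_of F G) =1 G.
Proof. by apply: forall3. Qed.

Lemma state_eq x y : strain x =1 strain y -> velocity x =1 velocity y -> x = y.
Proof.
case: x => [[[[[x1 x2] x3] x4] x5] x6]; case: y => [[[[[y1 y2] y3] y4] y5] y6] /=.
move=> s v.
have H (f g : H10type R) : dz f = dz g -> f = g.
  by move=> fg; apply: val_inj; apply: H10_dz_inj fg; exact: H10typeP.
have -> : x1 = y1 by apply: H; exact: (s 0).
have -> : x2 = y2 by apply: H; exact: (s 1).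
have -> : x3 = y3 by apply: H; exact: (s 2%:R).
by rewrite (v 0 : x4 = y4) (v 1 : x5 = y5) (v 2%:R : x6 = y6).
Qed.

Lemma dz_H10D (k : R) (f g : H10type R) : dz (k *: f + g : H10type R) = k *: dz f + dz g.
Proof. by rewrite -dzD; [|exact: (H10typeP f).1|exact: (H10typeP g).1]. Qed.

Lemma strainD (k : R) x y i : strain (k *: x + y) i = k *: strain x i + strain y i.
Proof.
case: x => [[[[[x1 x2] x3] x4] x5] x6]; case: y => [[[[[y1 y2] y3] y4] y5] y6].
by move: i; apply: forall3; rewrite /= /vec3 /= dz_H10D.
Qed.

Lemma velocityD (k : R) x y i :
  velocity (k *: x + y) i = k *: velocity x i + velocity y i.
Proof.
case: x => [[[[[x1 x2] x3] x4] x5] x6]; case: y => [[[[[y1 y2] y3] y4] y5] y6].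
by move: i; apply: forall3.
Qed.

Lemma act_ae (P : 'M[R]_3) F i :
  {ae lam, forall z, I01 z -> act P F i z = \sum_j P i j * F j z}.
Proof.
have FF := ae_filter_ringOfSetsType lam.
rewrite /act sum3.
have /L2_ae_eq d1 := Lspace2_DE (P i 0 *: F 0 + P i 1 *: F 1) (P i 2%:R *: F 2%:R).
have /L2_ae_eq d2 := Lspace2_DE (P i 0 *: F 0) (P i 1 *: F 1).
have zz j : {ae lam, forall z, I01 z -> (P i j *: F j) z = P i j * F j z}.
  by have /L2_ae_eq := Lspace2_ZE (P i j) (F j).
apply: filterS (filterI (filterI d1 d2) (filterI (filterI (zz 0) (zz 1)) (zz 2%:R))).
move=> z [[e1 e2] [[e3 e4] e5]] zI.
rewrite sum3; apply: (etrans (e1 zI)); congr (_ + _); last exact: e5.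
by apply: (etrans (e2 zI)); congr (_ + _); [exact: e3|exact: e4].
Qed.

Definition rsq_norm (u : pairL2) : R := fine (sq_norm u).

Lemma sq_normE u : sq_norm u = (rsq_norm u)%:E.
Proof.
by rewrite /rsq_norm fineK// fin_numD !ge0_fin_numE ?sqint_ge0// !sqint_L2_lty.
Qed.

Lemma rsq_norm_ge0 u : 0 <= rsq_norm u.
Proof. by rewrite -lee_fin -sq_normE adde_ge0// sqint_ge0. Qed.

Lemma rsq_norm_le u (e : R) : (sq_norm u <= e%:E)%E = (rsq_norm u <= e).
Proof. by rewrite sq_normE lee_fin. Qed.

Lemma rsq_norm_represents u w : represents u w -> period_sq w = (2 * rsq_norm u)%:E.
Proof. by move=> uw; rewrite (period_sq_represents uw) sq_normE. Qed.

Lemma rsq_normZ (k : R) u : rsq_norm (k *: u) = k ^+ 2 * rsq_norm u.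
Proof.
have ue := represents_extL u; have [[me _ _] _ _] := ue.
have := rsq_norm_represents (representsZ k ue).
rewrite /period_sq sqintZ//; last exact: measurable_funTS.
rewrite -/(period_sq _) (rsq_norm_represents ue) -EFinM => -[] /eqP.
by rewrite mulrCA => /eqP /mulfI -> //; rewrite pnatr_eq0.
Qed.

(** A weak form of the triangle inequality, sufficient for convergence to 0. *)
Lemma rsq_normD_le u v : rsq_norm (u + v) <= 2 * rsq_norm u + 2 * rsq_norm v.
Proof.
have ue := represents_extL u; have [[mu _ _] _ _] := ue.
have ve := represents_extL v; have [[mv _ _] _ _] := ve.
have := period_sqD_le mu mv; rewrite (rsq_norm_represents ue) (rsq_norm_represents ve).
have := representsD 1 ue ve; rewrite scale1r.
rewrite (_ : (fun z => _) = (fun z => extL u z + extL v z)); last first.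
  by apply/funext => z; rewrite mul1r.
by move=> /rsq_norm_represents ->; rewrite -!EFinM -EFinD lee_fin; lra.
Qed.

Lemma rsq_norm_eq0 u : rsq_norm u = 0 -> u = 0.
Proof. by move=> u0; apply: sq_norm_eq0; rewrite sq_normE u0. Qed.

Lemma rsq_norm_wave (s : R) u : 0 <= s -> rsq_norm (wave s u) = rsq_norm u.
Proof. by move=> s0; rewrite /rsq_norm sq_norm_wave. Qed.

End state_coordinates.

(** * The energy-preserving evolution *)

Section actuator_semigroup.
Context {R : realType} (p : actuator R) (md : modes p).
Local Notation lam := (@lebesgue_measure R).
Local Notation I01 := (`]0%R, 1%R[%classic : set R).
Local Notation pairL2 := (L2 R * L2 R)%type.
Local Notation P := (modal md).
Local Notation Q := (modal_inv md).
Local Notation c := (speed md).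
Local Notation w := (weight md).
Implicit Types (x y : state R) (F : 'I_3 -> L2 R) (U : 'I_3 -> pairL2).

(** The data of the i-th string; the speed makes its two components contribute
    equally to the energy. *)
Definition mode x (i : 'I_3) : pairL2 :=
  (c i *: act P (strain x) i, act P (velocity x) i).

Definition unmode U : state R :=
  state_of (act Q (fun i => (c i)^-1 *: (U i).1)) (act Q (fun i => (U i).2)).

Lemma speed_neq0 i : c i != 0.
Proof. by rewrite gt_eqF// speed_gt0. Qed.

Lemma mode_unmode U i : mode (unmode U) i = U i.
Proof.
rewrite /mode /unmode (eq_act _ _ (strain_state_of _ _)).
rewrite (eq_act _ _ (velocity_state_of _ _)) !act_comp !(modalK md) !act1.
by rewrite scalerA mulfV ?speed_neq0// scale1r; case: (U i).
Qed.

Lemma act_modalK (V : lmodType R) (F : 'I_3 -> V) j : act Q (act P F) j = F j.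
Proof. by rewrite act_comp mulmx1C ?act1// modalK. Qed.

Lemma mode_inj x y : mode x =1 mode y -> x = y.
Proof.
move=> xy; apply: state_eq => j.
  rewrite -[LHS](act_modalK (strain x)) -[RHS](act_modalK (strain y)).
  apply: eq_act => i; have [e _] := xy i.
  by move/(congr1 ( *:%R (c i)^-1)): e; rewrite !scalerA mulVf ?speed_neq0// !scale1r.
rewrite -[LHS](act_modalK (velocity x)) -[RHS](act_modalK (velocity y)).
by apply: eq_act => i; have [_ e] := xy i.
Qed.

Lemma modeD (k : R) x y i : mode (k *: x + y) i = k *: mode x i + mode y i.
Proof.
rewrite /mode; congr (_, _); rewrite /=.
  by rewrite (eq_act _ _ (strainD k x y)) actD scalerDr !scalerA mulrC.
by rewrite (eq_act _ _ (velocityD k x y)) actD.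
Qed.

Lemma modeB x y i : mode (x - y) i = mode x i - mode y i.
Proof. by rewrite -scaleN1r addrC modeD scaleN1r addrC. Qed.

Lemma mode0 i : mode 0 i = 0.
Proof. by rewrite -(subrr 0) modeB subrr. Qed.

Lemma modeZ (k : R) x i : mode (k *: x) i = k *: mode x i.
Proof. by rewrite -[k *: x]addr0 modeD mode0 addr0. Qed.

Lemma energy_ip_density x : energy_ip p x x = \int[mu01 R]_z
  energy_density p (fun i => strain x i z) (fun i => velocity x i z).
Proof. by case: x => [[[[[x1 x2] x3] x4] x5] x6]. Qed.

(** The two densities agree almost everywhere, the operations of L^2 being the
    pointwise ones up to null sets. *)
Lemma energy_ipE x : energy_ip p x x = \sum_i w i * rsq_norm (mode x i).
Proof.
pose u i z := (mode x i).1 z ^+ 2 + (mode x i).2 z ^+ 2.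
have mu_ i : measurable_fun setT (u i).
  by apply: measurable_funD; apply: measurable_funX; exact: measurable_L2.
have mwur i : measurable_fun setT (fun z => w i * u i z).
  by apply: measurable_funM; [exact: measurable_cst|exact: mu_].
have mwu i : measurable_fun setT (fun z => (w i * u i z)%:E).
  exact/measurable_EFinP.
have u0 i z : 0 <= w i * u i z.
  by rewrite mulr_ge0 ?(ltW (weight_gt0 md i))// addr_ge0 ?sqr_ge0.
have mfam F i : measurable_fun setT (F i : R -> R) by exact: measurable_L2.
have mdens : measurable_fun setT (fun z : R =>
    energy_density p (fun i => strain x i z) (fun i => velocity x i z)).
  have -> : (fun z : R => energy_density p (fun i => strain x i z)
      (fun i => velocity x i z)) = (fun z => \sum_i w i *
      ((c i * \sum_j P i j * strain x j z) ^+ 2 + (\sum_j P i j * velocity x j z) ^+ 2)).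
    by apply/funext => z; rewrite (energy_modes md).
  have mcst (k : R) : measurable_fun [set: R] (fun=> k) by exact: measurable_cst.
  have mlin F i : measurable_fun setT (fun z : R => \sum_j P i j * F j z).
    by apply: measurable_sum => j; apply: measurable_funM; [exact: mcst|exact: mfam].
  apply: measurable_sum => i; apply: measurable_funM; first exact: mcst.
  apply: measurable_funD; apply: measurable_funX; last exact: mlin.
  by apply: measurable_funM; [exact: mcst|exact: mlin].
rewrite energy_ip_density Rintegral_mu01//.
rewrite (@eq_ae_Rintegral _ _ _ (fun z => \sum_i w i * u i z))//; last 3 first.
- exact: measurable_funTS.
- by apply: measurable_funTS; apply: measurable_sum => i; exact: mwur.
- have FF := ae_filter_ringOfSetsType lam.
  have aes : {ae lam, forall z, forall i, I01 z -> act P (strain x) i z = \sum_j P i j * strain x j z}.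
    by apply: filter_forall => i; exact: act_ae.
  have aev : {ae lam, forall z, forall i, I01 z -> act P (velocity x) i z = \sum_j P i j * velocity x j z}.
    by apply: filter_forall => i; exact: act_ae.
  have aec : {ae lam, forall z, forall i, I01 z -> (c i *: act P (strain x) i) z = c i * act P (strain x) i z}.
    by apply: filter_forall => i; have /L2_ae_eq := Lspace2_ZE (c i) (act P (strain x) i).
  apply: filterS (filterI (filterI aes aev) aec) => z [[e1 e2] e3] zI.
  rewrite (energy_modes md); apply: eq_bigr => i _; rewrite /u /mode /=.
  congr (_ * (_ ^+ 2 + _ ^+ 2)); apply/esym; last exact: e2.
  by apply: (etrans (e3 i zI)); congr (_ * _); exact: e1.
rewrite /Rintegral (eq_integral (fun z => \sum_i (w i * u i z)%:E)%E); last first.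
  by move=> z _; rewrite sumEFin.
rewrite ge0_integral_sum//; last 2 first.
- by move=> i; exact: measurable_funTS.
- by move=> i z _; rewrite lee_fin.
rewrite (eq_bigr (fun i => (w i * rsq_norm (mode x i))%:E)) => [|i _].
  by rewrite sumEFin.
have m1 : measurable_fun I01 (fun z => ((mode x i).1 z ^+ 2)%:E).
  by apply: measurable_sqr; apply: measurable_funTS; exact: measurable_L2.
have m2 : measurable_fun I01 (fun z => ((mode x i).2 z ^+ 2)%:E).
  by apply: measurable_sqr; apply: measurable_funTS; exact: measurable_L2.
have sq0 (f : R -> R) z : (0 <= (f z ^+ 2)%:E :> \bar R)%E.
  by rewrite lee_fin sqr_ge0.
rewrite EFinM -sq_normE /sq_norm /sqint -ge0_integralD//.
have wi0 : (0 <= (w i)%:E)%E by rewrite lee_fin ltW// weight_gt0.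
rewrite -ge0_integralZl//; last 2 first.
- exact: emeasurable_funD.
- by move=> z _; rewrite adde_ge0.
Qed.

Lemma energy_normE x : energy_norm p x = Num.sqrt (\sum_i w i * rsq_norm (mode x i)).
Proof. by rewrite /energy_norm energy_ipE. Qed.

(** The weights are positive, and there are finitely many modes. *)
Lemma energy_norm_cvg0 (S : R -> state R) :
  energy_norm p (S t) @[t --> 0^'+] --> 0 <->
  forall i (e : R), 0 < e -> \forall t \near 0^'+, rsq_norm (mode (S t) i) <= e.
Proof.
split=> [/cvgrPdist_lt h i e e0|h].
  have we0 : 0 < w i * e by rewrite mulr_gt0// weight_gt0.
  have := h (Num.sqrt (w i * e)); rewrite sqrtr_gt0 => /(_ we0).
  apply: filterS => t; rewrite sub0r normrN energy_normE ger0_norm ?sqrtr_ge0//.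
  rewrite ltr_sqrt// => lt; rewrite -(ler_pM2l (weight_gt0 md i)).
  apply: le_trans (ltW lt); rewrite (bigD1 i)//= lerDl.
  by apply: sumr_ge0 => j _; rewrite mulr_ge0 ?rsq_norm_ge0// ltW// weight_gt0.
apply/cvgrPdist_le => e e0.
pose W := \sum_i w i.
have W0 : 0 < W by rewrite /W sum3 !addr_gt0// weight_gt0.
have d0 : 0 < e ^+ 2 / W by rewrite divr_gt0// exprn_gt0.
have : \forall t \near 0^'+, forall i, rsq_norm (mode (S t) i) <= e ^+ 2 / W.
  by apply: filter_forall => i; exact: h.
apply: filterS => t ht; rewrite sub0r normrN energy_normE ger0_norm ?sqrtr_ge0//.
rewrite -[leRHS](ger0_norm (ltW e0)) -sqrtr_sqr ler_wsqrtr//.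
have -> : e ^+ 2 = \sum_i w i * (e ^+ 2 / W).
  by rewrite -mulr_suml -/W mulrCA divff ?mulr1// gt_eqF.
by apply: ler_sum => i _; rewrite ler_wpM2l// ltW// weight_gt0.
Qed.

(** Each mode moves by its own string. The absolute value gives a value at
    negative times. *)
Definition evolution (t : R) x : state R :=
  unmode (fun i => wave (c i * `|t|) (mode x i)).

Lemma mode_evolution t x i : 0 <= t -> mode (evolution t x) i = wave (c i * t) (mode x i).
Proof. by move=> t0; rewrite mode_unmode ger0_norm. Qed.

Lemma evolution_linear t : linear (evolution t).
Proof.
move=> k x y; apply: mode_inj => i.
by rewrite modeD !mode_unmode modeD wave_linear.
Qed.

HB.instance Definition _ (t : R) := GRing.isLinear.Build R (state R) (state R) *:%R
  (evolution t) (@evolution_linear t).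

Definition semigroup (t : R) : {linear state R -> state R} := evolution t.

Lemma mode_semigroup t x i : 0 <= t ->
  mode (semigroup t x) i = wave (c i * t) (mode x i).
Proof. exact: mode_evolution. Qed.

Lemma speed_mul_ge0 i (t : R) : 0 <= t -> 0 <= c i * t.
Proof. by move=> t0; rewrite mulr_ge0// ltW// speed_gt0. Qed.

Lemma energy_norm_evolution t x : 0 <= t ->
  energy_norm p (evolution t x) = energy_norm p x.
Proof.
move=> t0; rewrite !energy_normE; congr (Num.sqrt _); apply: eq_bigr => i _.
by rewrite mode_evolution// rsq_norm_wave// speed_mul_ge0.
Qed.

(** The energy is conserved. *)
Lemma opnorm_semigroup (t : R) : 0 <= t -> (opnorm (energy_norm p) (semigroup t) <= 1)%E.
Proof.
move=> t0; apply: ub_ereal_sup => _ [x /= x1 <-].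
by rewrite lee_fin energy_norm_evolution.
Qed.

Lemma near0_scale (k : R) (B : R -> Prop) : 0 < k ->
  (\forall s \near 0^'+, B s) -> \forall t \near 0^'+, B (k * t).
Proof.
move=> k0 /near0_rightP[d d0 hd]; apply/near0_rightP; exists (d / k).
  by rewrite divr_gt0.
move=> t /andP[t0 td]; apply: hd; rewrite mulr_gt0//= mulrC -ltr_pdivlMr//.
Qed.

Lemma semigroup_C0 : C0_semigroup (energy_norm p) semigroup.
Proof.
split.
- by move=> t t0; apply: le_lt_trans (opnorm_semigroup t0) _; rewrite ltry.
- by move=> x; apply: mode_inj => i; rewrite mode_semigroup// mulr0 wave0.
- move=> s t x s0 t0; apply: mode_inj => i; rewrite !mode_semigroup ?addr_ge0//.
  by rewrite mulrDr waveD ?speed_mul_ge0.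
- move=> x; apply/energy_norm_cvg0 => i e e0.
  have := near0_scale (speed_gt0 md i) (wave_continuous (mode x i) e0).
  move=> h; near=> t.
  have t0 : 0 < t by near: t; exact: nbhs_right_gt.
  have ht : (sq_norm (wave (c i * t) (mode x i) - mode x i)%R <= e%:E)%E.
    by near: t; exact: h.
  by rewrite modeB (mode_semigroup _ _ (ltW t0)) -rsq_norm_le.
Unshelve. all: by end_near. Qed.

Lemma generator_graphP x y : generator_graph (energy_norm p) semigroup x y <->
  forall i (e : R), 0 < e -> \forall t \near 0^'+,
    rsq_norm (t^-1 *: (wave (c i * t) (mode x i) - mode x i) - mode y i) <= e.
Proof.
rewrite /generator_graph energy_norm_cvg0.
have H i (e : R) : (\forall t \near 0^'+,
      rsq_norm (mode (t^-1 *: (semigroup t x - x) - y) i) <= e) <->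
    \forall t \near 0^'+,
      rsq_norm (t^-1 *: (wave (c i * t) (mode x i) - mode x i) - mode y i) <= e.
  have E t : 0 < t -> mode (t^-1 *: (semigroup t x - x) - y) i =
      t^-1 *: (wave (c i * t) (mode x i) - mode x i) - mode y i.
    by move=> t0; rewrite modeB modeZ modeB mode_semigroup// ltW.
  by split=> /near0_rightP[d d0 hd]; apply/near0_rightP; exists d => // t td;
    have := hd t td; rewrite E//; case/andP: td.
by split=> h i e e0; [apply: (H i e).1 (h i e e0)|apply: (H i e).2 (h i e e0)].
Qed.

(** A mode u with zero time derivative satisfies D t = o(t^2), where D t is the
    squared distance from u to its position after time t, whereas
    D (2 t) <= 4 D t because the evolution is isometric. Repeated halving of the
    time T at which u has become - u gives D T = 0, so u = 0. *)
Lemma generator_graph_inj x : generator_graph (energy_norm p) semigroup x 0 -> x = 0.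
Proof.
move=> /generator_graphP g; apply: mode_inj => i; rewrite mode0.
set u := mode x i; have ci := speed_gt0 md i.
pose D (t : R) := rsq_norm (wave (c i * t) u - u).
have D2 t : 0 <= t -> D (2 * t) <= 4 * D t.
  move=> t0; have ct := speed_mul_ge0 i t0.
  rewrite /D (_ : c i * (2 * t) = c i * t + c i * t); last by ring.
  rewrite waveD//; set v := wave _ u.
  have -> : wave (c i * t) v - u = (wave (c i * t) (v - u)) + (v - u).
    by rewrite waveB /v addrA subrK.
  rewrite (le_trans (rsq_normD_le _ _))// rsq_norm_wave//; lra.
have Dpow k t : 0 <= t -> D (2 ^+ k * t) <= 4 ^+ k * D t.
  elim: k t => [|k IH] t t0; first by rewrite !expr0 !mul1r.
  have kt : 0 <= 2 ^+ k * t by apply: mulr_ge0 => //; exact: exprn_ge0.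
  rewrite !exprS -!mulrA; apply: (le_trans (D2 _ kt)).
  by apply: ler_wpM2l => //; exact: IH.
(* half a period of the i-th string *)
pose T := 2 / c i.
have T0 : 0 < T by rewrite divr_gt0.
have DT : D T = 4 * rsq_norm u.
  rewrite /D /T mulrCA divff ?mulr1 ?gt_eqF// wave2 -opprD -mulr2n -scaleN1r -scaler_nat.
  by rewrite scalerA rsq_normZ; congr (_ * _); ring.
suff small (e : R) : 0 < e -> D T <= T ^+ 2 * e.
  apply: rsq_norm_eq0; apply/eqP; rewrite eq_le rsq_norm_ge0 andbT; apply/ler_addgt0Pr => e e0.
  have e0' : 0 < 4 * e / T ^+ 2 by rewrite divr_gt0 ?exprn_gt0// mulr_gt0.
  have := small _ e0'; rewrite DT add0r mulrCA divff ?mulr1 ?ler_pM2l//.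
  by rewrite gt_eqF// exprn_gt0.
move=> e0; have /near0_rightP[d d0 hd] := g i e e0.
have [k kd] : exists k : nat, T / 2 ^+ k < d.
  exists (Num.bound (T / d)).
  have Td : 0 <= T / d by rewrite divr_ge0 ?ltW.
  rewrite ltr_pdivrMr ?exprn_gt0// mulrC -ltr_pdivrMr//.
  apply: (lt_le_trans (archi_boundP Td)).
  by rewrite -natrX ler_nat ltnW// ltn_expl.
set t := T / 2 ^+ k in kd.
have t0 : 0 < t by rewrite divr_gt0// exprn_gt0.
have := hd t; rewrite t0 kd => /(_ isT).
rewrite mode0 subr0 rsq_normZ -/u -/(D t) => Dt.
have -> : T = 2 ^+ k * t by rewrite /t mulrC divfK// expf_neq0// pnatr_eq0.
apply: (le_trans (Dpow k t (ltW t0))).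
rewrite exprMn -exprM mulnC exprM -[X in _ <= X]mulrA.
have -> : (2 ^+ 2 : R) = 4 by ring.
rewrite ler_pM2l ?exprn_gt0//.
by move: Dt; rewrite exprVn mulrC ler_pdivrMr ?exprn_gt0// mulrC.
Qed.

End actuator_semigroup.

(** * The generator *)

Section boundary_values.
Context {R : realType}.
Local Notation lam := (@lebesgue_measure R).
Implicit Types (f g : L2 R) (a : R).

Lemma has_valueD (k a b d : R) f g : has_value f a b -> has_value g a d ->
  has_value (k *: f + g) a (k * b + d).
Proof.
move=> [u [cu /L2_ae_eq fu <-]] [v [cv /L2_ae_eq gv <-]].
exists (fun z => k * u z + v z); split=> //.
  by move=> z; apply: cvgD; [apply: cvgMr; exact: cu|exact: cv].
apply/L2_ae_eq; have FF := ae_filter_ringOfSetsType lam.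
have /L2_ae_eq h1 := Lspace2_DE (k *: f) g.
have /L2_ae_eq h2 := Lspace2_ZE k f.
apply: filterS (filterI (filterI h1 h2) (filterI fu gv)) => z [[e1 e2] [e3 e4]] zI.
apply: (etrans (e1 zI)); congr (_ + _); last exact: e4.
by apply: (etrans (e2 zI)); rewrite -(e3 zI).
Qed.

(** H10 is the case a = 0. The velocities of the domain vanish at 0, its strains
    at 1. *)
Definition H1_vanishing a : set (L2 R) := [set f | H1 f /\ has_value f a 0].

Lemma H1_vanishing0 a : H1_vanishing a 0.
Proof.
split; first by exists 0; exact: weak_derivative0.
exists (cst 0); split=> //; last exact: Lspace2_0E.
by apply: continuous_subspaceT => z; exact: cvg_cst.
Qed.

Lemma H1_vanishingD a (k : R) f g : H1_vanishing a f -> H1_vanishing a g ->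
  H1_vanishing a (k *: f + g).
Proof.
move=> [Hf f0] [Hg g0]; split; first exact: H1D.
by have := has_valueD k f0 g0; rewrite mulr0 addr0.
Qed.

Lemma H1_vanishingZ a (k : R) f : H1_vanishing a f -> H1_vanishing a (k *: f).
Proof.
by move=> Hf; rewrite -[_ *: _]addr0; apply: H1_vanishingD => //; exact: H1_vanishing0.
Qed.

Lemma act_H1_vanishing a (P : 'M[R]_3) (F : 'I_3 -> L2 R) i :
  (forall j, H1_vanishing a (F j)) -> H1_vanishing a (act P F i).
Proof.
move=> HF; rewrite /act; elim/big_rec: _ => [|j f _ Hf]; first exact: H1_vanishing0.
exact: H1_vanishingD.
Qed.

Lemma dz0 : dz (0 : L2 R) = 0.
Proof. by apply: dz_eq; exact: weak_derivative0. Qed.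

Lemma dzZ (k : R) f : H1 f -> dz (k *: f) = k *: dz f.
Proof.
move=> Hf; rewrite -[k *: f]addr0 dzD ?dz0 ?addr0//.
by exists 0; exact: weak_derivative0.
Qed.

Lemma dz_act (P : 'M[R]_3) (F : 'I_3 -> L2 R) i : (forall j, H1 (F j)) ->
  dz (act P F i) = act P (fun j => dz (F j)) i.
Proof.
move=> HF; rewrite /act.
suff [] : H1 (\sum_j P i j *: F j) /\
  dz (\sum_j P i j *: F j) = \sum_j P i j *: dz (F j) by [].
elim/big_rec2: _ => [|j f g _ [Hg e]].
  by split; [exists 0; exact: weak_derivative0|exact: dz0].
by split; [exact: H1D|rewrite dzD// e].
Qed.

Lemma value_at_H1 f a : H1 f -> has_value f a (value_at f a).
Proof.
move=> /H1_primE[k hk].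
exact: (@xgetPex _ 0 [set b | has_value f a b] (ex_intro _ _ (prim_has_value a hk))).
Qed.

Lemma primitive_vanishing_at1 g : exists f, weak_derivative f g /\ has_value f 1 0.
Proof.
pose k := - prim (cut g) 1.
have cu : {within `[0, 1], continuous (fun z => k + prim (cut g) z)}.
  by move=> z; apply: cvgD; [exact: cvg_cst|exact: prim_continuous_cut].
have [f hf] := continuous_L2_class cu.
exists f; split; first exact: weak_derivative_prim hf.
by have := prim_has_value 1 hf; rewrite /k addNr.
Qed.

End boundary_values.

Section actuator_generator.
Context {R : realType} (p : actuator R) (md : modes p).
Local Notation P := (modal md).
Local Notation Q := (modal_inv md).
Local Notation c := (speed md).
Local Notation N := (wave_matrix p).
Local Notation Aop := (actuator_op p).
Implicit Types (x y : state R).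

Lemma strain_op x j : (forall k, H10 (velocity x k)) ->
  strain (Aop x) j = dz (velocity x j).
Proof.
case: x => [[[[[x1 x2] x3] x4] x5] x6] H.
have E (f : L2 R) : H10 f -> (insubd (0 : H10type R) f : L2 R) = f.
  by move=> Hf; rewrite insubdK//; exact: mem_set.
move: j; apply: forall3; rewrite /= /vec3 /= E//; [exact: (H 0)|exact: (H 1)|exact: (H 2%:R)].
Qed.

Lemma velocity_op x j : velocity (Aop x) j = act N (fun k => dz (strain x k)) j.
Proof.
case: x => [[[[[x1 x2] x3] x4] x5] x6].
rewrite /act sum3 !mxE; move: j; apply: forall3; rewrite /= /vec3 /=.
- by rewrite scale0r addr0 scaleNr.
- move: (dz (dz x1)) (dz (dz x2)) (dz (dz x3)) => f1 f2 f3.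
  by rewrite (scale0r f1) (scale0r f3) (addr0 (0 + _)) (add0r (_ *: f2)).
- exact: erefl.
Qed.

(** A mode diagonalises the matrix of the system, and constant matrices commute
    with the derivative in z. *)
Lemma mode_op x i : (forall k, H10 (velocity x k)) -> (forall k, H1 (strain x k)) ->
  mode md (Aop x) i = c i *: (dz (mode md x i).2, dz (mode md x i).1).
Proof.
move=> Hv Hs; rewrite /mode; congr (_, _) => /=.
  rewrite (eq_act _ _ (fun j => strain_op j Hv)) dz_act// => j.
  by case: (Hv j).
rewrite (eq_act _ _ (velocity_op x)) act_comp dzZ; last first.
  rewrite /act; elim/big_rec: _ => [|j f _ Hf]; last exact: H1D.
  by exists 0; exact: weak_derivative0.
rewrite dz_act// scalerA /act scaler_sumr; apply: eq_bigr => j _.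
by rewrite scalerA mxE (wave_modes md) expr2.
Qed.

(** The three left-hand sides are the components of K d, where K is the matrix of
    the stiffness form, and this form is definite. *)
Lemma boundary_strains (d : 'I_3 -> R) :
  stiffness p * area p * d 0 - stiffness p * inertia0 p * d 1
    - gamma p * beta p * area p * d 2%:R = 0 ->
  stiffness p * inertia p * d 1 - stiffness p * inertia0 p * d 0
    + gamma p * beta p * inertia0 p * d 2%:R = 0 ->
  beta p * area p * d 2%:R
    - gamma p * beta p * (area p * d 0 - inertia0 p * d 1) = 0 ->
  forall i, d i = 0.
Proof.
move=> b1 b2 b3.
have : energy_density p d (fun=> 0) = 0.
  rewrite /energy_density.
  transitivity (d 0 * (stiffness p * area p * d 0 - stiffness p * inertia0 p * d 1
    - gamma p * beta p * area p * d 2%:R) + d 1 * (stiffness p * inertia p * d 1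
    - stiffness p * inertia0 p * d 0 + gamma p * beta p * inertia0 p * d 2%:R) +
    d 2%:R * (beta p * area p * d 2%:R
    - gamma p * beta p * (area p * d 0 - inertia0 p * d 1))); first by ring.
  by rewrite b1 b2 b3 !mulr0 !addr0.
rewrite (energy_modes md) => /eqP; rewrite psumr_eq0; last first.
  by move=> i _; rewrite mulr_ge0 ?addr_ge0 ?sqr_ge0// ltW// weight_gt0.
move=> /allP h i.
have Pd j : act P (d : 'I_3 -> R^o) j = 0.
  have := h j (mem_index_enum _); rewrite implyTb mulf_eq0 gt_eqF ?weight_gt0//=.
  rewrite paddr_eq0 ?sqr_ge0// => /andP[]; rewrite sqrf_eq0 mulf_eq0.
  by rewrite gt_eqF ?speed_gt0//= => /eqP.
rewrite -[LHS](act_modalK md (d : 'I_3 -> R^o)) (eq_act _ _ Pd) /act.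
by rewrite big1// => j _; rewrite scaler0.
Qed.

Lemma domP x : actuator_dom p x <->
  (forall j, H1_vanishing 1 (strain x j)) /\ (forall j, H10 (velocity x j)).
Proof.
have one01 : (0 : R) <= (1 : R) <= 1 by rewrite ler01 lexx.
case: x => [[[[[x1 x2] x3] x4] x5] x6]; split.
  move=> [[[_ h1] [_ h2] [_ h3]] [v1 v2 v3] b1 b2 b3]; split; last exact: forall3.
  pose d := vec3 (value_at (dz x1) 1) (value_at (dz x2) 1) (value_at (dz x3) 1).
  have d0 := @boundary_strains d b1 b2 b3.
  have V (f : L2 R) : H1 f -> value_at f 1 = 0 -> H1_vanishing 1 f.
    by move=> Hf f0; split=> //; rewrite -[X in has_value _ _ X]f0; exact: value_at_H1.
  have e1 : value_at (dz x1) 1 = 0 := d0 0.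
  have e2 : value_at (dz x2) 1 = 0 := d0 1.
  have e3 : value_at (dz x3) 1 = 0 := d0 2%:R.
  by apply: forall3; [exact: (V _ h1 e1)|exact: (V _ h2 e2)|exact: (V _ h3 e3)].
move=> [s v].
have [h1 k1] : H1_vanishing 1 (dz x1) := s 0.
have [h2 k2] : H1_vanishing 1 (dz x2) := s 1.
have [h3 k3] : H1_vanishing 1 (dz x3) := s 2%:R.
split.
- by split; split=> //; exact: (H10typeP _).1.
- by split; [exact: (v 0)|exact: (v 1)|exact: (v 2%:R)].
all: rewrite (value_at_eq one01 k1) (value_at_eq one01 k2) (value_at_eq one01 k3).
all: by ring.
Qed.

(** The modes of a state of the domain satisfy the boundary conditions of a
    string, since both conditions are linear. *)
Lemma dom_generator_graph x : actuator_dom p x ->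
  generator_graph (energy_norm p) (semigroup md) x (Aop x).
Proof.
move=> /domP[s v]; apply/generator_graphP => i e e0.
have ci := speed_gt0 md i.
have Hs j : H1 (strain x j) by case: (s j).
rewrite mode_op//.
have [Hf f1] : H1_vanishing 1 (mode md x i).1.
  by apply: H1_vanishingZ; exact: act_H1_vanishing.
have Hg : H10 (mode md x i).2 by exact: (@act_H1_vanishing _ 0).
have one01 : (0 : R) <= (1 : R) <= 1 by rewrite ler01 lexx.
have e0' : 0 < e / c i ^+ 2 by rewrite divr_gt0// exprn_gt0.
have := wave_derivative Hf (value_at_eq one01 f1) Hg e0'.
rewrite -surjective_pairing => /(near0_scale ci).
apply: filterS => t; rewrite sq_normE lee_fin ler_pdivlMr ?exprn_gt0// => le.
set u := mode md x i in le *; set q := (dz u.2, dz u.1) in le *.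
have rescale (V : lmodType R) (k : R) (a b : V) : k != 0 ->
    t^-1 *: a - k *: b = k *: ((k * t)^-1 *: a - b).
  by move=> k0; rewrite scalerBr scalerA invfM mulrA mulfV// mul1r.
rewrite (rescale _ _ _ _ (speed_neq0 md i)).
by rewrite rsq_normZ mulrC.
Qed.

(** Invert the matrix of the system, then take the primitives that vanish at 1 as
    strains. *)
Lemma op_onto y : exists2 x, actuator_dom p x & Aop x = y.
Proof.
pose F := act Q (fun i => (c i ^+ 2)^-1 *: act P (velocity y) i).
have NF j : act N F j = velocity y j.
  rewrite -[LHS](act_modalK md (act N F)) -[RHS](act_modalK md (velocity y)).
  apply: eq_act => i.
  have -> : act P (act N F) i = c i ^+ 2 *: act P F i.
    rewrite act_comp /act scaler_sumr; apply: eq_bigr => k _.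
    by rewrite scalerA mxE (wave_modes md).
  rewrite /F act_comp (modalK md) act1 scalerA mulfV ?scale1r//.
  by rewrite gt_eqF// exprn_gt0// speed_gt0.
pose S j : L2 R := sval (cid (primitive_vanishing_at1 (F j))).
have SP j : weak_derivative (S j) (F j) /\ has_value (S j) 1 0.
  exact: svalP (cid (primitive_vanishing_at1 (F j))).
case: y F NF S SP => [[[[[y1 y2] y3] y4] y5] y6]; set y := (_, y6).
move=> F NF S SP.
pose x := state_of S (vec3 (y1 : L2 R) (y2 : L2 R) (y3 : L2 R)).
have vx : forall j, H10 (velocity x j) by apply: forall3; exact: H10typeP.
have sx j : H1_vanishing 1 (strain x j).
  by rewrite strain_state_of; have [h1 h2] := SP j; split=> //; exists (F j).
exists x; first exact/domP.
apply: state_eq => j.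
  by rewrite strain_op//; move: j; apply: forall3.
rewrite velocity_op -NF; apply: eq_act => k.
by rewrite strain_state_of (dz_eq (SP k).1).
Qed.

Lemma rsq_normB_le (f g : L2 R * L2 R) (e : R) : rsq_norm f <= e / 4 -> rsq_norm g <= e / 4 ->
  rsq_norm (f + -1 *: g) <= e.
Proof.
move=> fe ge; apply: (le_trans (rsq_normD_le _ _)); rewrite rsq_normZ sqrrN expr1n mul1r; lra.
Qed.

(** The operator is onto and the generator injective, so the generator does not
    extend the operator properly. *)
Lemma generator_graph_dom x y :
  generator_graph (energy_norm p) (semigroup md) x y -> actuator_dom p x.
Proof.
move=> gxy; have [x' dx' Ax'] := op_onto y.
have gx' := dom_generator_graph dx'; rewrite Ax' in gx'.
suff -> : x = x' by [].
apply/eqP; rewrite -subr_eq0; apply/eqP; apply: (@generator_graph_inj _ _ md).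
apply/generator_graphP => i e e0.
have e40 : 0 < e / 4 by rewrite divr_gt0.
have h1 := (generator_graphP md x y).1 gxy i _ e40.
have h2 := (generator_graphP md x' y).1 gx' i _ e40.
apply: filterS2 h1 h2 => t hu hv.
rewrite mode0 subr0 modeB (waveB _ (mode md x i)).
have sub_sub (V : lmodType R) (k : R) (a b d h r : V) :
    k *: ((a - b) - (d - h)) = (k *: (a - d) - r) + -1 *: (k *: (b - h) - r).
  rewrite scaleN1r [- (_ - r)]opprB addrA subrK -scalerBr; congr (_ *: _).
  by rewrite !opprD !opprK !addrA; congr (_ + _); rewrite addrAC.
rewrite (sub_sub _ _ _ _ _ _ (mode md y i)).
exact: rsq_normB_le hu hv.
Qed.

End actuator_generator.

Theorem theorem2 (R : realType) (p : actuator R)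
    (hrho : 0 < rho p) (hmu : 0 < mu p) (hbeta : 0 < beta p)
    (hCE11 : 0 < CE11 p) (hgb : 0 < gb p) (hab : ha p < hb p) :
  exists T : R -> {linear state R -> state R},
    [/\ C0_semigroup (energy_norm p) T,
        is_generator (energy_norm p) T (actuator_dom p) (actuator_op p) &
        forall t : R, 0 <= t -> (opnorm (energy_norm p) (T t) <= 1)%E].
Proof.
have md := modes_exist hrho hmu hbeta hCE11 hgb hab.
exists (semigroup md); split; first exact: semigroup_C0; last exact: opnorm_semigroup.
split=> x; last exact: dom_generator_graph.
split=> [dx|[y]]; last exact: generator_graph_dom.
by exists (actuator_op p x); exact: dom_generator_graph.
Qed.
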